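(* Let $\Phi$ and $\Phi_N$ denote the flows of the cubic nonlinear Klein-Gordon equation $u_{tt}-\Delta u+u+u^3=0$ and of the truncated equation $(u_N)_{tt}-\Delta u_N+u_N+P_N(P_Nu_N)^3=0$ on $\mathbb{T}^3$, respectively. Let $\lambda,R>0$. Then for any $T>0$ and for every $(u_0,u_1)\in\Sigma_\lambda\cap\mathbf{B}_R$, $$\sup_{t\in[0,T]}\|\Phi(t)(u_0,u_1)-\Phi_N(t)(u_0,u_1)\|_{\mathcal{H}^{1/2}_x(\mathbb{T}^3)}\le C(\lambda,T,R)\,\varepsilon_1(N)$$ with $\varepsilon_1(N)\to0$ as $N\to\infty$.
   Context: Notation: all functions are real-valued; $\mathcal{H}^s=H^s(\mathbb{T}^3)\times H^{s-1}(\mathbb{T}^3)$; $\mathbf{B}_R$ is the closed ball of radius $R$ centered at $0$ in $\mathcal{H}^{1/2}$. $P_N u=\widehat{u}(0)+\sum_{n\ne0}\psi(|n|^2/N^2)\widehat{u}(n)e^{in\cdot x}$ with $\psi$ a fixed smooth cut-off function (compactly supported, equal to $1$ near $0$). Flows send $(u_0,u_1)$ to $(u(t),\partial_tu(t))$, resp. $(u_N(t),\partial_tu_N(t))$. Free evolution: $S(t)(u_0,u_1)=\cos(t\langle\nabla\rangle)u_0+\frac{\sin(t\langle\nabla\rangle)}{\langle\nabla\rangle}u_1$, $\langle\nabla\rangle=(1-\Delta)^{1/2}$. Randomization: let $\{(h_k,l_k)\}_{k\in\mathbb{Z}^3}$ be zero-mean complex Gaussians (uniformly bounded variances) with $h_{-k}=\overline{h_k}$,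 $l_{-k}=\overline{l_k}$, such that $\{h_0,\mathrm{Re}\,h_k,\mathrm{Im}\,h_k\}_{k\in\mathcal{I}}$ are independent real Gaussians, where $\mathbb{Z}^3=\mathcal{I}\cup(-\mathcal{I})\cup\{0\}$ disjointly, and similarly for $l_k$. For $(f_0,f_1)\in\mathcal{H}^{1/2}$, $\mu_{(f_0,f_1)}$ is the law on $\mathcal{H}^{1/2}$ of $\bigl(\sum_kh_k\widehat{f}_0(k)e^{ik\cdot x},\sum_kl_k\widehat{f}_1(k)e^{ik\cdot x}\bigr)$; $\mathcal{M}^{1/2}$ is the set of all such measures. Fix $\mu\in\mathcal{M}^{1/2}$. Sets: fix $\gamma\in(0,1/2)$ sufficiently close to $1/2$, let $\Theta_1=\{(u_0,u_1)\in\mathcal{H}^{1/2}:\|S(t)(1-\Delta)^{\gamma/2}(u_0,u_1)\|_{L^6_x}^6\in L^1_{loc}(\mathbb{R}_t)\}$, $\Theta_2=\{(u_0,u_1)\in\mathcal{H}^{1/2}:\|S(t)(u_0,u_1)\|_{L^\infty_x}\in L^1_{loc}(\mathbb{R}_t)\}$, $\Sigma=(\Theta_1\cap\Theta_2)+\mathcal{H}^1$. For $(u_0,u_1)\in\Sigma$ it is known that there is a unique global solution $u=S(t)(u_0,u_1)+w$ of the full equation with $(w,\partial_tw)\in C(\mathbb{R};\mathcal{H}^1)$, and that the truncated equations have global solutions $u_N=S(t)(u_0,u_1)+w_N$. Fix $\varepsilon>0$; it is known that there are $C,c,\theta>0$ such that each $(u_0,u_1)\in\Sigma$ admits $M=M(u_0,u_1)>0$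 for which $\|(w,\partial_tw)(t)\|_{\mathcal{H}^1}$, $\|(w_N,\partial_tw_N)(t)\|_{\mathcal{H}^1}\le C(M+|t|)^{1+\varepsilon}$ and $\|u(t)\|_{L^4},\|P_Nu_N(t)\|_{L^4}\le C(M+|t|)^{1/2+\varepsilon}$ for all $t,N$, with $\mu(M>\lambda)\le Ce^{-c\lambda^\theta}$. With this $C$, $\Sigma_\lambda$ is the set of $(u_0,u_1)\in\Sigma$ such that for all $t\in\mathbb{R}$ and all $N$: $\|(w,\partial_tw)(t)\|_{\mathcal{H}^1}$, $\|(w_N,\partial_tw_N)(t)\|_{\mathcal{H}^1}$, $\|u(t)\|_{L^4_x}$, $\|u_N(t)\|_{L^4_x}$ are all $\le C(\lambda+|t|)^{1+\varepsilon}$, and $\|(1-\Delta)^{\gamma/2}S(t)(u_0,u_1)\|_{L^6_{t,x}([0,T]\times\mathbb{T}^3)}\le C(T)\lambda$, where $T>0$ is the time under consideration and $C(T)$ a fixed constant depending on $T$. *)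

(* Defs.v *)
From HB Require Import structures.
From mathcomp Require Import all_boot all_order all_algebra.
From mathcomp Require Import complex.
From mathcomp Require Import all_classical all_reals all_analysis.
Set Implicit Arguments.
Unset Strict Implicit.
Unset Printing Implicit Defensive.
Import Order.TTheory GRing.Theory Num.Theory.
Import numFieldNormedType.Exports.

Local Open Scope classical_set_scope.
Local Open Scope ring_scope.
Local Open Scope complex_scope.

(** ** The torus and Fourier coefficients *)

(* The torus (R/2 pi Z)^3 is represented by the cube [0, 2 pi]^3: a function on
   it is a function on R^3, looked at modulo torus_measure-null sets. *)

Notation torus R :=
  (measurableTypeR R * measurableTypeR R * measurableTypeR R)%type.

Lemma circle_measure_fin (R : realType) :
  (lebesgue_measure (`[0%R, (2 * pi)%R] : set R) < +oo)%E.
Proof. by rewrite lebesgue_measure_itv; case: ifP => //= _; rewrite ltry. Qed.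

Definition circle_measure (R : realType) :
    {finite_measure set (measurableTypeR R) -> \bar R} :=
  mfrestr (f := Measure.sort (@lebesgue_measure R)) (measurable_itv _)
    (@circle_measure_fin R).

Definition torus_measure (R : realType) :
    {measure set (torus R) -> \bar R} :=
  ((circle_measure R \x circle_measure R) \x circle_measure R)%E.

Definition Z3 := (int * int * int)%type.

Definition normsq (R : realType) (k : Z3) : R :=
  (k.1.1%:~R) ^+ 2 + (k.1.2%:~R) ^+ 2 + (k.2%:~R) ^+ 2.

(* <k>^2, the symbol of 1 - Delta. *)
Definition bracket2 (R : realType) (k : Z3) : R := 1 + normsq R k.

Definition dotp (R : realType) (k : Z3) (x : torus R) : R :=
  k.1.1%:~R * x.1.1 + k.1.2%:~R * x.1.2 + k.2%:~R * x.2.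

(* (2 pi)^-3 times the integral of f(x) exp(- i k.x), for real-valued f. *)
Definition fourier (R : realType) (f : torus R -> R) (k : Z3) : R[i] :=
  Complex
    ((2 * pi) ^- 3 *
       Rintegral (torus_measure R) setT (fun x => f x * cos (dotp k x)))
    (- ((2 * pi) ^- 3 *
       Rintegral (torus_measure R) setT (fun x => f x * sin (dotp k x)))).

(* g_sigma_algebraType (used for laws on phase R) requires a pointed type. *)
HB.instance Definition _ (R : realType) := isPointed.Build R[i] 0.

(* A distribution on the torus is given by the family of its Fourier
   coefficients. All the regularities H^s are then treated uniformly, including
   H^(-1/2), whose elements are not functions. *)
Notation distr R := (Z3 -> R[i]).

(* A pair (u, partial_t u). *)
Notation phase R := (distr R * distr R)%type.

Definition real_valued (R : realType) (c : distr R) : Prop :=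
  forall k : Z3, c (- k) = conjc (c k).

(* The distribution with coefficients c is the integrable function f. *)
Definition is_function (R : realType) (c : distr R) (f : torus R -> R) :=
  (torus_measure R).-integrable setT (EFin \o f) /\
  forall k, fourier f k = c k.

(* The L^p norm, with value +oo if c is not a function in L^p. Two functions
   with the same coefficients agree almost everywhere, so the infimum is over a
   set with at most one element. *)
Definition Lnorm_distr (R : realType) (p : \bar R) (c : distr R) : \bar R :=
  ereal_inf [set Lnorm (torus_measure R) p (EFin \o f) |
             f in [set f | is_function c f]].

Definition is_cube (R : realType) (c g : distr R) : Prop :=
  exists2 f, is_function c f & is_function g (fun x => f x ^+ 3).

(* Fourier multiplier with symbol m. *)
Definition multiplier (R : realType) (m : Z3 -> R) (c : distr R) : distr R :=
  fun k => (m k)%:C * c k.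

(** ** Sobolev spaces *)

Definition sobolev_norm (R : realType) (s : R) (c : distr R) : \bar R :=
  poweR (\esum_(k in [set: Z3])
           (bracket2 R k `^ s * (complex.Re (c k) ^+ 2 + complex.Im (c k) ^+ 2))%:E)
        2^-1.

Definition phase_norm (R : realType) (s : R) (d : phase R) : \bar R :=
  poweR (sobolev_norm s d.1 ^+ 2 + sobolev_norm (s - 1) d.2 ^+ 2)%E 2^-1.

(* H^s x H^(s-1), real-valued. *)
Definition phase_space (R : realType) (s : R) : set (phase R) :=
  [set d | [/\ real_valued d.1, real_valued d.2 & (phase_norm s d < +oo)%E]].

Definition phase_ball (R : realType) (s r : R) : set (phase R) :=
  [set d | phase_space s d /\ (phase_norm s d <= r%:E)%E].

(** ** Linear and nonlinear flows *)

(* (S(t)d, partial_t S(t)d). *)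
Definition free_flow (R : realType) (t : R) (d : phase R) : phase R :=
  let om k := Num.sqrt (bracket2 R k) in
  (multiplier (fun k => cos (t * om k)) d.1 +
   multiplier (fun k => sin (t * om k) / om k) d.2,
   multiplier (fun k => - (om k * sin (t * om k))) d.1 +
   multiplier (fun k => cos (t * om k)) d.2).

Definition is_cutoff (R : realType) (psi : R -> R) : Prop :=
  [/\ forall n x, derivable (derive1n n psi) x 1,
      exists r, forall x, r < `|x| -> psi x = 0 &
      \forall x \near 0, psi x = 1].

Definition truncation (R : realType) (psi : R -> R) (N : nat) :
    distr R -> distr R :=
  multiplier (fun k => if k == 0 then 1 else psi (normsq R k / N%:R ^+ 2)).

Definition is_cderive (R : realType) (z : R -> R[i]) (t : R) (dz : R[i]) :=
  is_derive t 1 (fun s => complex.Re (z s)) (complex.Re dz) /\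
  is_derive t 1 (fun s => complex.Im (z s)) (complex.Im dz).

(* U = (u, partial_t u) solves u_tt - Delta u + u + Pi ((Pi u)^3) = 0 in the
   sense of distributions, i.e. tested against each exponential exp(i k.x).
   For u continuous with values in H^(1/2), hence in L^3, the coefficients of
   (Pi u)^3 are continuous in time and each mode is a classical second order
   ODE. *)
Definition solves_nlkg (R : realType) (Pi : distr R -> distr R)
    (U : R -> phase R) : Prop :=
  exists F : R -> distr R, forall t : R,
    is_cube (Pi (U t).1) (F t) /\
    forall k : Z3,
      is_cderive (fun s => (U s).1 k) t ((U t).2 k) /\
      is_cderive (fun s => (U s).2 k) t
        (- ((bracket2 R k)%:C * (U t).1 k) - Pi (F t) k).

Definition phase_continuous (R : realType) (s : R) (W : R -> phase R) : Prop :=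
  (forall t, phase_space s (W t)) /\
  (forall t, phase_norm s (W t' - W t) @[t' --> t] --> 0%E).

(* Phi t d is the solution, with data d at t = 0, of the form S(t)d + w with
   (w, partial_t w) in C(R; H^1 x L^2), for every d in the set A. *)
Definition is_nlkg_flow (R : realType) (Pi : distr R -> distr R)
    (A : set (phase R)) (Phi : R -> phase R -> phase R) : Prop :=
  forall d, A d ->
    [/\ Phi 0 d = d,
        phase_continuous 1 (fun t => Phi t d - free_flow t d) &
        solves_nlkg Pi (fun t => Phi t d)].

(** ** The sets of initial data *)

Definition L1loc (R : realType) (g : R -> \bar R) : Prop :=
  forall a b : R, (@lebesgue_measure R).-integrable `[a, b] g.

(* S(t) (1 - Delta)^(gamma/2) d. *)
Definition smoothed_free (R : realType) (gamma t : R) (d : phase R) : distr R :=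
  let J := multiplier (fun k => bracket2 R k `^ (gamma / 2)) in
  (free_flow t (J d.1, J d.2)).1.

Definition Theta1 (R : realType) (gamma : R) : set (phase R) :=
  [set d | phase_space 2^-1 d /\
     L1loc (fun t => (Lnorm_distr 6%:E (smoothed_free gamma t d) ^+ 6)%E)].

Definition Theta2 (R : realType) : set (phase R) :=
  [set d | phase_space 2^-1 d /\
     L1loc (fun t => Lnorm_distr +oo%E (free_flow t d).1)].

Definition Sigma (R : realType) (gamma : R) : set (phase R) :=
  [set d | exists a b, [/\ (Theta1 gamma `&` @Theta2 R) a,
                           phase_space 1 b & d = a + b]].

(* The norm in L^6 ([0, T] x torus) of S(t) (1 - Delta)^(gamma/2) d. *)
Definition L6tx_smoothed_free (R : realType) (gamma T : R) (d : phase R) :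
    \bar R :=
  poweR (\int[lebesgue_measure]_(t in `[0%R, T])
           (Lnorm_distr 6%:E (smoothed_free gamma t d) ^+ 6)%E)%E
        6^-1.

Definition Sigma_lambda (R : realType) (gamma eps C : R) (CT : R -> R)
    (Phi : R -> phase R -> phase R) (PhiN : nat -> R -> phase R -> phase R)
    (T lam : R) : set (phase R) :=
  [set d | [/\ Sigma gamma d,
     forall t : R,
       let B := (C * (lam + `|t|) `^ (1 + eps))%:E in
       [/\ (phase_norm 1 (Phi t d - free_flow t d)%R <= B)%E,
           (Lnorm_distr 4%:E (Phi t d).1 <= B)%E &
           forall N, (0 < N)%N ->
             (phase_norm 1 (PhiN N t d - free_flow t d)%R <= B)%E /\
             (Lnorm_distr 4%:E (PhiN N t d).1 <= B)%E] &
     (L6tx_smoothed_free gamma T d <= (CT T * lam)%:E)%E]].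

(** ** Randomized initial data *)

(* The sigma-algebra generated by the Fourier coefficients; its trace on
   H^(1/2) x H^(-1/2) is the Borel sigma-algebra. *)
Definition cylinders (R : realType) : set (set (phase R)) :=
  [set A | exists (k : Z3) (B : set R), measurable B /\
     [\/ A = [set d | B (complex.Re (d.1 k))], A = [set d | B (complex.Im (d.1 k))],
         A = [set d | B (complex.Re (d.2 k))] | A = [set d | B (complex.Im (d.2 k))]]].

Definition mutually_independent d (Om : measurableType d) (R : realType)
    (P : probability Om R) (I : eqType) (J : set I) (X : I -> Om -> R) : Prop :=
  forall (s : seq I) (B : I -> set R), uniq s ->
    (forall i, i \in s -> J i /\ measurable (B i)) ->
    P [set w | forall i, i \in s -> B i (X i w)] =
      (\prod_(i <- s) P (X i @^-1` B i))%E.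

Definition centered_gaussian d (Om : measurableType d) (R : realType)
    (P : probability Om R) (X : Om -> R) (sigma : R) : Prop :=
  measurable_fun setT X /\
  forall B : set R, measurable B -> P (X @^-1` B) = normal_prob 0 sigma B.

(* Z^3 = half `|` - half `|` {0}, disjointly. *)
Definition half_lattice (half : set Z3) : Prop :=
  [/\ ~ half 0, forall k, ~ (half k /\ half (- k)) &
      forall k, [\/ k = 0, half k | half (- k)]].

(* The real family {h_0, Re h_k, Im h_k : k in half} is indexed by the pairs
   (k, b), where b = true stands for the real part. *)
Definition gaussian_coefs d (Om : measurableType d) (R : realType)
    (P : probability Om R) (half : set Z3) (h : Z3 -> Om -> R[i]) : Prop :=
  let J : set (Z3 * bool) := [set i | half i.1 \/ i = (0, true)] in
  let X (i : Z3 * bool) (w : Om) :=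
    if i.2 then complex.Re (h i.1 w) else complex.Im (h i.1 w) in
  [/\ forall k w, h (- k) w = conjc (h k w),
      exists K, forall i, J i ->
        exists2 sigma, 0 < sigma <= K & centered_gaussian P (X i) sigma &
      mutually_independent P J X].

Definition randomized_law (R : realType)
    (mu : probability (g_sigma_algebraType (@cylinders R)) R) : Prop :=
  exists (f : phase R) (d : measure_display) (Om : measurableType d)
         (P : probability Om R) (half : set Z3) (h l : Z3 -> Om -> R[i]),
    [/\ phase_space 2^-1 f, half_lattice half,
        gaussian_coefs P half h, gaussian_coefs P half l &
        forall A : set (g_sigma_algebraType (@cylinders R)), measurable A ->
          mu A = P [set w | A ((fun k => h k w * f.1 k),
                               (fun k => l k w * f.2 k))]].

(* The set {M > lambda} is not assumed measurable: its measure is understood as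
   outer measure. *)
Definition apriori_bounds (R : realType) (psi : R -> R) (gamma eps : R)
    (mu : probability (g_sigma_algebraType (@cylinders R)) R)
    (Phi : R -> phase R -> phase R) (PhiN : nat -> R -> phase R -> phase R)
    (C c theta : R) : Prop :=
  exists M : phase R -> R,
    (forall d, Sigma gamma d -> 0 < M d /\ forall t : R,
       let B1 := (C * (M d + `|t|) `^ (1 + eps))%:E in
       let B2 := (C * (M d + `|t|) `^ (2^-1 + eps))%:E in
       [/\ (phase_norm 1 (Phi t d - free_flow t d)%R <= B1)%E,
           (Lnorm_distr 4%:E (Phi t d).1 <= B2)%E &
           forall N, (0 < N)%N ->
             (phase_norm 1 (PhiN N t d - free_flow t d)%R <= B1)%E /\
             (Lnorm_distr 4%:E (truncation psi N (PhiN N t d).1) <= B2)%E]) /\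
    (forall lam, 0 < lam ->
       exists A : set (g_sigma_algebraType (@cylinders R)),
         [/\ measurable A, [set d | Sigma gamma d /\ lam < M d] `<=` A &
             (mu A <= (C * expR (- (c * lam `^ theta)))%:E)%E]).

(* Main.v *)
From HB Require Import structures.
Require Import Defs.
From mathcomp Require Import all_boot all_order all_algebra.
From mathcomp Require Import complex.
From mathcomp Require Import all_classical all_reals all_analysis.
From mathcomp Require Import measurable_realfun.
From mathcomp Require Import zify ring lra.
Import Order.TTheory GRing.Theory Num.Theory.
Import numFieldNormedType.Exports.
Local Open Scope classical_set_scope.
Local Open Scope ring_scope.
Set Implicit Arguments.
Unset Strict Implicit.
Unset Printing Implicit Defensive.

(** At each frequency, [V = Phi t d - PhiN N t d] solves
    [V'' + <k>^2 V = - (F - P_N FN)], where [F] and [FN] are the cubes of [u] and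
    of [P_N u_N], and [V] vanishes at time 0. The argument is an energy estimate
    for [V] in L^2 x H^(-1), closed by Gronwall's inequality, followed by an
    interpolation with the a priori bound in H^1 x L^2 (interpolate_half): an
    energy of order [1 / N] becomes a rate [N^(-1/4)] in H^(1/2).

    The forcing splits as [(1 - P_N) F + P_N (F - FN)]. The first part is small
    in H^(-1) since [F = u^3] is in L^2 (bessel_cube). The second one is linear
    in [u - P_N u_N], which is [V] up to a term of order [N^(-1/2)] as [u] is in
    H^(1/2); duality and the embedding of H^1 into L^6 (sobolev_trigpoly) bound
    it in H^(-1) by the L^2 norm of this difference times the squared L^6 norms
    of [u] and [P_N u_N] (cube_difference, nonlinear_estimate). These L^6 norms
    are finite at almost all times, although [u] only has the regularity of
    H^(1/2): [u] is the free evolution [z] plus a remainder [w] in H^1, which is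
    in L^6 by the Sobolev embedding, and [z] is controlled by the L^6 norm of
    [(1 - Delta)^(gamma/2) z], whose sixth power is integrable in time by the
    definition of the set of data. The resulting Gronwall factor is thus
    integrable in time, with a bound that only depends on the parameters of this
    set (sup_gronwall).

    All estimates are made on trigonometric polynomials, and are passed to
    functions by Fejer means. A function is the limit of its Fejer means in L^1
    (fejer_cvg1_integrable), and its L^2 and L^6 norms are at most the supremum
    of those of its Fejer means (fmean_lsc). Three facts on Fourier multipliers
    enter: [(1 - Delta)^(- s)] contracts L^6 for [0 < s < 1]
    (contraction6_bessel), so do the Fejer multipliers (contraction6_fejer), and
    the truncations [P_N] are bounded on L^6 uniformly in [N] (bounded6_tsym), as
    combinations of Fejer multipliers whose coefficients have bounded sums.

    In time, the L^6 norm of [(1 - Delta)^(gamma/2) z] is replaced by the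
    supremum over [n] of the norms of its [n]-th Fejer means. These are
    continuous in time, so that the differential inequality for the energy, which
    holds at all times but has an unbounded right-hand side, can be integrated by
    real induction (integrate_sup_inequality). *)

(** * Bounded measurable functions on finite measure spaces *)

Lemma eq_le_real (R : realDomainType) (x y : R) : x = y -> x <= y.
Proof. by move=> ->. Qed.

Section BoundedMeasurable.
Context d (T : measurableType d) (R : realType).
Implicit Types f g : T -> R.

(** The functions of this class are integrable for all finite measures, and it is
    closed under algebraic operations and integration in one variable. *)
Definition bmf f := measurable_fun setT f /\ exists M : R, forall x, `|f x| <= M.

Lemma bmf_cst (a : R) : bmf (fun=> a).
Proof. by split; [exact: measurable_cst | exists `|a|]. Qed.

Lemma bmfD f g : bmf f -> bmf g -> bmf (fun x => f x + g x).
Proof.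
move=> [mf [M fM]] [mg [N gN]]; split; first exact: measurable_funD.
by exists (M + N) => x; rewrite (le_trans (ler_normD _ _))// lerD.
Qed.

Lemma bmfM f g : bmf f -> bmf g -> bmf (fun x => f x * g x).
Proof.
move=> [mf [M fM]] [mg [N gN]]; split; first exact: measurable_funM.
by exists (M * N) => x; rewrite normrM ler_pM.
Qed.

Lemma bmfN f : bmf f -> bmf (fun x => - f x).
Proof.
move=> [mf [M fM]]; split; first exact: measurableT_comp.
by exists M => x; rewrite normrN.
Qed.

Lemma bmfB f g : bmf f -> bmf g -> bmf (fun x => f x - g x).
Proof. by move=> bf bg; apply: bmfD => //; apply: bmfN. Qed.

Lemma bmfZ (a : R) f : bmf f -> bmf (fun x => a * f x).
Proof. by apply: bmfM; apply: bmf_cst. Qed.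

Lemma bmfX n f : bmf f -> bmf (fun x => f x ^+ n).
Proof.
move=> bf; elim: n => [|n ih].
  by under eq_fun do rewrite expr0; apply: bmf_cst.
by under eq_fun do rewrite exprS; apply: bmfM.
Qed.

Lemma bmf_norm f : bmf f -> bmf (fun x => `|f x|).
Proof.
move=> [mf [M fM]]; split; first exact: measurableT_comp.
by exists M => x; rewrite normr_id.
Qed.

Lemma bmf_sum I (s : seq I) (F : I -> T -> R) : (forall i, bmf (F i)) ->
  bmf (fun x => \sum_(i <- s) F i x).
Proof.
move=> bF; elim: s => [|i s ih].
  by under eq_fun do rewrite big_nil; apply: bmf_cst.
by under eq_fun do rewrite big_cons; apply: bmfD.
Qed.

Lemma bmf_indic (A : set T) : measurable A -> bmf (\1_A : T -> R).
Proof.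
move=> mA; split; first exact: measurable_indic.
by exists 1 => x; rewrite indicE; case: (_ \in _); rewrite ?normr0 ?normr1.
Qed.

Lemma bmf_sqrt f : bmf f -> bmf (fun x => Num.sqrt (f x)).
Proof.
move=> [mf [M fM]]; split.
  by apply: (@measurableT_comp _ _ _ _ _ _ (@Num.sqrt R)) => //;
    exact: (continuous_measurable_fun (@sqrt_continuous R)).
exists (Num.sqrt M) => x; rewrite ger0_norm ?sqrtr_ge0// ler_wsqrtr//.
exact: le_trans (ler_norm _) (fM x).
Qed.

Variable mu : {measure set T -> \bar R}.
Hypothesis mufin : (mu setT < +oo)%E.

Lemma integrable_bmf f : bmf f -> mu.-integrable setT (EFin \o f).
Proof.
move=> [mf [M fM]]; apply: (@le_integrable _ _ _ mu setT measurableT _ (cst M%:E)).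
- exact/measurable_EFinP.
- move=> x _ /=; rewrite lee_fin.
  by apply: le_trans (fM x) _; apply: ler_norm.
- by apply/integrableP; split; [exact: measurable_cst | rewrite integral_cst//= lte_mul_pinfty].
Qed.

Lemma integrable_bmfM f g : bmf f -> mu.-integrable setT (EFin \o g) ->
  mu.-integrable setT (EFin \o (fun x => f x * g x)).
Proof.
move=> [mf [M fM]] ig.
have mg : measurable_fun setT g by exact/measurable_EFinP/(measurable_int _ ig).
apply: (@le_integrable _ _ _ mu setT measurableT _ (fun x => (M * g x)%:E)).
- exact/measurable_EFinP/measurable_funM.
- move=> x _ /=; rewrite lee_fin !normrM ler_wpM2r//.
  by apply: le_trans (fM x) _; apply: ler_norm.
- by under eq_fun do rewrite EFinM; exact: integrableZl.
Qed.

Lemma EFin_Rintegral f : mu.-integrable setT (EFin \o f) ->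
  ((\int[mu]_x f x)%R)%:E = (\int[mu]_x (f x)%:E)%E.
Proof. by move=> i; rewrite /Rintegral fineK// integrable_fin_num. Qed.

Lemma bmf_Rintegral_le f g : bmf f -> bmf g -> (forall x, f x <= g x) ->
  \int[mu]_x f x <= \int[mu]_x g x.
Proof. by move=> bf bg fg; apply: le_Rintegral => //; exact: integrable_bmf. Qed.

Lemma RintegralDb f g : bmf f -> bmf g ->
  \int[mu]_x (f x + g x) = \int[mu]_x f x + \int[mu]_x g x.
Proof. by move=> bf bg; apply: RintegralD => //; exact: integrable_bmf. Qed.

Lemma RintegralBb f g : bmf f -> bmf g ->
  \int[mu]_x (f x - g x) = \int[mu]_x f x - \int[mu]_x g x.
Proof. by move=> bf bg; apply: RintegralB => //; exact: integrable_bmf. Qed.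

Lemma RintegralZb a f : bmf f -> \int[mu]_x (a * f x) = a * \int[mu]_x f x.
Proof. by move=> bf; apply: RintegralZl => //; exact: integrable_bmf. Qed.

Lemma Rintegral_sum I (s : seq I) (F : I -> T -> R) :
  (forall i, mu.-integrable setT (EFin \o F i)) ->
  \int[mu]_x (\sum_(i <- s) F i x) = \sum_(i <- s) \int[mu]_x F i x.
Proof.
move=> iF.
have iS t : mu.-integrable setT (EFin \o (fun x => \sum_(i <- t) F i x)).
  elim: t => [|i t it].
    rewrite (_ : _ \o _ = cst 0%:E); first exact: integrable0.
    by apply/funext => x /=; rewrite big_nil.
  rewrite (_ : _ \o _ = (fun x => ((F i x)%:E + (\sum_(j <- t) F j x)%R%:E)%E)).
    exact: (integrableD measurableT (iF i) it).
  by apply/funext => x /=; rewrite big_cons EFinD.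
elim: s => [|i s ih].
  rewrite big_nil; under eq_Rintegral do rewrite big_nil.
  by rewrite Rintegral_cst// mul0r.
rewrite big_cons -ih -RintegralD//.
by under eq_Rintegral do rewrite big_cons.
Qed.

(** Cauchy-Schwarz, obtained by optimising the scale in 2fg <= sf^2 + g^2/s. *)
Lemma cauchy_schwarz_Rintegral f g : bmf f -> bmf g ->
  (\int[mu]_x (f x * g x)) ^+ 2 <= (\int[mu]_x (f x ^+ 2)) * (\int[mu]_x (g x ^+ 2)).
Proof.
move=> bf bg.
set a := \int[mu]_x (f x ^+ 2); set b := \int[mu]_x (g x ^+ 2).
set c := \int[mu]_x (f x * g x).
have q (s t : R) : 0 <= s ^+ 2 * a + 2 * (s * t) * c + t ^+ 2 * b.
  rewrite /a /b /c -!RintegralZb; try by [apply: bmfM | apply: bmfX].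
  rewrite -!RintegralDb; first last.
  - by apply: bmfZ; apply: bmfM.
  - by apply: bmfZ; apply: bmfX.
  - by apply: bmfZ; apply: bmfX.
  - by apply: bmfD; [apply: bmfZ; apply: bmfX | apply: bmfZ; apply: bmfM].
  apply: Rintegral_ge0 => x _.
  have -> : s ^+ 2 * f x ^+ 2 + 2 * (s * t) * (f x * g x) + t ^+ 2 * g x ^+ 2 =
    (s * f x + t * g x) ^+ 2 by ring.
  exact: sqr_ge0.
have a0 : 0 <= a by apply: Rintegral_ge0 => x _; exact: sqr_ge0.
have [a00|an] := eqVneq a 0.
  have := q 1 0; have := q (- (b + 1)) c; have := q (b+1) (-c).
  rewrite a00 => h1 h2 _.
  have b0 : 0 <= b by apply: Rintegral_ge0 => x _; exact: sqr_ge0.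
  suff : c ^+ 2 <= 0 by rewrite mul0r.
  have : 0 <= c ^+ 2 by exact: sqr_ge0.
  nra.
have ap : 0 < a by rewrite lt_neqAle eq_sym an.
have := q (- c) a.
have -> : (- c) ^+ 2 * a + 2 * (- c * a) * c + a ^+ 2 * b = a * (a * b - c ^+ 2) by ring.
by rewrite pmulr_rge0// subr_ge0.
Qed.

End BoundedMeasurable.

#[global] Hint Resolve bmf_cst : core.

Lemma finite_measure_setT_lty d (T : measurableType d) (R : realType)
  (m : {finite_measure set T -> \bar R}) : (m setT < +oo)%E.
Proof. exact: fin_num_fun_lty (@fin_num_measure _ _ _ m). Qed.

Section BoundedFubini.
Context d1 d2 (T1 : measurableType d1) (T2 : measurableType d2) (R : realType).
Variables (m1 : {finite_measure set T1 -> \bar R})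
          (m2 : {finite_measure set T2 -> \bar R}).

Let m1f : (m1 setT < +oo)%E := finite_measure_setT_lty m1.
Let m2f : (m2 setT < +oo)%E := finite_measure_setT_lty m2.

(** The product measure, under a name that carries the structure of a finite
    measure, so that products can be iterated. *)
Definition fprod_measure : set (T1 * T2) -> \bar R := (m1 \x m2)%E.

HB.instance Definition _ := Measure.on fprod_measure.

Lemma prod_measure_setT : ((m1 \x m2)%E setT = m1 setT * m2 setT)%E.
Proof. by rewrite -setXTT product_measure1E. Qed.

Let prod_measure_fin : ((m1 \x m2)%E setT < +oo)%E.
Proof. by rewrite prod_measure_setT lte_mul_pinfty// ge0_fin_numE. Qed.

Let fprod_measure_fin : fin_num_fun fprod_measure.
Proof. exact: lty_fin_num_fun prod_measure_fin. Qed.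

HB.instance Definition _ :=
  Measure_isFinite.Build _ _ _ fprod_measure fprod_measure_fin.

Lemma bmf_comp d3 (T3 : measurableType d3) (h : T1 -> T3) (f : T3 -> R) :
  measurable_fun setT h -> bmf f -> bmf (f \o h).
Proof.
move=> mh [mf [M fM]]; split; first exact: measurableT_comp.
by exists M => x; exact: fM.
Qed.

Lemma bmf_pair1 (f : T1 * T2 -> R) x : bmf f -> bmf (fun y => f (x, y)).
Proof.
move=> [mf [M fM]]; split; last by exists M.
by apply: (measurableT_comp mf).
Qed.

Lemma bmf_pair2 (f : T1 * T2 -> R) y : bmf f -> bmf (fun x => f (x, y)).
Proof.
move=> [mf [M fM]]; split; last by exists M.
by apply: (measurableT_comp mf).
Qed.

Lemma bmf_Rintegral2 (f : T1 * T2 -> R) : bmf f ->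
  bmf (fun x => \int[m2]_y f (x, y)).
Proof.
move=> bf; split.
  have i : (m1 \x m2)%E.-integrable setT (EFin \o f).
    exact: (@integrable_bmf _ _ _ fprod_measure prod_measure_fin f bf).
  apply: measurableT_comp; first exact: fine_measurable.
  exact: measurable_fubini_F i.
have [mf [M fM]] := bf; exists (M * fine (m2 setT)) => x.
have bx := bmf_pair1 x bf.
apply: le_trans (le_normr_Rintegral measurableT (integrable_bmf m2f bx)) _.
rewrite -Rintegral_cst//.
apply: bmf_Rintegral_le => //; exact: bmf_norm.
Qed.

Lemma bmf_Rintegral1 (f : T1 * T2 -> R) : bmf f ->
  bmf (fun y => \int[m1]_x f (x, y)).
Proof.
move=> bf; split.
  have i : (m1 \x m2)%E.-integrable setT (EFin \o f).
    exact: (@integrable_bmf _ _ _ fprod_measure prod_measure_fin f bf).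
  apply: measurableT_comp; first exact: fine_measurable.
  exact: measurable_fubini_G i.
have [mf [M fM]] := bf; exists (M * fine (m1 setT)) => x.
have bx := bmf_pair2 x bf.
apply: le_trans (le_normr_Rintegral measurableT (integrable_bmf m1f bx)) _.
rewrite -Rintegral_cst//.
apply: bmf_Rintegral_le => //; exact: bmf_norm.
Qed.

Lemma fubini_bmf12 (f : T1 * T2 -> R) : bmf f ->
  \int[(m1 \x m2)%E]_z f z = \int[m1]_x \int[m2]_y f (x, y).
Proof.
move=> bf; have i : (m1 \x m2)%E.-integrable setT (EFin \o f).
  exact: (@integrable_bmf _ _ _ fprod_measure prod_measure_fin f bf).
apply: EFin_inj; rewrite !EFin_Rintegral//; last first.
  by apply: integrable_bmf => //; exact: bmf_Rintegral2.
rewrite -integral12_prod_meas1//; apply: eq_integral => x _.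
by rewrite EFin_Rintegral//; apply: integrable_bmf => //; exact: bmf_pair1.
Qed.

Lemma fubini_bmf21 (f : T1 * T2 -> R) : bmf f ->
  \int[(m1 \x m2)%E]_z f z = \int[m2]_y \int[m1]_x f (x, y).
Proof.
move=> bf; have i : (m1 \x m2)%E.-integrable setT (EFin \o f).
  exact: (@integrable_bmf _ _ _ fprod_measure prod_measure_fin f bf).
apply: EFin_inj; rewrite !EFin_Rintegral//; last first.
  by apply: integrable_bmf => //; exact: bmf_Rintegral1.
rewrite -integral21_prod_meas1//; apply: eq_integral => x _.
by rewrite EFin_Rintegral//; apply: integrable_bmf => //; exact: bmf_pair2.
Qed.

End BoundedFubini.

Section BoundedFubini3.
Context d1 d2 d3 (T1 : measurableType d1) (T2 : measurableType d2)
  (T3 : measurableType d3) (R : realType).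
Variables (m1 : {finite_measure set T1 -> \bar R})
  (m2 : {finite_measure set T2 -> \bar R}) (m3 : {finite_measure set T3 -> \bar R}).

Let m12 : {finite_measure set (T1 * T2)%type -> \bar R} := fprod_measure m1 m2.
Let m23 : {finite_measure set (T2 * T3)%type -> \bar R} := fprod_measure m2 m3.

Lemma prod3_measure_fin : (((m1 \x m2) \x m3)%E setT < +oo)%E.
Proof. exact: (finite_measure_setT_lty (fprod_measure m12 m3)). Qed.

Lemma prod3_measure_setT :
  (((m1 \x m2) \x m3)%E setT = m1 setT * m2 setT * m3 setT)%E.
Proof.
have e : (m12 setT = m1 setT * m2 setT)%E := prod_measure_setT m1 m2.
by rewrite (prod_measure_setT m12 m3) e.
Qed.

Variable f : T1 * T2 * T3 -> R.
Hypothesis bf : bmf f.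

Lemma fubini3_123 : \int[((m1 \x m2) \x m3)%E]_x f x =
  \int[m1]_a \int[m2]_b \int[m3]_e f ((a, b), e).
Proof.
rewrite (@fubini_bmf12 _ _ _ _ _ m12 m3)//.
rewrite (@fubini_bmf12 _ _ _ _ _ m1 m2)//.
exact: (@bmf_Rintegral2 _ _ _ _ _ m12 m3).
Qed.

Lemma fubini3_231 : \int[((m1 \x m2) \x m3)%E]_x f x =
  \int[m2]_b \int[m3]_e \int[m1]_a f ((a, b), e).
Proof.
rewrite (@fubini_bmf21 _ _ _ _ _ m12 m3)//.
have -> : \int[m3]_y \int[m12]_x f (x, y) =
          \int[m3]_e \int[m2]_b \int[m1]_a f ((a, b), e).
  apply: eq_Rintegral => e _; rewrite (@fubini_bmf21 _ _ _ _ _ m1 m2)//.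
  exact: bmf_pair2.
have bg : bmf (fun z : T2 * T3 => \int[m1]_a f ((a, z.1), z.2)).
  pose g := fun z : T1 * (T2 * T3) => f ((z.1, z.2.1), z.2.2).
  apply: (@bmf_Rintegral1 _ _ _ _ _ m1 m23 g).
  apply: (@bmf_comp _ _ _ _ _ (fun z => ((z.1, z.2.1), z.2.2)) f) => //.
  apply: measurable_fun_pair; first apply: measurable_fun_pair.
  - exact: measurable_fst.
  - exact: (measurableT_comp measurable_fst measurable_snd).
  - exact: (measurableT_comp measurable_snd measurable_snd).
by rewrite -(fubini_bmf21 m2 m3 bg) (fubini_bmf12 m2 m3 bg).
Qed.

Lemma fubini3_132 : \int[((m1 \x m2) \x m3)%E]_x f x =
  \int[m1]_a \int[m3]_e \int[m2]_b f ((a, b), e).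
Proof.
rewrite fubini3_123; apply: eq_Rintegral => a _.
have bg : bmf (fun z : T2 * T3 => f ((a, z.1), z.2)).
  apply: (@bmf_comp _ _ _ _ _ (fun z => ((a, z.1), z.2)) f) => //.
  by apply: measurable_fun_pair => //; exact: measurable_fun_pair.
by rewrite -(fubini_bmf12 m2 m3 bg) (fubini_bmf21 m2 m3 bg).
Qed.

End BoundedFubini3.

(** * Integration over the circle and the torus *)

Section Circle.
Variable R : realType.
Local Notation c := (circle_measure R).
Local Notation TM := (torus_measure R).

Lemma circle_fin : (c setT < +oo)%E.
Proof. exact: finite_measure_setT_lty. Qed.

Lemma twopi_gt0 : 0 < 2 * pi :> R.
Proof. by rewrite mulr_gt0// pi_gt0. Qed.

Lemma circle_setT : c setT = (2 * pi)%:E :> \bar R.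
Proof.
rewrite /circle_measure /= /mfrestr /mrestr setTI.
rewrite [LHS](lebesgue_measure_itv `[0, (2 * pi)]) /= lte_fin twopi_gt0.
by rewrite oppr0 addr0.
Qed.

Lemma circle_fine : fine (c setT) = 2 * pi.
Proof. by rewrite circle_setT. Qed.

Lemma circle_integral (f : R -> R) : bmf (f : measurableTypeR R -> R) ->
  (\int[c]_x (f x)%:E = \int[lebesgue_measure]_(x in `[0%R, (2 * pi)%R]) (f x)%:E)%E.
Proof.
move=> bf; have i := integrable_bmf circle_fin bf.
have mI : measurable (`[0, 2 * pi]%classic : set (measurableTypeR R)) by [].
rewrite (@negligible_integral _ _ _ c setT (~` `[0, 2 * pi]%classic))//; first last.
- by rewrite /= /mfrestr /mrestr setICl measure0.
- exact: measurableC.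
rewrite setTD setCK; apply: eq_measure_integral => A mA AI.
by rewrite /= /mfrestr /mrestr setIidl.
Qed.

Lemma circle_Rintegral (f : R -> R) : bmf (f : measurableTypeR R -> R) ->
  \int[c]_x f x = \int[lebesgue_measure]_(x in `[0, 2 * pi]) f x.
Proof. by move=> bf; congr fine; exact: circle_integral. Qed.

Lemma circle_FTC (F f : R -> R) : bmf (f : measurableTypeR R -> R) ->
  continuous f -> (forall x : R, is_derive x (1 : R) F (f x)) ->
  \int[c]_x f x = F (2 * pi) - F 0.
Proof.
move=> bf cf dF; rewrite circle_Rintegral// /Rintegral.
have cF : continuous F.
  by move=> x; apply/differentiable_continuous/derivable1_diffP; apply: ex_derive.
rewrite (@continuous_FTC2 _ f F 0 (2 * pi)) ?twopi_gt0//.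
- exact: continuous_subspaceT.
- split; first by move=> x _; apply: ex_derive.
  + exact/cvg_at_right_filter/cF.
  + exact/cvg_at_left_filter/cF.
- by move=> x _; rewrite derive1E derive_val.
Qed.

Lemma cosD2piz (k : int) (x : R) : cos (x + k%:~R * (2 * pi)) = cos x.
Proof.
have p m (y : R) : cos (y + m%:R * (2 * pi)) = cos y.
  have -> : m%:R * (2 * pi) = (pi *+ 2) *+ m :> R by rewrite !mulr_natl.
  exact: (periodicn (@cosD2pi R)).
case: k => m; first exact: p.
rewrite NegzE mulrNz mulNr -[LHS](p m.+1) -pmulrn; congr cos.
by rewrite subrK.
Qed.

Lemma sinD2piz (k : int) (x : R) : sin (x + k%:~R * (2 * pi)) = sin x.
Proof. by rewrite -!cosBpihalf -(cosD2piz k (x - pi / 2)) addrAC. Qed.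

Lemma bmf_cos d (T : measurableType d) (f : T -> R) : measurable_fun setT f ->
  bmf (fun x => cos (f x)).
Proof.
move=> mf; split; last by exists 1 => x; exact: cos_max.
apply: (@measurableT_comp _ _ _ _ _ _ (@cos R)) => //.
exact: (continuous_measurable_fun (@continuous_cos R)).
Qed.

Lemma bmf_sin d (T : measurableType d) (f : T -> R) : measurable_fun setT f ->
  bmf (fun x => sin (f x)).
Proof.
move=> mf; split; last by exists 1 => x; exact: sin_max.
apply: (@measurableT_comp _ _ _ _ _ _ (@sin R)) => //.
exact: (continuous_measurable_fun (@continuous_sin R)).
Qed.

Lemma circle_int_cos (k : int) (a : R) :
  \int[c]_x cos (k%:~R * x + a) = if k == 0 then 2 * pi * cos a else 0.
Proof.
case: eqP => [->|/eqP k0].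
  under eq_Rintegral do rewrite mul0r add0r.
  by rewrite Rintegral_cst// circle_fine mulrC.
have k0R : k%:~R != 0 :> R by rewrite intr_eq0.
have dl (x : R) : is_derive x (1 : R) (fun y : R => k%:~R * y + a) k%:~R.
  have := is_deriveD (is_deriveZ k%:~R (is_derive_id x (1 : R))) (is_derive_cst a x (1 : R)).
  by rewrite addr0 /GRing.scale /= mulr1.
have dF (x : R) : is_derive x (1 : R) (fun x => k%:~R^-1 * sin (k%:~R * x + a)) (cos (k%:~R * x + a)).
  have ds : is_derive (k%:~R * x + a) (1 : R) (@sin R) (cos (k%:~R * x + a)).
    exact: is_derive_sin.
  have := is_deriveZ k%:~R^-1 (@is_derive1_comp _ (@sin R) (fun y => k%:~R * y + a) _ _ _ ds (dl x)).
  by rewrite [_ * k%:~R]mulrC {1}/GRing.scale /= mulKf.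
rewrite (circle_FTC _ _ dF).
- by rewrite mulr0 add0r [_ * (2 * pi) + a]addrC sinD2piz subrr.
- apply: bmf_cos; apply: measurable_funD => //.
- move=> x; apply: continuous_comp; last exact: continuous_cos.
  by apply: differentiable_continuous; apply/derivable1_diffP; apply: ex_derive.
Qed.

Lemma torus_fin : (TM setT < +oo)%E.
Proof. exact: (@prod3_measure_fin _ _ _ _ _ _ _ c c c). Qed.

Lemma torus_setT : fine (TM setT) = (2 * pi) ^+ 3.
Proof.
have := @prod3_measure_setT _ _ _ _ _ _ _ c c c.
rewrite circle_setT -!EFinM => E.
by rewrite /torus_measure /= E /= !exprS expr0 mulr1 mulrA.
Qed.

Lemma torus_fubini1 (f : torus R -> R) : bmf f ->
  \int[TM]_x f x = \int[c]_a \int[c]_b \int[c]_e f ((a, b), e).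
Proof. exact: (@fubini3_123 _ _ _ _ _ _ _ c c c). Qed.

Lemma torus_fubini2 (f : torus R -> R) : bmf f ->
  \int[TM]_x f x = \int[c]_b \int[c]_e \int[c]_a f ((a, b), e).
Proof. exact: (@fubini3_231 _ _ _ _ _ _ _ c c c). Qed.

Lemma torus_fubini3 (f : torus R -> R) : bmf f ->
  \int[TM]_x f x = \int[c]_a \int[c]_e \int[c]_b f ((a, b), e).
Proof. exact: (@fubini3_132 _ _ _ _ _ _ _ c c c). Qed.

End Circle.

(** * Trigonometric polynomials *)

Section TrigPoly.
Variable R : realType.
Local Notation c := (circle_measure R).
Local Notation TM := (torus_measure R).
Implicit Types (k l : Z3) (s : seq Z3) (z : R[i]) (u : distr R).

Definition vol : R := (2 * pi) ^+ 3.

Definition csq z : R := complex.Re z ^+ 2 + complex.Im z ^+ 2.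

(** The real part of [z exp(i k.x)]. *)
Definition wave z k (x : torus R) : R :=
  complex.Re z * cos (dotp k x) - complex.Im z * sin (dotp k x).

(** Only the real part is kept, so that no symmetry of the coefficients is
    required. *)
Definition trigpoly s u (x : torus R) : R := \sum_(k <- s) wave (u k) k x.

Lemma vol_gt0 : 0 < vol.
Proof. by rewrite exprn_gt0// twopi_gt0. Qed.

Lemma csq_ge0 z : 0 <= csq z.
Proof. by rewrite addr_ge0// sqr_ge0. Qed.

Lemma dotpD k l x : @dotp R (k + l) x = dotp k x + dotp l x.
Proof. by rewrite /dotp /= !intrD; ring. Qed.

Lemma dotpN k x : @dotp R (- k) x = - dotp k x.
Proof. by rewrite /dotp /= !intrN; ring. Qed.

Lemma dotpB k l x : @dotp R (k - l) x = dotp k x - dotp l x.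
Proof. by rewrite dotpD dotpN. Qed.

Lemma measurable_dotp k : measurable_fun setT (@dotp R k).
Proof.
have m1 : measurable_fun setT (fun x : torus R => x.1.1 : R).
  exact: (measurableT_comp measurable_fst measurable_fst).
have m2 : measurable_fun setT (fun x : torus R => x.1.2 : R).
  exact: (measurableT_comp measurable_snd measurable_fst).
have m3 : measurable_fun setT (fun x : torus R => x.2 : R).
  exact: measurable_snd.
by apply: measurable_funD; [apply: measurable_funD|]; apply: measurable_funM.
Qed.

Lemma bmf_cosdot k (a : R) : bmf (fun x => cos (dotp k x + a)).
Proof. by apply: bmf_cos; apply: measurable_funD => //; exact: measurable_dotp. Qed.

Lemma bmf_sindot k (a : R) : bmf (fun x => sin (dotp k x + a)).
Proof. by apply: bmf_sin; apply: measurable_funD => //; exact: measurable_dotp. Qed.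

Lemma bmf_cosd k : bmf (fun x => cos (@dotp R k x)).
Proof. by apply: bmf_cos; exact: measurable_dotp. Qed.

Lemma bmf_sind k : bmf (fun x => sin (@dotp R k x)).
Proof. by apply: bmf_sin; exact: measurable_dotp. Qed.

Lemma bmf_wave z k : bmf (wave z k).
Proof.
by apply: bmfB; apply: bmfZ; [exact: bmf_cosd | exact: bmf_sind].
Qed.

Lemma bmf_trigpoly s u : bmf (trigpoly s u).
Proof. by apply: bmf_sum => k; exact: bmf_wave. Qed.

Lemma torus_int_cos l (a : R) :
  \int[TM]_x cos (dotp l x + a) = if l == 0 then vol * cos a else 0.
Proof.
rewrite torus_fubini1; last exact: bmf_cosdot.
have -> : \int[c]_x \int[c]_b \int[c]_e cos (dotp l (x, b, e) + a) =
  \int[c]_x \int[c]_b (if l.2 == 0 then 2 * pi * cos (l.1.2%:~R * b + (l.1.1%:~R * x + a)) else 0).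
  apply: eq_Rintegral => x _; apply: eq_Rintegral => b _.
  rewrite -circle_int_cos; apply: eq_Rintegral => e _; rewrite /dotp /=.
  by congr cos; ring.
have -> : \int[c]_x \int[c]_b (if l.2 == 0 then 2 * pi * cos (l.1.2%:~R * b + (l.1.1%:~R * x + a)) else 0) =
  \int[c]_x (if l.2 == 0 then if l.1.2 == 0 then (2 * pi) ^+ 2 * cos (l.1.1%:~R * x + a) else 0 else 0).
  apply: eq_Rintegral => x _; case: ifP => _; last by rewrite Rintegral_cst// mul0r.
  rewrite (RintegralZb (circle_fin R)); last by apply: bmf_cos; apply: measurable_funD.
  rewrite circle_int_cos; case: ifP => _; last by rewrite mulr0.
  by rewrite mulrA.
case: l => [[l1 l2] l3] /=.
have -> : ((l1, l2, l3) == 0 :> Z3) = [&& l3 == 0, l2 == 0 & l1 == 0].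
  by rewrite -!pair_eqE /= andbC [in RHS]andbA [RHS]andbAC -!andbA; congr andb; rewrite andbC.
case: (l3 == 0) => /=; last by rewrite Rintegral_cst// mul0r.
case: (l2 == 0) => /=; last by rewrite Rintegral_cst// mul0r.
rewrite (RintegralZb (circle_fin R)); last by apply: bmf_cos; apply: measurable_funD.
by rewrite circle_int_cos; case: ifP => _; rewrite ?mulr0// mulrA -exprSr.
Qed.

Lemma torus_int_sin l (a : R) :
  \int[TM]_x sin (dotp l x + a) = if l == 0 then vol * sin a else 0.
Proof.
rewrite -cosBpihalf -torus_int_cos; apply: eq_Rintegral => x _.
by rewrite addrA cosBpihalf.
Qed.

(** The integrand is completed to the squared modulus of the complex
    polynomial, whose off-diagonal terms integrate to zero. *)
Lemma trigpoly_L2 s u : uniq s ->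
  \int[TM]_x (trigpoly s u x ^+ 2) <= vol * \sum_(k <- s) csq (u k).
Proof.
move=> us.
pose v z k (x : torus R) : R :=
  complex.Re z * sin (dotp k x) + complex.Im z * cos (dotp k x).
have bv z k : bmf (v z k).
  by apply: bmfD; apply: bmfZ; [exact: bmf_sind | exact: bmf_cosd].
pose w j k := fun x => wave (u j) j x * wave (u k) k x + v (u j) j x * v (u k) k x.
have bw j k : bmf (w j k) by apply: bmfD; apply: bmfM => //; exact: bmf_wave.
have -> : vol * \sum_(k <- s) csq (u k) = \int[TM]_x (\sum_(j <- s) \sum_(k <- s) w j k x).
  rewrite (@Rintegral_sum _ _ _ TM); last first.
    by move=> j; apply: (integrable_bmf (torus_fin R)); apply: bmf_sum.
  rewrite mulr_sumr big_seq [RHS]big_seq; apply: eq_bigr => j js.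
  rewrite (@Rintegral_sum _ _ _ TM); last by move=> k; exact: (integrable_bmf (torus_fin R)).
  rewrite (bigD1_seq j)//= [X in _ + X]big1 ?addr0.
    rewrite (_ : \int[TM]_x w j j x = \int[TM]_x csq (u j)).
      by rewrite Rintegral_cst// torus_setT mulrC.
    apply: eq_Rintegral => x _; rewrite /w /wave /v /csq.
    transitivity ((complex.Re (u j) ^+ 2 + complex.Im (u j) ^+ 2) *
      (cos (dotp j x) ^+ 2 + sin (dotp j x) ^+ 2)); last by rewrite cos2Dsin2 mulr1.
    by ring.
  move=> k kj.
  have kj0 : (j - k == 0) = false by rewrite subr_eq0 eq_sym; apply/negbTE.
  rewrite (_ : \int[TM]_x w j k x = \int[TM]_x (
    (complex.Re (u j) * complex.Re (u k) + complex.Im (u j) * complex.Im (u k)) * cos (dotp (j - k) x + 0) +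
    (complex.Re (u j) * complex.Im (u k) - complex.Im (u j) * complex.Re (u k)) * sin (dotp (j - k) x + 0))).
    rewrite (RintegralDb (torus_fin R)); try by apply: bmfZ; [exact: bmf_cosdot || exact: bmf_sindot].
    rewrite !(RintegralZb (torus_fin R)) ?torus_int_cos ?torus_int_sin ?kj0 ?mulr0 ?addr0//.
      exact: bmf_sindot.
    exact: bmf_cosdot.
  apply: eq_Rintegral => x _; rewrite /w /wave /v addr0 dotpB cosB sinB; ring.
apply: (bmf_Rintegral_le (torus_fin R)).
- by apply: bmfX; exact: bmf_trigpoly.
- by apply: bmf_sum => j; apply: bmf_sum.
move=> x; rewrite expr2 /trigpoly mulr_suml -subr_ge0 -sumrB.
rewrite (_ : \sum_(i <- s) _ = (\sum_(j <- s) v (u j) j x) ^+ 2); first exact: sqr_ge0.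
rewrite expr2 mulr_suml; apply: eq_bigr => j _.
by rewrite !mulr_sumr -sumrB; apply: eq_bigr => k _; rewrite /w addrC addKr.
Qed.

Lemma Re_fourier (f : torus R -> R) k :
  \int[TM]_x (f x * cos (dotp k x)) = vol * complex.Re (fourier f k).
Proof. by rewrite /fourier /= mulrA mulfV ?mul1r// gt_eqF// vol_gt0. Qed.

Lemma Im_fourier (f : torus R -> R) k :
  \int[TM]_x (f x * sin (dotp k x)) = - (vol * complex.Im (fourier f k)).
Proof. by rewrite /fourier /= mulrN opprK mulrA mulfV ?mul1r// gt_eqF// vol_gt0. Qed.

(** Parseval: the coefficients of a trigonometric polynomial only have to be
    compared with those of [f], which need not be square summable. *)
Lemma pairing (f : torus R -> R) s u :
  TM.-integrable setT (EFin \o f) ->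
  \int[TM]_x (f x * trigpoly s u x) = vol * \sum_(k <- s)
    (complex.Re (u k) * complex.Re (fourier f k) + complex.Im (u k) * complex.Im (fourier f k)).
Proof.
move=> fi.
have fc k : TM.-integrable setT (EFin \o (fun x => f x * cos (dotp k x))).
  under eq_fun do rewrite mulrC; apply: integrable_bmfM => //; exact: bmf_cosd.
have fs k : TM.-integrable setT (EFin \o (fun x => f x * sin (dotp k x))).
  under eq_fun do rewrite mulrC; apply: integrable_bmfM => //; exact: bmf_sind.
rewrite (_ : \int[TM]_x (f x * trigpoly s u x) =
  \int[TM]_x (\sum_(k <- s) (f x * wave (u k) k x))); last first.
  by apply: eq_Rintegral => x _; rewrite mulr_sumr.
rewrite (@Rintegral_sum _ _ _ TM); last first.
  move=> k; under eq_fun do rewrite mulrC; apply: integrable_bmfM => //; exact: bmf_wave.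
rewrite mulr_sumr; apply: eq_bigr => k _.
rewrite (_ : \int[TM]_x (f x * wave (u k) k x) = \int[TM]_x
  (complex.Re (u k) * (f x * cos (dotp k x)) - complex.Im (u k) * (f x * sin (dotp k x)))); last first.
  by apply: eq_Rintegral => x _; rewrite /wave; ring.
have ic : TM.-integrable setT (EFin \o (fun x => complex.Re (u k) * (f x * cos (dotp k x)))).
  by apply: integrable_bmfM.
have isn : TM.-integrable setT (EFin \o (fun x => complex.Im (u k) * (f x * sin (dotp k x)))).
  by apply: integrable_bmfM.
rewrite RintegralB// !RintegralZl// Re_fourier Im_fourier; ring.
Qed.

(** Multiplication by [i m], the symbol of a partial derivative. *)
Definition imul (m : R) z : R[i] := Complex (- (m * complex.Im z)) (m * complex.Re z).

Lemma csq_imul m z : csq (imul m z) = m ^+ 2 * csq z.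
Proof. by rewrite /csq /imul /=; ring. Qed.

Lemma is_derive_line (p q : Z3 -> R) s u (t : R) :
  is_derive t (1 : R) (fun t : R => \sum_(k <- s)
    (complex.Re (u k) * cos (p k * t + q k) - complex.Im (u k) * sin (p k * t + q k)))
   (\sum_(k <- s) (complex.Re (imul (p k) (u k)) * cos (p k * t + q k) -
      complex.Im (imul (p k) (u k)) * sin (p k * t + q k))).
Proof.
elim: s => [|k s ih].
  under eq_fun do rewrite big_nil.
  by rewrite big_nil; exact: is_derive_cst.
under eq_fun do rewrite big_cons.
rewrite big_cons; apply: is_deriveD => //=.
have dl : is_derive t (1 : R) (fun y : R => p k * y + q k) (p k).
  have := is_deriveD (is_deriveZ (p k) (is_derive_id t (1 : R))) (is_derive_cst (q k) t (1 : R)).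
  by rewrite addr0 /GRing.scale /= mulr1.
have dc := is_deriveZ (complex.Re (u k)) (@is_derive1_comp _ (@cos R) (fun y => p k * y + q k) _ _ _
  (is_derive_cos (p k * t + q k)) dl).
have ds := is_deriveZ (complex.Im (u k)) (@is_derive1_comp _ (@sin R) (fun y => p k * y + q k) _ _ _
  (is_derive_sin (p k * t + q k)) dl).
have := is_deriveB dc ds.
by congr (is_derive _ _ _ _); rewrite /GRing.scale /=; ring.
Qed.

End TrigPoly.

(** * The Sobolev embedding of H^1 into L^6 *)

Section Sobolev.
Variable R : realType.
Local Notation c := (circle_measure R).
Local Notation TM := (torus_measure R).
Implicit Types (s : seq Z3) (u : distr R).

(** Coordinates are indexed by natural numbers, where any index from 2 on stands
    for the third one. *)
Definition coord (j : nat) (k : Z3) : int :=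
  match j with 0 => k.1.1 | 1 => k.1.2 | _ => k.2 end.

Definition line (j : nat) (y : torus R) (t : R) : torus R :=
  match j with 0 => ((t, y.1.2), y.2) | 1 => ((y.1.1, t), y.2) | _ => (y.1, t) end.

Definition pderiv (j : nat) u : distr R := fun k => imul (coord j k)%:~R (u k).

Lemma dotp_line j y t (k : Z3) :
  dotp k (line j y t) = (coord j k)%:~R * t + dotp k (line j y 0).
Proof. by case: j => [|[|j]]; rewrite /dotp /=; ring. Qed.

Lemma is_derive_trigpoly j s u y (t : R) :
  is_derive t (1 : R) (fun t => trigpoly s u (line j y t))
    (trigpoly s (pderiv j u) (line j y t)).
Proof.
have := is_derive_line (fun k => (coord j k)%:~R) (fun k => dotp k (line j y 0)) s u t.
congr (is_derive _ _ _ _).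
  by apply/funext => r; apply: eq_bigr => k _; rewrite /wave [dotp k (line j y r)]dotp_line.
by apply: eq_bigr => k _; rewrite /wave [dotp k (line j y t)]dotp_line.
Qed.

Lemma trigpoly_period j s u y (t : R) (n : int) :
  trigpoly s u (line j y (t + n%:~R * (2 * pi))) = trigpoly s u (line j y t).
Proof.
apply: eq_bigr => k _; rewrite /wave dotp_line [dotp k (line j y t)]dotp_line.
have -> : (coord j k)%:~R * (t + n%:~R * (2 * pi)) + dotp k (line j y 0) =
  (coord j k)%:~R * t + dotp k (line j y 0) + (coord j k * n)%:~R * (2 * pi).
  by rewrite intrM; ring.
by rewrite cosD2piz sinD2piz.
Qed.

Lemma continuous_trigpoly_line j s u y : continuous (fun t => trigpoly s u (line j y t)).
Proof.
move=> t; apply/differentiable_continuous/derivable1_diffP.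
by apply: ex_derive; exact: is_derive_trigpoly.
Qed.

Lemma measurable_line j y : measurable_fun setT (line j y : measurableTypeR R -> torus R).
Proof.
case: j => [|[|j]] /=.
- by apply: measurable_fun_pair => //; exact: measurable_fun_pair.
- by apply: measurable_fun_pair => //; exact: measurable_fun_pair.
- exact: measurable_fun_pair.
Qed.

Lemma bmf_line j y (f : torus R -> R) : bmf f ->
  bmf ((fun t => f (line j y t)) : measurableTypeR R -> R).
Proof.
move=> [mf [M fM]]; split; last by exists M.
by apply: measurableT_comp => //; exact: measurable_line.
Qed.

Lemma period_reduce (x : R) : exists (n : int) (r : R),
  0 <= r <= 2 * pi /\ x = r + n%:~R * (2 * pi).
Proof.
have tp := twopi_gt0 R.
exists (Num.floor (x / (2 * pi))), (x - (Num.floor (x / (2 * pi)))%:~R * (2 * pi)).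
split; last by rewrite subrK.
apply/andP; split.
  by rewrite subr_ge0 -ler_pdivlMr// floor_le.
rewrite lerBlDr -[X in _ <= X + _]mul1r -mulrDl -ler_pdivrMr//.
by have := ltW (floorD1_gt (x / (2 * pi))); rewrite intrD addrC.
Qed.

(** A periodic function exceeds its mean by at most its total variation, and its
    mean is at most its integral as the period is at least 1. *)
Lemma sup_le_int (h h' : R -> R) :
  bmf (h : measurableTypeR R -> R) -> bmf (h' : measurableTypeR R -> R) ->
  continuous h' -> (forall x : R, is_derive x (1 : R) h (h' x)) ->
  (forall x (n : int), h (x + n%:~R * (2 * pi)) = h x) ->
  (forall x, 0 <= h x) ->
  forall x, h x <= \int[c]_t (h t + `|h' t|).
Proof.
move=> bh bh' ch dh ph h0.
set D := \int[c]_t `|h' t|.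
have bn := bmf_norm bh'.
have ch0 : continuous h.
  by move=> x; apply/differentiable_continuous/derivable1_diffP; apply: ex_derive.
have osc (a b : R) : 0 <= a -> a < b -> b <= 2 * pi -> `|h b - h a| <= D.
  move=> a0 ab b2.
  have E := @continuous_FTC2 _ h' h a b ab (continuous_subspaceT ch).
  have {}E : (\int[lebesgue_measure]_(x in `[a, b]) (h' x)%:E = (h b)%:E - (h a)%:E)%E.
    apply: E; last by move=> x _; rewrite derive1E derive_val.
    split; first by move=> x _; apply: ex_derive.
    + exact/cvg_at_right_filter/ch0.
    + exact/cvg_at_left_filter/ch0.
  have mh' : measurable_fun setT (h' : measurableTypeR R -> R) by case: bh'.
  rewrite -lee_fin /D (EFin_Rintegral (integrable_bmf (circle_fin R) bn)) circle_integral//.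
  have -> : (`|h b - h a|%:E = `|\int[lebesgue_measure]_(x in `[a, b]) (h' x)%:E|)%E by rewrite E.
  have m1 (I : set R) : measurable_fun I (h' : measurableTypeR R -> R).
    exact: measurable_funTS.
  apply: le_trans (le_abse_integral _ _ _) _ => //.
    by apply/measurable_EFinP; exact: m1.
  apply: ge0_subset_integral => //.
    apply: (measurableT_comp (@abse_measurable R _)).
    by apply/measurable_EFinP; exact: m1.
  by apply: subset_itv; rewrite bnd_simp.
have oscS (a b : R) : h a - h b <= D.
  have [n [r [/andP[r0 r2] ->]]] := period_reduce a.
  have [m [q [/andP[q0 q2] ->]]] := period_reduce b.
  rewrite !ph; have [rq|qr|->] := ltgtP r q.
  - by rewrite (le_trans (ler_norm _))// distrC osc.
  - by rewrite (le_trans (ler_norm _))// osc.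
  - by rewrite subrr Rintegral_ge0.
move=> x.
have : \int[c]_t (h x - D) <= \int[c]_t h t.
  apply: (bmf_Rintegral_le (circle_fin R)) => // t.
  by rewrite lerBlDr addrC -lerBlDr.
rewrite Rintegral_cst// circle_fine (RintegralDb (circle_fin R))// -/D => H.
have i0 : 0 <= \int[c]_t h t by apply: Rintegral_ge0.
rewrite -lerBlDr; have [n0|p0] := leP (h x - D) 0; first exact: le_trans n0 i0.
apply: le_trans H; rewrite ler_peMr//; first exact: ltW.
have := @pi_ge2 R; lra.
Qed.

Lemma sqrt_cauchy_schwarz (F G : R -> R) :
  bmf (F : measurableTypeR R -> R) -> bmf (G : measurableTypeR R -> R) ->
  (forall x, 0 <= F x) -> (forall x, 0 <= G x) ->
  \int[c]_x (Num.sqrt (F x) * Num.sqrt (G x)) <=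
  Num.sqrt (\int[c]_x F x) * Num.sqrt (\int[c]_x G x).
Proof.
move=> bF bG F0 G0.
have := cauchy_schwarz_Rintegral (circle_fin R) (bmf_sqrt bF) (bmf_sqrt bG).
under [in X in _ <= X * _]eq_Rintegral => x _ do rewrite sqr_sqrtr//.
under [in X in _ <= _ * X]eq_Rintegral => x _ do rewrite sqr_sqrtr//.
rewrite -sqrtrM; last exact: Rintegral_ge0.
move=> H; apply: le_trans (ler_norm _) _.
by rewrite -sqrtr_sqr ler_wsqrtr.
Qed.

(** The Cauchy-Schwarz inequality is applied in each variable in turn to the
    product of the two factors that depend on it. *)
Lemma loomis_whitney (A : nat -> R -> R -> R) (f : torus R -> R) :
  (forall j, bmf (fun z : measurableTypeR R * measurableTypeR R => A j z.1 z.2)) ->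
  (forall j x y, 0 <= A j x y) -> bmf f ->
  (forall x1 x2 x3, f ((x1, x2), x3) <=
    Num.sqrt (A 0 x2 x3) * Num.sqrt (A 1 x1 x3) * Num.sqrt (A 2 x1 x2)) ->
  \int[TM]_x f x <=
    Num.sqrt (\int[c]_x \int[c]_y A 0 x y) * Num.sqrt (\int[c]_x \int[c]_y A 1 x y) *
    Num.sqrt (\int[c]_x \int[c]_y A 2 x y).
Proof.
move=> bA A0 bf fA.
have bA1 j x : bmf ((fun y => A j x y) : measurableTypeR R -> R).
  by have := bmf_pair1 x (bA j).
have bA2 j : bmf ((fun x => \int[c]_y A j x y) : measurableTypeR R -> R).
  exact: (bmf_Rintegral2 c c (bA j)).
have Ap j x : 0 <= \int[c]_y A j x y by apply: Rintegral_ge0.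
have Aq j : 0 <= \int[c]_x \int[c]_y A j x y by apply: Rintegral_ge0.
have cf := circle_fin R.
rewrite torus_fubini1//.
have bf2 : bmf (fun z : measurableTypeR R * measurableTypeR R => \int[c]_e f (z, e)).
  exact: (bmf_Rintegral2 (fprod_measure c c) c bf).
have bf1 : bmf (fun a : measurableTypeR R => \int[c]_b \int[c]_e f ((a, b), e)).
  exact: (bmf_Rintegral2 c c bf2).
pose S := Num.sqrt (\int[c]_x \int[c]_y A 0 x y).
apply: (@le_trans _ _ (\int[c]_a (S *
   (Num.sqrt (\int[c]_y A 1 a y) * Num.sqrt (\int[c]_y A 2 a y))))).
  apply: (bmf_Rintegral_le cf) => //.
    by apply: bmfZ; apply: bmfM; apply: bmf_sqrt.
  move=> a; apply: (@le_trans _ _ (\int[c]_b (Num.sqrt (\int[c]_y A 1 a y) *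
     (Num.sqrt (\int[c]_y A 0 b y) * Num.sqrt (A 2 a b))))).
    apply: (bmf_Rintegral_le cf).
    - exact: bmf_pair1 bf2.
    - by apply: bmfZ; apply: bmfM; apply: bmf_sqrt.
    move=> b; apply: (@le_trans _ _ (\int[c]_e (Num.sqrt (A 2 a b) *
      (Num.sqrt (A 0 b e) * Num.sqrt (A 1 a e))))).
      apply: (bmf_Rintegral_le cf).
      - exact: (bmf_pair1 (a, b) bf).
      - by apply: bmfZ; apply: bmfM; apply: bmf_sqrt.
      by move=> e; rewrite mulrC.
    rewrite (RintegralZb cf); last by apply: bmfM; apply: bmf_sqrt.
    rewrite mulrA [X in _ <= X]mulrC ler_wpM2l ?sqrtr_ge0// [X in _ <= X]mulrC.
    exact: sqrt_cauchy_schwarz.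
  rewrite (RintegralZb cf); last by apply: bmfM; apply: bmf_sqrt.
  rewrite [X in _ <= X]mulrCA ler_wpM2l ?sqrtr_ge0//.
  exact: sqrt_cauchy_schwarz.
rewrite (RintegralZb cf); last by apply: bmfM; apply: bmf_sqrt.
rewrite -mulrA ler_wpM2l ?sqrtr_ge0//.
exact: sqrt_cauchy_schwarz.
Qed.

(** With [p] the polynomial, [p^4] is bounded at each point by an
    integral along each of the three coordinate lines, so that [p^6] is dominated
    by a Loomis-Whitney product. *)
Lemma sobolev_trigpoly s u : uniq s ->
  \int[TM]_x (trigpoly s u x ^+ 6) <=
  5 ^+ 6 * vol R ^+ 3 * (\sum_(k <- s) bracket2 R k * csq (u k)) ^+ 3.
Proof.
move=> us; set H := \sum_(k <- s) _; set p := trigpoly s u.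
pose q j := trigpoly s (pderiv j u).
have tf := torus_fin R.
have bp : bmf p by exact: bmf_trigpoly.
have bq j : bmf (q j) by exact: bmf_trigpoly.
pose h j x := p x ^+ 4 + `|4 * (p x ^+ 3 * q j x)|.
have bh j : bmf (h j).
  by apply: bmfD; [exact: bmfX | apply: bmf_norm; apply: bmfZ; apply: bmfM => //; exact: bmfX].
have h0 j x : 0 <= h j x by rewrite addr_ge0// exprn_even_ge0.
pose A j x y := match j with
  | 0 => \int[c]_t h 0%N ((t, x), y) | 1 => \int[c]_t h 1%N ((x, t), y)
  | _ => \int[c]_t h 2%N ((x, y), t) end.
have p4 j y t : p (line j y t) ^+ 4 <= \int[c]_r h j (line j y r).
  pose P r := p (line j y r).
  have dP (r : R) : is_derive r (1 : R) P (q j (line j y r)) by exact: is_derive_trigpoly.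
  have dP4 (r : R) : is_derive r (1 : R) (fun r => P r ^+ 4) (4 * (P r ^+ 3 * q j (line j y r))).
    have := is_deriveX 4 (dP r); congr (is_derive _ _ _ _).
    by rewrite /GRing.scale /= mulrA.
  apply: (sup_le_int (h := fun r => P r ^+ 4)
    (h' := fun r => 4 * (P r ^+ 3 * q j (line j y r)))) => //.
  - by apply: bmfX; exact: (bmf_line j y bp).
  - apply: bmfZ; apply: bmfM; first by apply: bmfX; exact: (bmf_line j y bp).
    exact: (bmf_line j y (bq j)).
  - move=> r; apply: cvgM; first exact: cvg_cst.
    apply: cvgM; last exact: continuous_trigpoly_line.
    by apply: (@continuous_comp _ _ _ P (fun z => z ^+ 3));
      [exact: continuous_trigpoly_line | exact: exprn_continuous].
  - by move=> r n; rewrite /P /p trigpoly_period.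
  - by move=> r; rewrite exprn_even_ge0.
have A0 j x y : 0 <= A j x y by case: j => [|[|j]]; apply: Rintegral_ge0.
have bA j : bmf (fun z : measurableTypeR R * measurableTypeR R => A j z.1 z.2).
  have g (k : nat) (m : (measurableTypeR R * measurableTypeR R) * measurableTypeR R -> torus R) :
      measurable_fun setT m -> bmf (fun z => \int[c]_t h k (m (z, t))).
    move=> mm.
    apply: (@bmf_Rintegral2 _ _ _ _ _ (fprod_measure c c) c (h k \o m)).
    exact: bmf_comp.
  have m11 : measurable_fun setT (fun w : (measurableTypeR R * measurableTypeR R) * measurableTypeR R => w.1.1).
    exact: (measurableT_comp measurable_fst measurable_fst).
  have m12 : measurable_fun setT (fun w : (measurableTypeR R * measurableTypeR R) * measurableTypeR R => w.1.2).
    exact: (measurableT_comp measurable_snd measurable_fst).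
  case: j => [|[|j]].
  - apply: (g 0%N (fun w => ((w.2, w.1.1), w.1.2))).
    by apply: measurable_fun_pair => //; apply: measurable_fun_pair.
  - apply: (g 1%N (fun w => ((w.1.1, w.2), w.1.2))).
    by apply: measurable_fun_pair => //; apply: measurable_fun_pair.
  - apply: (g 2%N (fun w => ((w.1.1, w.1.2), w.2))).
    by apply: measurable_fun_pair => //; apply: measurable_fun_pair.
have I6 : \int[TM]_x (p x ^+ 6) <= Num.sqrt (\int[TM]_x h 0%N x) *
   Num.sqrt (\int[TM]_x h 1%N x) * Num.sqrt (\int[TM]_x h 2%N x).
  rewrite (torus_fubini2 (bh 0%N)) (torus_fubini3 (bh 1%N)) (torus_fubini1 (bh 2%N)).
  apply: (loomis_whitney (A := A)) => //; first exact: bmfX.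
  move=> x1 x2 x3; rewrite -!sqrtrM ?mulr_ge0//.
  have -> : p (x1, x2, x3) ^+ 6 = Num.sqrt (p (x1, x2, x3) ^+ 4 * p (x1, x2, x3) ^+ 4 * p (x1, x2, x3) ^+ 4).
    have -> : forall r : R, r ^+ 4 * r ^+ 4 * r ^+ 4 = (r ^+ 6) ^+ 2 by move=> r; ring.
    by rewrite sqrtr_sqr ger0_norm// exprn_even_ge0.
  have p40 x : 0 <= p x ^+ 4 by rewrite exprn_even_ge0.
  have e0 := p4 0%N (x1, x2, x3) x1.
  have e1 := p4 1%N (x1, x2, x3) x2.
  have e2 := p4 2%N (x1, x2, x3) x3.
  have x40 := p40 (x1, x2, x3).
  by rewrite ler_wsqrtr// (ler_pM (mulr_ge0 x40 x40) x40 (ler_pM x40 x40 e0 e1) e2).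
set Q := \int[TM]_x (p x ^+ 6).
set W := vol R * H.
have V0 := ltW (vol_gt0 R).
have b0 k : 0 <= bracket2 R k by rewrite /bracket2 /normsq !addr_ge0 ?sqr_ge0.
have H0 : 0 <= H by apply: sumr_ge0 => k _; rewrite mulr_ge0 ?csq_ge0.
have W0 : 0 <= W by rewrite mulr_ge0.
have Q0 : 0 <= Q by apply: Rintegral_ge0 => x _; rewrite exprn_even_ge0.
have L2 : \int[TM]_x (p x ^+ 2) <= W.
  apply: le_trans (trigpoly_L2 u us) _; rewrite ler_wpM2l// ler_sum// => k _.
  by rewrite ler_peMl ?csq_ge0// /bracket2 lerDl /normsq !addr_ge0 ?sqr_ge0.
have L2' j : \int[TM]_x (q j x ^+ 2) <= W.
  apply: le_trans (trigpoly_L2 _ us) _; rewrite ler_wpM2l// ler_sum// => k _.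
  rewrite csq_imul ler_wpM2r ?csq_ge0//.
  have n0 (i : int) : 0 <= (i%:~R : R) ^+ 2 by exact: sqr_ge0.
  by case: j => [|[|j]]; rewrite /coord /bracket2 /normsq;
    have := n0 k.1.1; have := n0 k.1.2; have := n0 k.2; clear; lra.
have cs (g : torus R -> R) : bmf g -> \int[TM]_x (g x ^+ 2) <= W ->
    \int[TM]_x `|p x ^+ 3 * g x| <= Num.sqrt Q * Num.sqrt W.
  move=> bg gW.
  have bp3 : bmf (fun x => p x ^+ 3) by exact: bmfX.
  have := cauchy_schwarz_Rintegral tf (bmf_norm bp3) (bmf_norm bg).
  rewrite (_ : \int[TM]_x (`|p x ^+ 3| ^+ 2) = Q); last first.
    by apply: eq_Rintegral => x _; rewrite real_normK ?num_real// -exprM.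
  rewrite (_ : \int[TM]_x (`|g x| ^+ 2) = \int[TM]_x (g x ^+ 2)); last first.
    by apply: eq_Rintegral => x _; rewrite real_normK ?num_real.
  rewrite -(sqrtrM _ Q0) => E.
  under eq_Rintegral do rewrite normrM.
  apply: le_trans (ler_norm _) _; rewrite -sqrtr_sqr ler_wsqrtr//.
  by apply: le_trans E _; rewrite ler_wpM2l.
have ah j : \int[TM]_x h j x <= 5 * (Num.sqrt Q * Num.sqrt W).
  rewrite /h (RintegralDb tf); first last.
  - by apply: bmf_norm; apply: bmfZ; apply: bmfM => //; exact: bmfX.
  - exact: bmfX.
  rewrite (_ : \int[TM]_x (p x ^+ 4) = \int[TM]_x `|p x ^+ 3 * p x|); last first.
    apply: eq_Rintegral => x _; rewrite -exprSr ger0_norm//.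
    by rewrite exprn_even_ge0.
  rewrite (_ : \int[TM]_x `|4 * (p x ^+ 3 * q j x)| = 4 * \int[TM]_x `|p x ^+ 3 * q j x|); last first.
    rewrite -(RintegralZb tf); last by apply: bmf_norm; apply: bmfM => //; exact: bmfX.
    by apply: eq_Rintegral => x _; rewrite normrM ger0_norm.
  have := cs _ bp L2; have := cs _ (bq j) (L2' j); lra.
set t := Num.sqrt (5 * (Num.sqrt Q * Num.sqrt W)).
have QT : Q <= t ^+ 3.
  apply: le_trans I6 _; rewrite !exprS expr0 mulr1 mulrA.
  by rewrite !ler_pM ?mulr_ge0 ?sqrtr_ge0// ler_wsqrtr.
have t4 : t ^+ 4 = 25 * (Q * W).
  rewrite (exprM t 2 2) sqr_sqrtr ?mulr_ge0 ?sqrtr_ge0//.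
  by rewrite !exprMn !sqr_sqrtr//; ring.
have [Q00|Qn] := eqVneq Q 0.
  by rewrite Q00; apply: mulr_ge0; [apply: mulr_ge0|]; apply: exprn_ge0.
have Qp : 0 < Q ^+ 3 by rewrite exprn_gt0// lt_neqAle eq_sym Qn.
rewrite -(ler_pM2l Qp) -exprSr.
apply: (@le_trans _ _ ((t ^+ 3) ^+ 4)); first by rewrite lerXn2r ?nnegrE// exprn_ge0 ?sqrtr_ge0.
rewrite -exprM mulnC exprM t4 /W; apply: eq_le_real; ring.
Qed.

End Sobolev.

(** * Negative powers of 1 - Delta on L^6 *)

Section Contractions.
Variable R : realType.
Local Notation c := (circle_measure R).
Local Notation TM := (torus_measure R).
Implicit Types (s : seq Z3) (u v : distr R).

Lemma multiplier_comp (m m' : Z3 -> R) u :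
  multiplier m (multiplier m' u) = multiplier (fun k => m k * m' k) u.
Proof. by apply/funext => k; rewrite /multiplier rmorphM mulrA. Qed.

Lemma Re_multiplier (m : Z3 -> R) u k :
  complex.Re (multiplier m u k) = m k * complex.Re (u k).
Proof. by rewrite /multiplier; case: (u k) => a b /=; rewrite mul0r subr0. Qed.

Lemma Im_multiplier (m : Z3 -> R) u k :
  complex.Im (multiplier m u k) = m k * complex.Im (u k).
Proof. by rewrite /multiplier; case: (u k) => a b /=; rewrite mul0r addr0. Qed.

Lemma csq_multiplier (m : Z3 -> R) u k :
  csq (multiplier m u k) = m k ^+ 2 * csq (u k).
Proof. by rewrite /csq Re_multiplier Im_multiplier; ring. Qed.

Lemma eq_trigpoly s u v x :
  (forall k, k \in s -> u k = v k) -> trigpoly s u x = trigpoly s v x.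
Proof.
move=> uv; rewrite /trigpoly big_seq [RHS]big_seq; apply: eq_bigr => k ks.
by rewrite /wave uv.
Qed.

Lemma trigpoly_lin s (a b : R) (m m' m'' : Z3 -> R) u x :
  (forall k, m k = a * m' k + b * m'' k) ->
  trigpoly s (multiplier m u) x =
  a * trigpoly s (multiplier m' u) x + b * trigpoly s (multiplier m'' u) x.
Proof.
move=> E; rewrite /trigpoly !mulr_sumr -big_split /=; apply: eq_bigr => k _.
by rewrite /wave !Re_multiplier !Im_multiplier E; ring.
Qed.

(** The difference of the two sides is [(y - x)^2] times a sum of squares. *)
Lemma tangent6 (x y : R) : x ^+ 6 + 6 * x ^+ 5 * (y - x) <= y ^+ 6.
Proof.
rewrite -subr_ge0.
have -> : y ^+ 6 - (x ^+ 6 + 6 * x ^+ 5 * (y - x)) = (y - x) ^+ 2 *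
  ((y ^+ 2 + y * x) ^+ 2 + 2 * (y * x + x ^+ 2) ^+ 2 + 3 * (x ^+ 2) ^+ 2) by ring.
apply: mulr_ge0; first exact: sqr_ge0.
have := sqr_ge0 (y ^+ 2 + y * x); have := sqr_ge0 (y * x + x ^+ 2); have := sqr_ge0 (x ^+ 2); lra.
Qed.

Lemma convex6 (a b t : R) : 0 <= t <= 1 ->
  (t * a + (1 - t) * b) ^+ 6 <= t * a ^+ 6 + (1 - t) * b ^+ 6.
Proof.
move=> /andP[t0 t1]; set m := t * a + (1 - t) * b.
have h1 := ler_wpM2l t0 (tangent6 m a).
have t1' : 0 <= 1 - t by rewrite subr_ge0.
have h2 := ler_wpM2l t1' (tangent6 m b).
have := lerD h1 h2; apply: le_trans; apply: eq_le_real.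
by rewrite /m; ring.
Qed.

Lemma normsq_ge0 k : 0 <= normsq R k.
Proof. by rewrite /normsq !addr_ge0 ?sqr_ge0. Qed.

Lemma bracket2_ge1 k : 1 <= bracket2 R k.
Proof. by rewrite /bracket2 lerDl normsq_ge0. Qed.

Lemma bracket2_gt0 k : 0 < bracket2 R k.
Proof. exact: lt_le_trans ltr01 (bracket2_ge1 k). Qed.

(** The derivative of [p^5 p_j], where [p_j] is the partial derivative of [p],
    integrates to zero along the [j]-th coordinate lines. *)
Lemma trigpoly_ibp j s u :
  \int[TM]_x (trigpoly s u x ^+ 5 * trigpoly s (pderiv j (pderiv j u)) x) <= 0.
Proof.
have bp (w : distr R) : bmf (trigpoly s w) by exact: bmf_trigpoly.
set p := trigpoly s u; set p1 := trigpoly s (pderiv j u).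
set p2 := trigpoly s (pderiv j (pderiv j u)).
have tf := torus_fin R.
pose F x := 5 * p x ^+ 4 * p1 x ^+ 2 + p x ^+ 5 * p2 x.
have bF : bmf F.
  apply: bmfD; apply: bmfM => //; try by apply: bmfX; exact: bp.
  - by apply: bmfZ; apply: bmfX; exact: bp.
  - exact: bp.
have line0 y : \int[c]_t F (line j y t) = 0.
  have dP (r : R) := is_derive_trigpoly j s u y r.
  have dP1 (r : R) := is_derive_trigpoly j s (pderiv j u) y r.
  have dF (r : R) : is_derive r (1 : R) (fun r => p (line j y r) ^+ 5 * p1 (line j y r)) (F (line j y r)).
    have H := is_deriveM (is_deriveX 5 (dP r)) (dP1 r).
    apply: is_derive_eq H _.
    rewrite -[X in X *: _ + _]/(p (line j y r) ^+ 5) /F /GRing.scale /= -/p -/p1 -/p2; ring.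
  rewrite (circle_FTC _ _ dF).
  - have -> : 2 * pi = 0 + 1%:~R * (2 * pi) :> R by rewrite add0r mul1r.
    by rewrite /p /p1 !trigpoly_period subrr.
  - exact: (bmf_line j y bF).
  - have cl w := @continuous_trigpoly_line R j s w y.
    have cX n : continuous (fun t => p (line j y t) ^+ n).
      by move=> r; apply: (@continuous_comp _ _ _ (fun t => p (line j y t)) (fun z : R => z ^+ n));
        [exact: cl | exact: exprn_continuous].
    have cX1 n : continuous (fun t => p1 (line j y t) ^+ n).
      by move=> r; apply: (@continuous_comp _ _ _ (fun t => p1 (line j y t)) (fun z : R => z ^+ n));
        [exact: cl | exact: exprn_continuous].
    move=> r; apply: cvgD; apply: cvgM.
    + by apply: cvgM; [exact: cvg_cst | exact: cX].
    + exact: cX1.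
    + exact: cX.
    + exact: cl.
have I0 : \int[TM]_x F x = 0.
  case: j @p1 @p2 F bF line0 => [|[|j]] p1 p2 F bF line0.
  - rewrite (torus_fubini2 bF); under eq_Rintegral => b _.
      under eq_Rintegral => e _ do rewrite (line0 ((0, b), e)).
      rewrite Rintegral_cst// mul0r; over.
    by rewrite Rintegral_cst// mul0r.
  - rewrite (torus_fubini3 bF); under eq_Rintegral => b _.
      under eq_Rintegral => e _ do rewrite (line0 ((b, 0), e)).
      rewrite Rintegral_cst// mul0r; over.
    by rewrite Rintegral_cst// mul0r.
  - rewrite (torus_fubini1 bF); under eq_Rintegral => b _.
      under eq_Rintegral => e _ do rewrite (line0 ((b, e), 0)).
      rewrite Rintegral_cst// mul0r; over.
    by rewrite Rintegral_cst// mul0r.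
rewrite -I0; apply: (bmf_Rintegral_le tf) => //.
  by apply: bmfM; [apply: bmfX; exact: bp | exact: bp].
move=> x; rewrite /F lerDr; apply: mulr_ge0; last exact: sqr_ge0.
by apply: mulr_ge0 => //; exact: exprn_even_ge0.
Qed.

Lemma laplacian_dissip s u :
  0 <= \int[TM]_x (trigpoly s u x ^+ 5 * trigpoly s (multiplier (normsq R) u) x).
Proof.
have bp (w : distr R) : bmf (trigpoly s w) by exact: bmf_trigpoly.
have tf := torus_fin R.
have bm j : bmf (fun x => trigpoly s u x ^+ 5 * trigpoly s (pderiv j (pderiv j u)) x).
  by apply: bmfM => //; exact: bmfX.
rewrite (_ : \int[TM]_x _ = - (\int[TM]_x (trigpoly s u x ^+ 5 * trigpoly s (pderiv 0 (pderiv 0 u)) x)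
  + \int[TM]_x (trigpoly s u x ^+ 5 * trigpoly s (pderiv 1 (pderiv 1 u)) x)
  + \int[TM]_x (trigpoly s u x ^+ 5 * trigpoly s (pderiv 2 (pderiv 2 u)) x))).
  rewrite oppr_ge0; have := trigpoly_ibp 0 s u; have := trigpoly_ibp 1 s u.
  have := trigpoly_ibp 2 s u; lra.
rewrite -(RintegralDb tf)// -(RintegralDb tf)//; last exact: bmfD.
rewrite -[RHS]mulN1r -(RintegralZb tf); last by apply: bmfD => //; exact: bmfD.
apply: eq_Rintegral => x _; rewrite -!mulrDr mulrCA mulN1r; congr (_ * _).
rewrite /trigpoly -!big_split /= -sumrN; apply: eq_bigr => k _.
rewrite /wave Re_multiplier Im_multiplier /pderiv /imul /normsq /=; ring.
Qed.

Definition contraction6 (m : Z3 -> R) := forall s u,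
  \int[TM]_x (trigpoly s (multiplier m u) x ^+ 6) <= \int[TM]_x (trigpoly s u x ^+ 6).

(** The equation [v - a Delta v = u] is tested against [v^5]. *)
Lemma contraction6_resolvent (a : R) : 0 <= a ->
  contraction6 (fun k => (1 + a * normsq R k)^-1).
Proof.
move=> a0 s u; pose m (k : Z3) := (1 + a * normsq R k)^-1.
rewrite -[X in multiplier X]/m; set v := multiplier m u.
have tf := torus_fin R.
have bp (w : distr R) : bmf (trigpoly s w) by exact: bmf_trigpoly.
have uE x : trigpoly s u x = trigpoly s v x + a * trigpoly s (multiplier (normsq R) v) x.
  rewrite /v multiplier_comp -[X in X + _]mul1r.
  rewrite -(@trigpoly_lin s 1 a (fun=> 1) m (fun k => normsq R k * m k)); last first.
    move=> k; rewrite /m mulrA -mulrDl mulfV// gt_eqF//.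
    by rewrite ltr_wpDr// mulr_ge0 ?normsq_ge0.
  by apply: eq_trigpoly => k _; rewrite /multiplier rmorph1 mul1r.
have := laplacian_dissip s v; set D := \int[TM]_x _ => D0.
have : \int[TM]_x (trigpoly s v x ^+ 6 + 6 * a * (trigpoly s v x ^+ 5 *
   trigpoly s (multiplier (normsq R) v) x)) <= \int[TM]_x (trigpoly s u x ^+ 6).
  apply: (bmf_Rintegral_le tf).
  - apply: bmfD; first exact: bmfX.
    by apply: bmfZ; apply: bmfM => //; exact: bmfX.
  - exact: bmfX.
  move=> x; have := tangent6 (trigpoly s v x) (trigpoly s u x); rewrite uE.
  by apply: le_trans; apply: eq_le_real; ring.
rewrite (RintegralDb tf); first last.
- by apply: bmfZ; apply: bmfM => //; exact: bmfX.
- exact: bmfX.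
rewrite (RintegralZb tf); last by apply: bmfM => //; exact: bmfX.
by apply: le_trans; rewrite lerDl mulr_ge0// mulr_ge0.
Qed.

Lemma contraction6_convex (t : R) (m m' m'' : Z3 -> R) : 0 <= t <= 1 ->
  contraction6 m' -> contraction6 m'' ->
  (forall k, m k = t * m' k + (1 - t) * m'' k) -> contraction6 m.
Proof.
move=> /andP[t0 t1] cm' cm'' mE s u.
have tf := torus_fin R.
have bp (w : distr R) : bmf (fun x => trigpoly s w x ^+ 6) by apply: bmfX; exact: bmf_trigpoly.
apply: (@le_trans _ _ (\int[TM]_x (t * trigpoly s (multiplier m' u) x ^+ 6 +
   (1 - t) * trigpoly s (multiplier m'' u) x ^+ 6))).
  apply: (bmf_Rintegral_le tf) => //; first by apply: bmfD; exact: bmfZ.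
  by move=> x; rewrite (trigpoly_lin s u x mE); apply: convex6; rewrite t0.
rewrite (RintegralDb tf); try exact: bmfZ.
rewrite !(RintegralZb tf)//.
have := ler_wpM2l t0 (cm' s u); have := @ler_wpM2l _ (1 - t) _ _ _ (cm'' s u).
by rewrite subr_ge0 => /(_ t1); lra.
Qed.

Lemma contraction6_comp m m' : contraction6 m -> contraction6 m' ->
  contraction6 (fun k => m k * m' k).
Proof. by move=> cm cm' s u; rewrite -multiplier_comp; apply: le_trans (cm _ _) (cm' _ _). Qed.

Lemma contraction6_1 : contraction6 (fun=> 1).
Proof.
move=> s u; rewrite (_ : multiplier _ u = u)//.
by apply/funext => k; rewrite /multiplier rmorph1 mul1r.
Qed.

Lemma contraction6_moebius (a b : R) : 0 <= b -> b <= a ->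
  contraction6 (fun k => (1 + b * normsq R k) / (1 + a * normsq R k)).
Proof.
move=> b0 ba; have a0 := le_trans b0 ba.
have [a00|an] := eqVneq a 0.
  have -> : b = a by apply/eqP; rewrite eq_le ba a00 b0.
  rewrite (_ : (fun k => _) = (fun=> 1)); first exact: contraction6_1.
  by apply/funext => k; rewrite a00 mul0r addr0 divr1.
apply: (@contraction6_convex (b / a) _ (fun=> 1) (fun k => (1 + a * normsq R k)^-1)).
- by rewrite divr_ge0//= ler_pdivrMr ?mul1r// lt_neqAle eq_sym an.
- exact: contraction6_1.
- exact: contraction6_resolvent.
move=> k; have n0 : 1 + a * normsq R k != 0.
  by rewrite gt_eqF// ltr_wpDr// mulr_ge0 ?normsq_ge0.
by field; rewrite an n0.
Qed.

(** By induction on the power: expanding one factor, whose coefficients converge,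
    leaves finitely many integrals with one factor less and another weight [g]. *)
Lemma cvg_wave_pow {T : Type} (F : set_system T) {FF : Filter F}
    (U : T -> distr R) u s n :
  (forall k, complex.Re (U t k) @[t --> F] --> complex.Re (u k)) ->
  (forall k, complex.Im (U t k) @[t --> F] --> complex.Im (u k)) ->
  forall g : torus R -> R, bmf g ->
  (\int[TM]_x (g x * trigpoly s (U t) x ^+ n)) @[t --> F] -->
   \int[TM]_x (g x * trigpoly s u x ^+ n).
Proof.
move=> cR cI; elim: n => [|n ih] g bg.
  by under eq_fun do under eq_Rintegral do rewrite expr0; apply: cvg_cst.
have tf := torus_fin R.
have E w : \int[TM]_x (g x * trigpoly s w x ^+ n.+1) = \sum_(k <- s)
   (complex.Re (w k) * \int[TM]_x (g x * cos (dotp k x) * trigpoly s w x ^+ n)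
   - complex.Im (w k) * \int[TM]_x (g x * sin (dotp k x) * trigpoly s w x ^+ n)).
  have bc k : bmf (fun x => g x * cos (dotp k x) * trigpoly s w x ^+ n).
    by apply: bmfM; [apply: bmfM => //; exact: bmf_cosd | apply: bmfX; exact: bmf_trigpoly].
  have bs k : bmf (fun x => g x * sin (dotp k x) * trigpoly s w x ^+ n).
    by apply: bmfM; [apply: bmfM => //; exact: bmf_sind | apply: bmfX; exact: bmf_trigpoly].
  transitivity (\sum_(k <- s) \int[TM]_x
   (complex.Re (w k) * (g x * cos (dotp k x) * trigpoly s w x ^+ n)
   - complex.Im (w k) * (g x * sin (dotp k x) * trigpoly s w x ^+ n))).
    rewrite -(@Rintegral_sum _ _ _ TM); last first.
      by move=> k; apply: (integrable_bmf tf); apply: bmfB; exact: bmfZ.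
    apply: eq_Rintegral => x _; rewrite exprS {1}/trigpoly mulr_suml mulr_sumr.
    by apply: eq_bigr => k _; rewrite /wave; ring.
  apply: eq_bigr => k _; rewrite (RintegralBb tf); try exact: bmfZ.
  by rewrite !(RintegralZb tf).
rewrite (_ : (fun t => _) = (fun t => \sum_(k <- s)
   (complex.Re (U t k) * \int[TM]_x (g x * cos (dotp k x) * trigpoly s (U t) x ^+ n)
   - complex.Im (U t k) * \int[TM]_x (g x * sin (dotp k x) * trigpoly s (U t) x ^+ n)))); last first.
  by apply/funext => t; exact: E.
rewrite E; apply: cvg_big => [|k _]; first exact: add_continuous.
have i1 : bmf (fun x => g x * cos (dotp k x)) by apply: bmfM => //; exact: bmf_cosd.
have i2 : bmf (fun x => g x * sin (dotp k x)) by apply: bmfM => //; exact: bmf_sind.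
by apply: cvgB; (apply: cvgM; [exact: cR || exact: cI | exact: ih i1 || exact: ih i2]).
Qed.

Lemma cvg_trigpoly6 {T : Type} (F : set_system T) {FF : Filter F}
    (U : T -> distr R) u s :
  (forall k, complex.Re (U t k) @[t --> F] --> complex.Re (u k)) ->
  (forall k, complex.Im (U t k) @[t --> F] --> complex.Im (u k)) ->
  (\int[TM]_x (trigpoly s (U t) x ^+ 6)) @[t --> F] --> \int[TM]_x (trigpoly s u x ^+ 6).
Proof.
move=> cR cI.
have E w : \int[TM]_x (trigpoly s w x ^+ 6) = \int[TM]_x (1 * trigpoly s w x ^+ 6).
  by apply: eq_Rintegral => x _; rewrite mul1r.
rewrite E (_ : (fun t => _) = (fun t => \int[TM]_x (1 * trigpoly s (U t) x ^+ 6))).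
  exact: cvg_wave_pow.
by apply/funext => t; exact: E.
Qed.

Lemma cvg_le_cst (f : nat -> R) (a b : R) :
  f n @[n --> \oo] --> a -> (forall n, f n <= b) -> a <= b.
Proof.
by move=> fa fb; apply: (cvgr_to_le fa); exact: nearW.
Qed.

Lemma contraction6_cvg (M : nat -> Z3 -> R) m :
  (forall n, contraction6 (M n)) -> (forall k, M n k @[n --> \oo] --> m k) ->
  contraction6 m.
Proof.
move=> cM Mm s u.
apply: (@cvg_le_cst (fun n => \int[TM]_x (trigpoly s (multiplier (M n) u) x ^+ 6))).
  apply: cvg_trigpoly6 => k.
  - under eq_fun do rewrite Re_multiplier.
    by rewrite Re_multiplier; apply: cvgM => //; exact: cvg_cst.
  - under eq_fun do rewrite Im_multiplier.
    by rewrite Im_multiplier; apply: cvgM => //; exact: cvg_cst.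
by move=> n; exact: cM.
Qed.

Lemma powR_bernoulli (x s : R) : 0 < s < 1 -> 0 <= x -> x `^ s <= 1 + s * (x - 1).
Proof.
move=> /andP[s0 s1] x0.
have sn : s != 0 by rewrite gt_eqF.
have s10 : 0 < 1 - s by rewrite subr_gt0.
have := @conjugate_powR R (x `^ s) 1 s^-1 (1 - s)^-1 (powR_ge0 _ _) ler01.
rewrite !invr_gt0 !invrK => /(_ s0 s10); rewrite addrCA subrr addr0 => /(_ erefl).
rewrite mulr1 -powRrM mulfV// powRr1// powR1; lra.
Qed.

(** For [J = n] this tends to [(1 + xi)^(-s)] as [n] tends to infinity: the product
    of the factors [1 - s xi / (n + j xi)] behaves as the exponential of
    [- s] times the integral of [xi / (1 + y xi)] over [0 <= y <= 1]. *)
Fixpoint moebius_prod (n : nat) (s xi : R) (J : nat) : R :=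
  if J is j.+1 then moebius_prod n s xi j *
    ((n%:R + (j.+1%:R - s) * xi) / (n%:R + j.+1%:R * xi))
  else 1.

(** Both bounds telescope: each factor is compared with a quotient of two
    successive denominators, raised to the power [s], by the concavity of this
    power. *)
Lemma moebius_prod_bounds (n : nat) (s xi : R) J : (0 < n)%N -> 0 < s < 1 -> 0 <= xi ->
  (n%:R / (n%:R + J%:R * xi)) `^ s <= moebius_prod n s xi J <=
  ((n%:R + xi) / (n%:R + J.+1%:R * xi)) `^ s.
Proof.
move=> n0 /[dup] s01 /andP[s0 s1] x0.
have N0 : 0 < n%:R :> R by rewrite ltr0n.
have d0 m : 0 < n%:R + m%:R * xi by rewrite ltr_wpDr// mulr_ge0.
elim: J => [|J /andP[lo up]] /=.
  by rewrite mul0r addr0 mul1r !divff ?powR1 ?lexx// gt_eqF// ltr_wpDr.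
have dJ := d0 J.+1; have dJn : n%:R + J.+1%:R * xi != 0 by rewrite gt_eqF.
have f0 : 0 <= (n%:R + (J.+1%:R - s) * xi) / (n%:R + J.+1%:R * xi).
  apply: divr_ge0; last exact: ltW.
  apply: addr_ge0; first exact: ltW.
  by rewrite mulr_ge0// subr_ge0 (le_trans (ltW s1))// ler1n.
apply/andP; split.
  rewrite (_ : n%:R / (n%:R + J.+1%:R * xi) = (n%:R / (n%:R + J%:R * xi)) *
     ((n%:R + J%:R * xi) / (n%:R + J.+1%:R * xi))); last first.
    by rewrite mulrA divfK// gt_eqF.
  have q0 : 0 <= n%:R / (n%:R + J%:R * xi) by rewrite divr_ge0// ltW.
  have q1 : 0 <= (n%:R + J%:R * xi) / (n%:R + J.+1%:R * xi) by rewrite divr_ge0// ltW.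
  rewrite powRM//; apply: ler_pM => //; rewrite ?powR_ge0//.
  apply: le_trans (powR_bernoulli s01 _) _; first by rewrite divr_ge0 ?ltW.
  apply: eq_le_real; rewrite -natr1; field.
  by rewrite natr1.
rewrite (_ : (n%:R + xi) / (n%:R + J.+2%:R * xi) = ((n%:R + xi) / (n%:R + J.+1%:R * xi)) *
     ((n%:R + J.+1%:R * xi) / (n%:R + J.+2%:R * xi))); last first.
  by rewrite mulrA divfK.
have p1 : 0 <= (n%:R + xi) / (n%:R + J.+1%:R * xi) 
  by apply: divr_ge0; [apply: addr_ge0 => //; exact: ltW | exact: ltW].
rewrite powRM//; last by apply: divr_ge0; exact: ltW.
apply: ler_pM => //.
  by apply: le_trans lo; exact: powR_ge0.
set y := (n%:R + J.+2%:R * xi) / (n%:R + J.+1%:R * xi).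
have y0 : 0 < y by rewrite divr_gt0.
have -> : (n%:R + J.+1%:R * xi) / (n%:R + J.+2%:R * xi) = y^-1 by rewrite /y invf_div.
have -> : (n%:R + (J.+1%:R - s) * xi) / (n%:R + J.+1%:R * xi) = 1 - s * (y - 1).
  by move: dJn; rewrite /y -[J.+2%:R]natr1; move: (J.+1%:R : R) => a an; field.
rewrite -powR_inv1; last exact: ltW.
rewrite -powRrM mulN1r powRN.
rewrite -[X in _ <= X]mul1r ler_pdivlMr ?powR_gt0//.
have b := powR_bernoulli s01 (ltW y0).
have y1 : 0 <= y - 1.
  by rewrite subr_ge0 /y ler_pdivlMr// mul1r lerD2l ler_wpM2r// ler_nat.
have t0 : 0 <= 1 - s * (y - 1).
  move: f0; rewrite (_ : _ / _ = 1 - s * (y - 1))//.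
  by move: dJn; rewrite /y -[J.+2%:R]natr1; move: (J.+1%:R : R) => a an; field.
apply: le_trans (ler_wpM2l t0 b) _.
rewrite (_ : _ * _ = 1 - (s * (y - 1)) ^+ 2); last by ring.
by rewrite gerBl sqr_ge0.
Qed.

Lemma contraction6_moebius_prod (n : nat) (s : R) J : (0 < n)%N -> 0 < s < 1 ->
  contraction6 (fun k => moebius_prod n s (normsq R k) J).
Proof.
move=> n0 /andP[s0 s1]; elim: J => [|j ih] /=; first exact: contraction6_1.
apply: contraction6_comp => //.
have N0 : 0 < n%:R :> R by rewrite ltr0n.
rewrite (_ : (fun k => _) = (fun k => (1 + ((j.+1%:R - s) / n%:R) * normsq R k) /
   (1 + (j.+1%:R / n%:R) * normsq R k))).
  apply: contraction6_moebius.
    by rewrite divr_ge0 ?ltW// subr_gt0 (lt_le_trans s1)// ler1n.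
  by rewrite ler_pM2r ?invr_gt0// gerBl ltW.
apply/funext => k.
have Nn : n%:R != 0 :> R by rewrite gt_eqF.
have e (a : R) : 1 + a / n%:R * normsq R k = (n%:R + a * normsq R k) / n%:R by field.
by rewrite !e invf_div mulrA divfK.
Qed.

(** The symbol is a limit of products of Moebius functions of [|k|^2], each of
    which is a convex combination of 1 and of a resolvent. *)
Lemma contraction6_bessel (s : R) : 0 < s < 1 ->
  contraction6 (fun k => bracket2 R k `^ (- s)).
Proof.
move=> s01; have /andP[s0 s1] := s01.
apply: (contraction6_cvg (M := fun n k => moebius_prod n.+1 s (normsq R k) n.+1)).
  by move=> n; exact: contraction6_moebius_prod.
move=> k; set x := normsq R k; have x0 : 0 <= x by exact: normsq_ge0.
have b0 := bracket2_gt0 k.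
have up n : ((n.+1%:R + x) / (n.+1%:R + n.+2%:R * x)) `^ s <=
    bracket2 R k `^ (- s) * (1 + s * x * n.+1%:R^-1).
  have N0 : 0 < n.+1%:R :> R by rewrite ltr0n.
  apply: (@le_trans _ _ (((bracket2 R k)^-1 * (1 + x / n.+1%:R)) `^ s)).
    have q0 : 0 <= x / n.+1%:R by rewrite divr_ge0.
    have i0 : 0 <= (bracket2 R k)^-1 by rewrite invr_ge0 ltW.
    have s0' := ltW s0.
    have n2x : 0 <= n.+2%:R * x by rewrite mulr_ge0.
    have h1 : 0 <= 1 + x / n.+1%:R by rewrite addr_ge0.
    apply: ge0_ler_powR => //; rewrite ?nnegrE ?divr_ge0 ?mulr_ge0 ?addr_ge0 ?sqr_ge0//.
    rewrite (_ : (bracket2 R k)^-1 * (1 + x / n.+1%:R) =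
      (n.+1%:R + x) / (n.+1%:R * bracket2 R k)); last first.
      by field; rewrite !gt_eqF.
    apply: ler_wpM2l; first by rewrite addr_ge0.
    rewrite lef_pV2 ?posrE ?mulr_gt0//; last by rewrite ltr_wpDr// mulr_ge0.
    by rewrite /bracket2 -/x mulrDr mulr1 lerD2l ler_wpM2r// ler_nat.
  have i0 : 0 <= (bracket2 R k)^-1 by rewrite invr_ge0 ltW.
  rewrite powRM//; last by rewrite addr_ge0// divr_ge0.
  rewrite -powR_inv1; last exact: ltW.
  rewrite -powRrM mulN1r ler_wpM2l ?powR_ge0//.
  apply: le_trans (powR_bernoulli s01 _) _; first by rewrite addr_ge0// divr_ge0.
  by rewrite [1 + _ - 1]addrAC subrr add0r mulrA.
have lo n : bracket2 R k `^ (- s) = (n.+1%:R / (n.+1%:R + n.+1%:R * x)) `^ s.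
  have N0 : 0 < n.+1%:R :> R by rewrite ltr0n.
  rewrite (_ : n.+1%:R / _ = (bracket2 R k)^-1).
    by rewrite -powR_inv1 -?powRrM ?mulN1r// ltW.
  rewrite /bracket2 -/x -[X in _ / (X + _)]mulr1 -mulrDr invfM mulrA divff ?mul1r//.
apply: (@squeeze_cvgr _ _ _ _ (fun=> bracket2 R k `^ (- s))
   (fun n => bracket2 R k `^ (- s) * (1 + s * x * n.+1%:R^-1))).
- apply: nearW => n; have /andP[l u] := @moebius_prod_bounds n.+1 s x n.+1 isT s01 x0.
  by rewrite {1}(lo n) l/=; exact: le_trans u (up n).
- exact: cvg_cst.
- rewrite -[X in _ --> X]mulr1; apply: cvgM; first exact: cvg_cst.
  rewrite -[X in _ --> X]addr0; apply: cvgD; first exact: cvg_cst.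
  rewrite -(mulr0 (s * x)); apply: cvgM; first exact: cvg_cst.
  exact: cvg_harmonic.
Qed.

End Contractions.

(** * Fejer means *)

Section Fejer.
Variable R : realType.
Local Notation TM := (torus_measure R).
Implicit Types (s : seq Z3) (u v : distr R) (f g : torus R -> R).

Fixpoint zbox (n : nat) : seq int :=
  if n is m.+1 then [:: Posz m.+1, - Posz m.+1 & zbox m] else [:: 0].

Lemma mem_zbox n (k : int) : (k \in zbox n) = (`|k| <= n)%N.
Proof.
elim: n k => [|n ih] k; first by rewrite inE leqn0 absz_eq0.
rewrite !inE ih [RHS]leq_eqVlt ltnS orbA; congr (_ || _).
by case: k => m; rewrite ?NegzE ?abszN; lia.
Qed.

Lemma uniq_zbox n : uniq (zbox n).
Proof.
elim: n => [//|n ih] /=; rewrite !inE !mem_zbox ih abszN andbT.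
by apply/andP; split; lia.
Qed.

(** The truncated subtraction makes these coefficients vanish outside the box. *)
Definition zfejer (n : nat) (k : int) : R := (n.+1 - `|k|)%:R / n.+1%:R.

Lemma zfejer_ge0 n k : 0 <= zfejer n k.
Proof. by rewrite divr_ge0. Qed.

Lemma zfejer_le1 n k : zfejer n k <= 1.
Proof. by rewrite ler_pdivrMr ?ltr0n// mul1r ler_nat leq_subr. Qed.

Lemma zfejerN n k : zfejer n (- k) = zfejer n k.
Proof. by rewrite /zfejer abszN. Qed.

Lemma zfejer_out n k : k \notin zbox n -> zfejer n k = 0.
Proof.
by rewrite mem_zbox -ltnNge => nk; rewrite /zfejer (eqP nk) mul0r.
Qed.

Lemma zfejer0 n : zfejer n 0 = 1.
Proof. by rewrite /zfejer subn0 divff. Qed.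

Lemma zfejer_cvg k : zfejer n k @[n --> \oo] --> (1 : R).
Proof.
rewrite -[X in _ --> X]subr0 -(mulr0 `|k|%:R).
apply: (@cvg_trans _ ((fun n => 1 - `|k|%:R * n.+1%:R^-1) @ \oo)); last first.
  apply: cvgB; first exact: cvg_cst.
  by apply: cvgM; [exact: cvg_cst | exact: cvg_harmonic].
apply: near_eq_cvg; near=> n.
have kn : (`|k| <= n.+1)%N by near: n; exists `|k|%N => // m /= /leqW.
by rewrite /zfejer natrB// mulrBl divff.
Unshelve. all: by end_near. Qed.

Lemma zbox_sum_even n (F : int -> R) (a b : R) :
  (forall k, F (- k) = F k) ->
  \sum_(k <- zbox n) F k * cos (k%:~R * a + b) =
  (\sum_(k <- zbox n) F k * cos (k%:~R * a)) * cos b.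
Proof.
move=> Fe; elim: n => [|n ih] /=.
  by rewrite !big_seq1 mul0r add0r cos0 mulr1.
rewrite !big_cons ih Fe !intrN !mulNr cosN.
have -> : cos (- (n.+1%:~R * a) + b) = cos (n.+1%:~R * a - b).
  by rewrite -cosN opprD opprK.
by rewrite cosD cosB; ring.
Qed.

Definition zkernel n (t : R) : R := \sum_(k <- zbox n) zfejer n k * cos (k%:~R * t).

(** The Fejer kernel is the squared modulus of a sum of exponentials. *)
Lemma zkernel_ge0 n t : 0 <= zkernel n t.
Proof.
pose D m := \sum_(k <- zbox m) cos (k%:~R * t).
pose C m := \sum_(0 <= j < m.+1) cos (j%:R * t).
pose S m := \sum_(0 <= j < m.+1) sin (j%:R * t).
have step m : C m * cos (m.+1%:R * t) + S m * sin (m.+1%:R * t) =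
    \sum_(1 <= j < m.+2) cos (j%:R * t).
  rewrite /C /S !mulr_suml -big_split /= big_add1 /= big_nat_rev /=.
  rewrite !big_nat; apply: eq_bigr => j /andP[_ jm].
  rewrite add0n subSS mulrC [X in _ + X]mulrC -cosB -mulrBl; congr (cos (_ * _)).
  by rewrite -natrB; [congr (_%:R)|]; lia.
have DE m : D m = 1 + 2 * \sum_(1 <= j < m.+1) cos (j%:R * t).
  elim: m => [|m ih].
    by rewrite /D big_seq1 mul0r cos0 big_nil mulr0 addr0.
  have -> : \sum_(1 <= j < m.+2) cos (j%:R * t) =
      \sum_(1 <= j < m.+1) cos (j%:R * t) + cos (m.+1%:R * t) by rewrite big_nat_recr.
  rewrite /D [zbox m.+1]/= !big_cons -/(D m) ih intrN mulNr cosN -!pmulrn.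
  by move: (\sum_(1 <= j < m.+1) _) => x; ring.
have sq m : \sum_(k <- zbox m) (m.+1 - `|k|)%:R * cos (k%:~R * t) = C m ^+ 2 + S m ^+ 2.
  elim: m => [|m ih].
    rewrite big_seq1 /C /S !big_nat1 mul0r cos0 sin0 subn0; ring.
  have CS : C m.+1 = C m + cos (m.+1%:R * t) by rewrite /C big_nat_recr.
  have SS : S m.+1 = S m + sin (m.+1%:R * t) by rewrite /S big_nat_recr.
  have cs := cos2Dsin2 (m.+1%:R * t).
  rewrite CS SS.
  transitivity (D m.+1 + \sum_(k <- zbox m) (m.+1 - `|k|)%:R * cos (k%:~R * t)).
    rewrite /D /= !big_cons abszN /= subSnn !mul1r -!addrA; congr (_ + (_ + _)).
    rewrite -big_split /= big_seq [RHS]big_seq; apply: eq_bigr => k.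
    by rewrite mem_zbox => km; rewrite subSn ?leqW// -nat1r mulrDl mul1r.
  rewrite ih DE -step; move: cs; set a := cos _; set b := sin _ => cs.
  transitivity (C m ^+ 2 + S m ^+ 2 + 2 * (C m * a + S m * b) + (a ^+ 2 + b ^+ 2)); last by ring.
  by rewrite cs; ring.
rewrite /zkernel; under eq_bigr do rewrite /zfejer mulrAC.
by rewrite -mulr_suml divr_ge0// sq addr_ge0// sqr_ge0.
Qed.

Definition box (n : nat * nat * nat) : seq Z3 :=
  [seq (ab, d) | ab <- [seq (a, b) | a <- zbox n.1.1, b <- zbox n.1.2], d <- zbox n.2].

Definition fejer (n : nat * nat * nat) (k : Z3) : R :=
  zfejer n.1.1 k.1.1 * zfejer n.1.2 k.1.2 * zfejer n.2 k.2.

Lemma uniq_box n : uniq (box n).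
Proof.
apply: allpairs_uniq; rewrite ?uniq_zbox//; last by move=> [? ?] [? ?] _ _ [-> ->].
apply: allpairs_uniq; rewrite ?uniq_zbox//; by move=> [? ?] [? ?] _ _ [-> ->].
Qed.

Lemma mem_box n (k : Z3) :
  (k \in box n) = [&& k.1.1 \in zbox n.1.1, k.1.2 \in zbox n.1.2 & k.2 \in zbox n.2].
Proof.
case: k => [[a b] d]; rewrite andbA /=.
apply/allpairsP/andP => [[[ab d'] /= [/allpairsP[[a' b'] /= [ha hb ->]] hd [-> -> ->]]]|[/andP[ha hb] hd]].
  by rewrite ha hb.
exists ((a, b), d); split => //=; apply/allpairsP; exists (a, b); split => //.
Qed.

Lemma big_box n (F : Z3 -> R) : \sum_(k <- box n) F k =
  \sum_(a <- zbox n.1.1) \sum_(b <- zbox n.1.2) \sum_(d <- zbox n.2) F ((a, b), d).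
Proof. by rewrite big_allpairs /= big_allpairs. Qed.

Lemma big_box0 n (F : Z3 -> R) : (forall k, k != 0 -> F k = 0) ->
  \sum_(k <- box n) F k = F 0.
Proof.
move=> F0; rewrite (bigD1_seq 0) ?uniq_box ?mem_box ?mem_zbox// big1//.
exact: addr0.
Qed.

Lemma fejer_ge0 n k : 0 <= fejer n k.
Proof. by rewrite /fejer !mulr_ge0 ?zfejer_ge0. Qed.

Lemma fejer_le1 n k : fejer n k <= 1.
Proof.
apply: mulr_ile1; rewrite ?mulr_ge0 ?zfejer_ge0 ?zfejer_le1//.
by apply: mulr_ile1; rewrite ?zfejer_ge0 ?zfejer_le1.
Qed.

Lemma fejerN n k : fejer n (- k) = fejer n k.
Proof. by rewrite /fejer /= !zfejerN. Qed.

Lemma fejer_out n k : k \notin box n -> fejer n k = 0.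
Proof.
rewrite mem_box !negb_and /fejer => /or3P[] /zfejer_out ->;
by rewrite ?mul0r ?mulr0 ?mul0r.
Qed.

Lemma fejer0 n : fejer n 0 = 1.
Proof. by rewrite /fejer /= !zfejer0 !mulr1. Qed.

Lemma fejer_cvg k : fejer ((n, n), n) k @[n --> \oo] --> (1 : R).
Proof.
have := cvgM (cvgM (zfejer_cvg k.1.1) (zfejer_cvg k.1.2)) (zfejer_cvg k.2).
by rewrite !mulr1 => H; exact: H.
Qed.

Definition fkernel n (x y : torus R) : R :=
  \sum_(k <- box n) fejer n k * cos (dotp k x - dotp k y).

Lemma fkernel_ge0 n x y : 0 <= fkernel n x y.
Proof.
pose t1 := x.1.1 - y.1.1 : R; pose t2 := x.1.2 - y.1.2 : R; pose t3 := x.2 - y.2 : R.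
rewrite (_ : fkernel n x y = zkernel n.2 t3 * zkernel n.1.2 t2 * zkernel n.1.1 t1).
  by rewrite !mulr_ge0 ?zkernel_ge0.
transitivity (\sum_(a <- zbox n.1.1) \sum_(b <- zbox n.1.2) \sum_(d <- zbox n.2)
    zfejer n.1.1 a * zfejer n.1.2 b * (zfejer n.2 d * cos (d%:~R * t3 + (b%:~R * t2 + a%:~R * t1)))).
  rewrite /fkernel big_box /fejer /dotp /=.
  apply: eq_bigr => a _; apply: eq_bigr => b _; apply: eq_bigr => d _.
  rewrite -[LHS]mulrA; congr (_ * (_ * cos _)); rewrite /t1 /t2 /t3; ring.
transitivity (\sum_(a <- zbox n.1.1) \sum_(b <- zbox n.1.2)
    zkernel n.2 t3 * zfejer n.1.1 a * (zfejer n.1.2 b * cos (b%:~R * t2 + a%:~R * t1))).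
  apply: eq_bigr => a _; apply: eq_bigr => b _.
  by rewrite -mulr_sumr zbox_sum_even; [rewrite -/(zkernel _ _); ring | exact: zfejerN].
rewrite /(zkernel n.1.1 t1) mulr_sumr; apply: eq_bigr => a _.
by rewrite -mulr_sumr zbox_sum_even; [rewrite -/(zkernel _ _); ring | exact: zfejerN].
Qed.

(** The Fejer mean of the distribution with coefficients [u]. *)
Definition fmean n u : torus R -> R := trigpoly (box n) (multiplier (fejer n) u).

Lemma bmf_fmean n u : bmf (fmean n u).
Proof. exact: bmf_trigpoly. Qed.

Lemma bmf_kernelB n x : bmf (fun y => fkernel n x y).
Proof.
apply: bmf_sum => k; apply: bmfZ.
apply: bmf_cos; apply: measurable_funB => //; exact: measurable_dotp.
Qed.

(** The positivity of the kernel thus makes Fejer means averages of [f]. *)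
Lemma fmean_conv n f x : TM.-integrable setT (EFin \o f) ->
  \int[TM]_y (f y * fkernel n x y) = vol R * fmean n (fourier f) x.
Proof.
move=> fi.
pose z (k : Z3) : R[i] := Complex (fejer n k * cos (dotp k x)) (- (fejer n k * sin (dotp k x))).
rewrite (_ : \int[TM]_y _ = \int[TM]_y (f y * trigpoly (box n) z y)); last first.
  apply: eq_Rintegral => y _; congr (_ * _); apply: eq_bigr => k _.
  by rewrite /wave /z /= cosB; ring.
rewrite pairing//; congr (_ * _); apply: eq_bigr => k _.
by rewrite /wave /z Re_multiplier Im_multiplier /=; ring.
Qed.

Lemma fmean_int n f : TM.-integrable setT (EFin \o f) ->
  \int[TM]_x fmean n (fourier f) x = \int[TM]_x f x.
Proof.
move=> fi; have tf := torus_fin R.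
rewrite /fmean /trigpoly (@Rintegral_sum _ _ _ TM); last first.
  by move=> k; apply: (integrable_bmf tf); exact: bmf_wave.
have W k (z : R[i]) : \int[TM]_x wave z k x = if k == 0 then vol R * complex.Re z else 0.
  rewrite (RintegralBb tf); try by apply: bmfZ; [exact: bmf_cosd || exact: bmf_sind].
  rewrite !(RintegralZb tf); try by [exact: bmf_cosd || exact: bmf_sind].
  have -> : \int[TM]_x cos (dotp k x) = \int[TM]_x cos (dotp k x + 0).
    by apply: eq_Rintegral => x _; rewrite addr0.
  have -> : \int[TM]_x sin (dotp k x) = \int[TM]_x sin (dotp k x + 0).
    by apply: eq_Rintegral => x _; rewrite addr0.
  rewrite torus_int_cos torus_int_sin cos0 sin0 !mulr0 mulr1.
  by case: ifP => _; rewrite ?mulr0 subr0// mulrC.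
under eq_bigr do rewrite W.
rewrite big_box0 ?eqxx; last by move=> k /negbTE ->.
rewrite Re_multiplier fejer0 mul1r -Re_fourier; apply: eq_Rintegral => x _.
by rewrite /dotp !mul0r !addr0 cos0 mulr1.
Qed.

Section Jensen.
Variables (Phi dPhi : R -> R).
Hypothesis mPhi : measurable_fun setT Phi.
Hypothesis tangent : forall x y, Phi x + dPhi x * (y - x) <= Phi y.

(** Jensen's inequality for the probability density [y |-> fkernel n x y / vol]. *)
Lemma fmean_jensen n f x : TM.-integrable setT (EFin \o f) ->
  TM.-integrable setT (EFin \o (fun x => Phi (f x))) ->
  Phi (fmean n (fourier f) x) <= fmean n (fourier (fun x => Phi (f x))) x.
Proof.
move=> fi Pi; set a := fmean n (fourier f) x.
have tf := torus_fin R.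
rewrite -(ler_pM2l (vol_gt0 R)) -fmean_conv//.
have bk := bmf_kernelB n x.
have ik1 : TM.-integrable setT (EFin \o (fun y => f y * fkernel n x y)).
  by under eq_fun do rewrite mulrC; exact: integrable_bmfM.
have ik : TM.-integrable setT (EFin \o (fun y => fkernel n x y)) by exact: integrable_bmf.
have one : \int[TM]_y fkernel n x y = vol R.
  have i1 : TM.-integrable setT (EFin \o (fun=> 1 : R)) by exact: integrable_bmf.
  have := fmean_conv n x i1; under eq_Rintegral do rewrite mul1r; move=> ->.
  rewrite /fmean /trigpoly big_box0; last first.
    move=> k k0; rewrite /wave Re_multiplier Im_multiplier.
    have kr : complex.Re (fourier (fun=> 1 : R) k) = 0.
      apply: (mulfI (lt0r_neq0 (vol_gt0 R))); rewrite -Re_fourier mulr0.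
      transitivity (\int[TM]_x0 cos (dotp k x0 + 0)); last by rewrite torus_int_cos (negbTE k0).
      by apply: eq_Rintegral => y _; rewrite mul1r addr0.
    have ki : complex.Im (fourier (fun=> 1 : R) k) = 0.
      apply: (mulfI (lt0r_neq0 (vol_gt0 R))); apply: oppr_inj; rewrite -Im_fourier mulr0 oppr0.
      transitivity (\int[TM]_x0 sin (dotp k x0 + 0)); last by rewrite torus_int_sin (negbTE k0).
      by apply: eq_Rintegral => y _; rewrite mul1r addr0.
    by rewrite kr ki !mulr0 !mul0r subr0.
  rewrite /wave Re_multiplier Im_multiplier fejer0 !mul1r.
  have d0 y : @dotp R 0 y = 0 by rewrite /dotp !mul0r !addr0.
  rewrite d0 cos0 sin0 mulr0 subr0 mulr1 -Re_fourier.
  rewrite (_ : \int[TM]_x0 _ = \int[TM]_(x0 in setT) (1 : R)); last first.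
    by apply: eq_Rintegral => y _; rewrite d0 cos0 mulr1.
  by rewrite Rintegral_cst// torus_setT mul1r.
have ia := integrable_bmfM (@bmf_cst _ _ _ (Phi a - dPhi a * a)) ik.
have ib := integrable_bmfM (@bmf_cst _ _ _ (dPhi a)) ik1.
have iab : TM.-integrable setT (EFin \o (fun y =>
   (Phi a - dPhi a * a) * fkernel n x y + dPhi a * (f y * fkernel n x y))).
  exact: (integrableD measurableT ia ib).
apply: (@le_trans _ _ (\int[TM]_y
   ((Phi a - dPhi a * a) * fkernel n x y + dPhi a * (f y * fkernel n x y)))).
  rewrite RintegralD// !RintegralZl// one fmean_conv// -/a.
  by apply: eq_le_real; ring.
apply: le_Rintegral => //.
  by under eq_fun do rewrite mulrC; exact: integrable_bmfM.
move=> y _; rewrite [X in _ + X](mulrA) -mulrDl ler_wpM2r ?fkernel_ge0//.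
by apply: le_trans (tangent a (f y)); rewrite mulrBr addrA addrAC.
Qed.

Lemma fmean_contract n f : TM.-integrable setT (EFin \o f) ->
  TM.-integrable setT (EFin \o (fun x => Phi (f x))) ->
  (forall x, 0 <= Phi x) ->
  (\int[TM]_x (Phi (fmean n (fourier f) x))%:E <= \int[TM]_x (Phi (f x))%:E)%E.
Proof.
move=> fi Pi P0; have tf := torus_fin R.
rewrite -(EFin_Rintegral Pi) -(fmean_int n Pi) (EFin_Rintegral (integrable_bmf tf (bmf_fmean n _))).
apply: ge0_le_integral => //.
- by move=> x _; rewrite lee_fin.
- apply/measurable_EFinP; apply: measurableT_comp => //.
  by case: (bmf_fmean n (fourier f)).
- by apply/measurable_EFinP; case: (bmf_fmean n (fourier (fun x => Phi (f x)))).
- by move=> x _; rewrite lee_fin fmean_jensen.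
Qed.

End Jensen.

End Fejer.

(** * Convergence of Fejer means in L^1 *)

Section L1Density.
Variable R : realType.
Local Notation TM := (torus_measure R).
Implicit Types (f g : torus R -> R).

Let tf : (TM setT < +oo)%E := torus_fin R.

Definition tint f := TM.-integrable setT (EFin \o f).

Lemma bmf_tint f : bmf f -> tint f.
Proof. exact: integrable_bmf. Qed.

Lemma tint_lin (a b : R) f g : tint f -> tint g -> tint (fun x => a * f x + b * g x).
Proof.
move=> fi gi.
have ai : tint (fun x => a * f x) by exact: integrable_bmfM.
have bi : tint (fun x => b * g x) by exact: integrable_bmfM.
exact: (integrableD measurableT ai bi).
Qed.

Lemma tintB f g : tint f -> tint g -> tint (fun x => f x - g x).
Proof.
move=> fi gi; have := tint_lin 1 (-1) fi gi.
by rewrite (_ : (fun x => _) = (fun x => f x - g x))//; apply/funext => x; rewrite mul1r mulN1r.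
Qed.

Lemma tint_norm f : tint f -> tint (fun x => `|f x|).
Proof. by move=> fi; apply: integrable_norm. Qed.

Lemma Rintegral_lin (a b : R) f g : tint f -> tint g ->
  \int[TM]_x (a * f x + b * g x) = a * \int[TM]_x f x + b * \int[TM]_x g x.
Proof.
move=> fi gi; rewrite RintegralD//; try exact: integrable_bmfM.
by rewrite !RintegralZl.
Qed.

Lemma fmean_lin n (a b : R) f g x : tint f -> tint g ->
  fmean n (fourier (fun x => a * f x + b * g x)) x =
  a * fmean n (fourier f) x + b * fmean n (fourier g) x.
Proof.
move=> fi gi; apply: (mulfI (lt0r_neq0 (vol_gt0 R))).
have bk := bmf_kernelB n x.
have ki h : tint h -> tint (fun y => h y * fkernel n x y).
  by move=> hi; rewrite /tint; under eq_fun do rewrite mulrC; exact: integrable_bmfM.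
rewrite -fmean_conv; last exact: tint_lin.
rewrite (_ : \int[TM]_y _ = \int[TM]_y (a * (f y * fkernel n x y) + b * (g y * fkernel n x y))).
  by rewrite (Rintegral_lin a b (ki _ fi) (ki _ gi)) (fmean_conv _ _ fi) (fmean_conv _ _ gi); ring.
by apply: eq_Rintegral => y _; ring.
Qed.

Definition fdist m f : R := \int[TM]_x `|f x - fmean ((m, m), m) (fourier f) x|.

Definition fejer_cvg1 f := tint f /\ fdist m f @[m --> \oo] --> (0 : R).

Lemma tint_fdist m f : tint f -> tint (fun x => `|f x - fmean ((m, m), m) (fourier f) x|).
Proof. by move=> fi; apply: tint_norm; apply: tintB => //; exact/bmf_tint/bmf_fmean. Qed.

Lemma fdist_ge0 m f : 0 <= fdist m f.
Proof. by apply: Rintegral_ge0. Qed.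

Lemma fmean_contract1 n f : tint f ->
  \int[TM]_x `|fmean n (fourier f) x| <= \int[TM]_x `|f x|.
Proof.
move=> fi; have ni := tint_norm fi.
have := @fmean_contract R (fun x => `|x|) (fun x => Num.sg x) _ _ n f fi ni (fun x => normr_ge0 x).
rewrite -(EFin_Rintegral ni) -EFin_Rintegral ?lee_fin; last first.
  by apply/tint_norm/bmf_tint/bmf_fmean.
apply=> // x y; rewrite mulrBr -normrEsg addrC subrK.
apply: le_trans (ler_norm _) _; rewrite normrM normr_sg.
by rewrite ler_piMl// lern1 leq_b1.
Qed.

Lemma fejer_cvg1_lin (a b : R) f g : fejer_cvg1 f -> fejer_cvg1 g ->
  fejer_cvg1 (fun x => a * f x + b * g x).
Proof.
move=> [fi fc] [gi gc]; split; first exact: tint_lin.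
apply: (@squeeze_cvgr _ _ _ _ (fun=> 0) (fun m => `|a| * fdist m f + `|b| * fdist m g)).
- apply: nearW => m; rewrite fdist_ge0/= /fdist -Rintegral_lin; [|exact: tint_fdist|exact: tint_fdist].
  apply: le_Rintegral => //.
  + by apply: tint_fdist; exact: tint_lin.
  + by apply: tint_lin; exact: tint_fdist.
  move=> x _; rewrite fmean_lin// -!normrM.
  by rewrite (_ : _ - _ = a * (f x - fmean (m, m, m) (fourier f) x) +
     b * (g x - fmean (m, m, m) (fourier g) x)) ?ler_normD//; ring.
- exact: cvg_cst.
- rewrite (_ : 0 = `|a| * 0 + `|b| * 0); last by rewrite !mulr0 addr0.
  exact: (cvgD (cvgM (cvg_cst _) fc) (cvgM (cvg_cst _) gc)).
Qed.

Lemma cvg0_approx (a : nat -> R) : (forall m, 0 <= a m) ->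
  (forall e : R, 0 < e -> exists b : nat -> R,
     b m @[m --> \oo] --> (0 : R) /\ forall m, a m <= b m + e) ->
  a m @[m --> \oo] --> (0 : R).
Proof.
move=> a0 H; apply/cvgr0Pnorm_le => e e0.
have e2 : 0 < e / 2 by rewrite divr_gt0.
have [b [bc ab]] := H _ e2.
move/cvgr0Pnorm_le : bc => /(_ _ e2); apply: filterS => m bm.
rewrite ger0_norm//; apply: le_trans (ab m) _.
have := le_trans (ler_norm _) bm; lra.
Qed.

(** Fejer means contract L^1, so the class is closed in L^1. *)
Lemma fejer_cvg1_close f : tint f ->
  (forall e : R, 0 < e -> exists g, fejer_cvg1 g /\ \int[TM]_x `|f x - g x| <= e) ->
  fejer_cvg1 f.
Proof.
move=> fi H; split => //; apply: cvg0_approx => [m|e e0]; first exact: fdist_ge0.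
have e2 : 0 < e / 2 by rewrite divr_gt0.
have [g [[gi gc] fg]] := H _ e2.
exists (fun m => fdist m g); split => // m.
have i1 : tint (fun x => `|f x - g x|) by apply/tint_norm/tintB.
have bm h : tint (fmean (m, m, m) (fourier h)) by apply/bmf_tint/bmf_fmean.
have i2 : tint (fun x => `|fmean (m, m, m) (fourier (fun x => g x - f x)) x|).
  exact/tint_norm.
apply: (@le_trans _ _ (\int[TM]_x (1 * (1 * `|f x - g x| +
   1 * `|g x - fmean (m, m, m) (fourier g) x|) +
   1 * `|fmean (m, m, m) (fourier (fun x => g x - f x)) x|))).
  apply: le_Rintegral => //; first exact: tint_fdist.
    by apply: tint_lin => //; apply: tint_lin => //; exact: tint_fdist.
  move=> x _; rewrite !mul1r.
  have -> : fmean (m, m, m) (fourier (fun x => g x - f x)) x =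
     fmean (m, m, m) (fourier g) x - fmean (m, m, m) (fourier f) x.
    have := @fmean_lin (m, m, m) 1 (-1) g f x gi fi.
    rewrite (_ : (fun x => _) = (fun x => g x - f x)) ?mul1r ?mulN1r//.
    by apply/funext => y; rewrite mul1r mulN1r.
  apply: le_trans (lerD (ler_normD _ _) (lexx _)); apply: le_trans (ler_normD _ _).
  by apply: eq_le_real; congr `|_|; ring.
rewrite !Rintegral_lin//; [|exact: tint_fdist|by apply: tint_lin => //; exact: tint_fdist].
have := fmean_contract1 (m, m, m) (tintB gi fi).
rewrite (_ : \int[TM]_x `|g x - f x| = \int[TM]_x `|f x - g x|); last first.
  by apply: eq_Rintegral => x _; rewrite distrC.
by move=> C; rewrite -/(fdist m g) !mul1r; move: (fdist m g) => d; lra.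
Qed.

Lemma big_box_pick n (j : Z3) (F : Z3 -> R) :
  \sum_(l <- box n) fejer R n l * (if l == j then F l else 0) = fejer R n j * F j.
Proof.
have [jb|jb] := boolP (j \in box n).
  rewrite (bigD1_seq j) ?uniq_box//= eqxx big1 ?addr0//.
  by move=> l /negbTE ->; rewrite mulr0.
rewrite fejer_out// mul0r big_seq big1// => l lb.
case: eqP => [lj|_]; last by rewrite mulr0.
by rewrite -lj lb in jb.
Qed.

Lemma fmean_cos n k (a : R) x :
  fmean n (fourier (fun y => cos (dotp k y + a))) x = fejer R n k * cos (dotp k x + a).
Proof.
apply: (mulfI (lt0r_neq0 (vol_gt0 R))); rewrite -fmean_conv; last exact/bmf_tint/bmf_cosdot.
transitivity (\sum_(l <- box n) \int[TM]_y (fejer R n l / 2 *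
  (cos (dotp (k + l) y + (a - dotp l x)) + cos (dotp (k - l) y + (a + dotp l x))))).
  have b1 l : bmf (fun y => fejer R n l / 2 *
  (cos (dotp (k + l) y + (a - dotp l x)) + cos (dotp (k - l) y + (a + dotp l x)))).
    by apply: bmfZ; apply: bmfD; exact: bmf_cosdot.
  rewrite -(@Rintegral_sum _ _ _ TM); last by move=> l; exact: bmf_tint.
  apply: eq_Rintegral => y _; rewrite /fkernel mulr_sumr; apply: eq_bigr => l _.
  rewrite dotpD dotpB.
  rewrite (_ : dotp k y + dotp l y + (a - dotp l x) = (dotp k y + a) - (dotp l x - dotp l y)); last by ring.
  rewrite (_ : dotp k y - dotp l y + (a + dotp l x) = (dotp k y + a) + (dotp l x - dotp l y)); last by ring.
  move: (dotp k y + a) (dotp l x - dotp l y) => A B.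
  by rewrite cosB cosD; field.
transitivity (vol R / 2 * (\sum_(l <- box n) fejer R n l * (if l == - k then cos (a - dotp l x) else 0)
  + \sum_(l <- box n) fejer R n l * (if l == k then cos (a + dotp l x) else 0))).
  rewrite -big_split mulr_sumr; apply: eq_bigr => l _ /=.
  have bc m (b : R) : bmf (fun y => cos (dotp m y + b)) by exact: bmf_cosdot.
  rewrite (RintegralZb tf); last exact: bmfD.
  rewrite (RintegralDb tf)// !torus_int_cos.
  have -> : (k + l == 0) = (l == - k) by rewrite addrC addr_eq0.
  have -> : (k - l == 0) = (l == k) by rewrite subr_eq0 eq_sym.
  by case: (l == - k); case: (l == k); rewrite ?mulr0 ?addr0 ?add0r; field.
by rewrite !big_box_pick fejerN dotpN opprK [a + _]addrC; field.
Qed.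

Lemma fejer_cvg1_cos k (a : R) : fejer_cvg1 (fun y => cos (dotp k y + a)).
Proof.
have bc := bmf_cosdot k a.
split; first exact: bmf_tint.
rewrite (_ : (fun m => _) = (fun m => (1 - fejer R ((m, m), m) k) *
   \int[TM]_x `|cos (dotp k x + a)|)); last first.
  apply/funext => m; rewrite -(RintegralZb tf); last exact: bmf_norm.
  apply: eq_Rintegral => x _; rewrite fmean_cos -{1}[cos _]mul1r -mulrBl normrM ger0_norm//.
  by rewrite subr_ge0 fejer_le1.
rewrite -(mul0r (\int[TM]_x `|cos (dotp k x + a)|)).
apply: cvgM; last exact: cvg_cst.
rewrite -(subrr 1); apply: cvgB; first exact: cvg_cst.
exact: fejer_cvg.
Qed.

(** The shifts make this class closed under products. *)
Definition trigsum f := exists L : seq (R * Z3 * R),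
  f = fun x => \sum_(t <- L) t.1.1 * cos (dotp t.1.2 x + t.2).

Lemma fejer_cvg1_trigsum f : trigsum f -> fejer_cvg1 f.
Proof.
move=> [L ->]; elim: L => [|t L ih].
  have := fejer_cvg1_lin 0 0 (fejer_cvg1_cos 0 0) (fejer_cvg1_cos 0 0).
  by under eq_fun do rewrite !mul0r addr0; under [in X in _ -> X]eq_fun do rewrite big_nil.
have := fejer_cvg1_lin t.1.1 1 (fejer_cvg1_cos t.1.2 t.2) ih.
by under eq_fun do rewrite mul1r; under [in X in _ -> X]eq_fun do rewrite big_cons.
Qed.

Lemma trigsum_cos (b : R) k (a : R) : trigsum (fun x => b * cos (dotp k x + a)).
Proof. by exists [:: (b, k, a)]; apply/funext => x; rewrite big_seq1. Qed.

Lemma trigsum_cst (b : R) : trigsum (fun=> b).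
Proof.
exists [:: (b, 0, 0)]; apply/funext => x; rewrite big_seq1 /= addr0.
by rewrite /dotp !mul0r !addr0 cos0 mulr1.
Qed.

Lemma trigsumD f g : trigsum f -> trigsum g -> trigsum (fun x => f x + g x).
Proof. by move=> [L ->] [M ->]; exists (L ++ M); apply/funext => x; rewrite big_cat. Qed.

Lemma trigsum_sum I (L : seq I) (F : I -> torus R -> R) :
  (forall i, trigsum (F i)) -> trigsum (fun x => \sum_(i <- L) F i x).
Proof.
move=> tF; elim: L => [|i L ih].
  by under eq_fun do rewrite big_nil; exact: trigsum_cst.
by under eq_fun do rewrite big_cons; exact: trigsumD.
Qed.

Lemma trigsumM f g : trigsum f -> trigsum g -> trigsum (fun x => f x * g x).
Proof.
move=> [L ->] [M ->].
under eq_fun do rewrite mulr_suml; apply: trigsum_sum => t.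
under eq_fun do rewrite mulr_sumr; apply: trigsum_sum => r.
rewrite (_ : (fun x => _) = (fun x => t.1.1 * r.1.1 / 2 * cos (dotp (t.1.2 + r.1.2) x + (t.2 + r.2)) +
  t.1.1 * r.1.1 / 2 * cos (dotp (t.1.2 - r.1.2) x + (t.2 - r.2)))).
  by apply: trigsumD; exact: trigsum_cos.
apply/funext => x; rewrite dotpB dotpD.
rewrite (_ : dotp t.1.2 x + dotp r.1.2 x + (t.2 + r.2) = (dotp t.1.2 x + t.2) + (dotp r.1.2 x + r.2)); last by ring.
rewrite (_ : dotp t.1.2 x - dotp r.1.2 x + (t.2 - r.2) = (dotp t.1.2 x + t.2) - (dotp r.1.2 x + r.2)); last by ring.
by move: (dotp t.1.2 x + t.2) (dotp r.1.2 x + r.2) => A B; rewrite cosB cosD; field.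
Qed.

Lemma trigsumX f n : trigsum f -> trigsum (fun x => f x ^+ n).
Proof.
move=> tf'; elim: n => [|n ih]; first by under eq_fun do rewrite expr0; exact: trigsum_cst.
by under eq_fun do rewrite exprS; exact: trigsumM.
Qed.

Lemma trigsum_bmf f : trigsum f -> bmf f.
Proof. by move=> [L ->]; apply: bmf_sum => t; apply: bmfZ; exact: bmf_cosdot. Qed.

End L1Density.

(** * Indicators as limits of trigonometric sums *)

Section L1Density2.
Variable R : realType.
Local Notation c := (circle_measure R).
Local Notation TM := (torus_measure R).
Implicit Types (f g : torus R -> R).

Lemma bernoulli_ge (x : R) n : -1 <= x -> 1 + n%:R * x <= (1 + x) ^+ n.
Proof.
move=> x1; elim: n => [|n ih]; first by rewrite mul0r addr0 expr0.
have p : 0 <= 1 + x by lra.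
rewrite exprS; apply: le_trans (ler_wpM2l p ih).
rewrite -natr1 -subr_ge0 (_ : _ - _ = n%:R * x ^+ 2); last by ring.
by rewrite mulr_ge0// sqr_ge0.
Qed.

(** Bernoulli's inequality compares these polynomials with [1 - (2 p)^n] from
    below, and with [(2 p)^(-n)] from above. Their values stay between 0 and 1. *)
Lemma step_poly_cvg (p : R) : 0 <= p <= 1 -> p != 1 / 2 ->
  (1 - p ^+ n) ^+ (2 ^ n) @[n --> \oo] --> ((p < 1 / 2)%R%:R : R).
Proof.
move=> /andP[p0 p1] ph.
have pn0 n : 0 <= p ^+ n by exact: exprn_ge0.
have pn1 n : p ^+ n <= 1 by exact: exprn_ile1.
have [lt|gt] := ltP p (1 / 2).
  apply: (@squeeze_cvgr _ _ _ _ (fun n => 1 - (2 * p) ^+ n) (fun=> 1)).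
  - apply: nearW => n; apply/andP; split; last first.
      by rewrite exprn_ile1// ?subr_ge0// gerBl.
    have := @bernoulli_ge (- p ^+ n) (2 ^ n) _; rewrite lerN2 => /(_ (pn1 n)).
    by rewrite natrX mulrN -exprMn.
  - rewrite -[X in _ --> X]subr0; apply: cvgB; first exact: cvg_cst.
    by apply: cvg_expr; rewrite ger0_norm ?mulr_ge0//; lra.
  - exact: cvg_cst.
have {ph}gt : 1 / 2 < p by rewrite lt_neqAle eq_sym ph.
have q1 : 0 <= (2 * p)^-1 by rewrite invr_ge0 mulr_ge0.
apply: (@squeeze_cvgr _ _ _ _ (fun=> 0) (fun n => (2 * p)^-1 ^+ n)).
- apply: nearW => n; apply/andP; split; first by rewrite exprn_ge0// subr_ge0.
  have q0 : 0 < (2 * p) ^+ n by rewrite exprn_gt0//; lra.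
  rewrite exprVn -[X in _ <= X]mul1r ler_pdivlMr//.
  apply: (@le_trans _ _ ((1 - p ^+ n) ^+ (2 ^ n) * (1 + p ^+ n) ^+ (2 ^ n))).
    apply: ler_wpM2l; first by rewrite exprn_ge0// subr_ge0.
    have := @bernoulli_ge (p ^+ n) (2 ^ n) _; rewrite natrX -exprMn => H.
    apply: le_trans (H _); first by rewrite lerDr.
    by apply: le_trans (pn0 n); rewrite lerN10.
  rewrite -exprMn (_ : (1 - _) * _ = 1 - (p ^+ n) ^+ 2); last by ring.
  apply: exprn_ile1; first by rewrite subr_ge0 exprn_ile1.
  by rewrite gerBl sqr_ge0.
- exact: cvg_cst.
- by apply: cvg_expr; rewrite ger0_norm// invf_lt1; lra.
Qed.

Lemma circle_null (a : R) : c (~` `]0%R, (2 * pi)%R[ `|` [set a]) = 0%E.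
Proof.
rewrite /= /mfrestr /mrestr; apply: (@subset_measure0 _ _ _ (@lebesgue_measure R) _ ([set 0] `|` [set 2 * pi] `|` [set a])).
- apply: measurableI => //; apply: measurableU => //; exact: measurableC.
- by apply: measurableU => //; apply: measurableU.
- move=> x [[|->]]; last by right.
  rewrite /= !in_itv/= => /negP; rewrite negb_and -!leNgt => /orP[h1|h1] /andP[h2 h3].
    by left; left; apply/eqP; rewrite eq_le h1.
  by left; right; apply/eqP; rewrite eq_le h3.
- apply: countable_lebesgue_measure0; apply: finite_set_countable.
  by rewrite !finite_setU; do ?split; exact: finite_set1.
Qed.

Definition xcoord (j : nat) (x : torus R) : measurableTypeR R :=
  match j with 0 => x.1.1 | 1 => x.1.2 | _ => x.2 end.

Lemma measurable_xcoord j : measurable_fun setT (xcoord j).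
Proof.
case: j => [|[|j]].
- exact: (measurableT_comp measurable_fst measurable_fst).
- exact: (measurableT_comp measurable_snd measurable_fst).
- exact: measurable_snd.
Qed.

Lemma ae_xcoord j (A : set (measurableTypeR R)) : measurable A -> c A = 0%E ->
  {ae TM, forall x, ~ A (xcoord j x)}.
Proof.
move=> mA A0; exists (xcoord j @^-1` A); split.
- by rewrite -[X in measurable X]setTI; apply: measurable_xcoord.
- have B1 (B C : set (measurableTypeR R)) : measurable B -> measurable C ->
    (fprod_measure c c (B `*` C) = c B * c C)%E by move=> mB mC; exact: product_measure1E.
  have B2 (B : set (measurableTypeR R * measurableTypeR R)) (C : set (measurableTypeR R)) :
    measurable B -> measurable C ->
    (TM (B `*` C) = fprod_measure c c B * c C)%E.
    by move=> mB mC; exact: (product_measure1E (fprod_measure c c) c mB mC).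
  case: j => [|[|j]].
  + rewrite (_ : _ @^-1` _ = (A `*` setT) `*` setT); last first.
      by apply/seteqP; split => [[[? ?] ?]|[[? ?] ?]] //= [[]].
    rewrite B2//; last exact: measurableX.
    by rewrite B1// A0 !mul0e.
  + rewrite (_ : _ @^-1` _ = (setT `*` A) `*` setT); last first.
      by apply/seteqP; split => [[[? ?] ?]|[[? ?] ?]] //= [[]].
    rewrite B2//; last exact: measurableX.
    by rewrite B1// A0 mule0 mul0e.
  + rewrite (_ : _ @^-1` _ = setT `*` A); last first.
      by apply/seteqP; split => [[[? ?] ?]|[[? ?] ?]] //= [].
    by rewrite B2// A0 mule0.
- by move=> x /= /contrapT.
Qed.

(** The uniform bound is there for dominated convergence. *)
Definition trig_limit f := bmf f /\ exists q : nat -> torus R -> R,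
  [/\ forall n, trigsum (q n), forall n x, 0 <= q n x <= 1 &
      {ae TM, forall x, q n x @[n --> \oo] --> f x}].

Lemma trig_limit1 : trig_limit (fun=> 1).
Proof.
split => //; exists (fun _ _ => 1); split => [n|n x|].
- exact: trigsum_cst.
- by rewrite ler01 lexx.
- by apply/aeW => x; exact: cvg_cst.
Qed.

Definition zunit (j : nat) : Z3 :=
  match j with 0 => ((1, 0), 0) | 1 => ((0, 1), 0) | _ => ((0, 0), 1) end.

Lemma dotp_zunit j x : dotp (zunit j) x = xcoord j x.
Proof. by case: j => [|[|j]]; rewrite /dotp /= !mul0r mul1r ?addr0 ?add0r. Qed.

Lemma bmf_indic_xcoord j (A : set (measurableTypeR R)) : measurable A ->
  bmf (fun x => \1_A (xcoord j x) : R).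
Proof.
move=> mA; have [mi [M iM]] := bmf_indic R mA; split; last by exists M.
by apply: (measurableT_comp mi); exact: measurable_xcoord.
Qed.

(** On a period, the points to the left of [a] are those where
    [cos (t - a / 2)] exceeds [cos (a / 2)]; an affine function maps this
    threshold to [1 / 2]. The points 0, [2 pi] and [a] are discarded. *)
Lemma trig_limit_ray j (a : R) : trig_limit (fun x => \1_(`]a, +oo[%classic) (xcoord j x)).
Proof.
split; first exact: bmf_indic_xcoord.
have N0 := circle_null a.
have mN : measurable (~` `]0%R, (2 * pi)%R[ `|` [set a] : set (measurableTypeR R)).
  by apply: measurableU => //; exact: measurableC.
have := @ae_xcoord j _ mN N0.
have inN t : ~ (~` `]0%R, (2 * pi)%R[ `|` [set a]) t -> 0 < t < 2 * pi /\ t != a.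
  by move/not_orP => [/contrapT]; rewrite /= in_itv/= => h /eqP h2.
have [a0|a0] := leP a 0.
  move=> H; exists (fun _ _ => 1); split => [n|n x|]; first exact: trigsum_cst.
    by rewrite ler01 lexx.
  apply: filterS H => x /inN[/andP[t0 t2] _].
  rewrite indicE mem_set; first exact: cvg_cst.
  by rewrite /= in_itv/= andbT (le_lt_trans a0).
have [a2|a2] := leP (2 * pi) a.
  move=> H; exists (fun _ _ => 0); split => [n|n x|]; first exact: trigsum_cst.
    by rewrite ler01 lexx.
  apply: filterS H => x /inN[/andP[t0 t2] _].
  rewrite indicE memNset; first exact: cvg_cst.
  by rewrite /= in_itv/= andbT; apply/negP; rewrite -leNgt (le_trans (ltW t2)).
pose p (x : torus R) := 1 / 2 + (1 / 4 * cos (dotp (zunit j) x + - (a / 2)) + - (cos (a / 2) / 4)).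
have tp : trigsum p.
  apply: trigsumD; first exact: trigsum_cst.
  by apply: trigsumD; [exact: trigsum_cos | exact: trigsum_cst].
have p01 x : 0 <= p x <= 1.
  rewrite /p; move: (cos_le1 (dotp (zunit j) x + - (a / 2))) (cos_geN1 (dotp (zunit j) x + - (a / 2))).
  move: (cos_le1 (a / 2)) (cos_geN1 (a / 2)).
  by move: (cos (a / 2)) (cos _) => A B h1 h2 h3 h4; apply/andP; split; lra.
move=> H; exists (fun n x => (1 - p x ^+ n) ^+ (2 ^ n)); split => [n|n x|].
- apply: trigsumX; apply: trigsumD; first exact: trigsum_cst.
  have := trigsumM (trigsum_cst (-1)) (trigsumX n tp).
  by under eq_fun do rewrite mulN1r.
- have /andP[p0 p1] := p01 x; have pn1 := exprn_ile1 n p0 p1.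
  have pn0 := exprn_ge0 n p0.
  by rewrite exprn_ge0 ?subr_ge0//= exprn_ile1// ?subr_ge0// gerBl.
apply: filterS H => x /inN[]; set t := xcoord j x => /andP[t0 t2] ta.
have pE : p x = 1 / 2 + 1 / 2 * (sin (t / 2) * sin ((a - t) / 2)).
  rewrite /p dotp_zunit -/t.
  have -> : cos (t + - (a / 2)) = cos (t / 2 - (a - t) / 2) by congr cos; field.
  have -> : cos (a / 2) = cos (t / 2 + (a - t) / 2) by congr cos; field.
  by rewrite cosB cosD; field.
have s0 : 0 < sin (t / 2) by apply: sin_gt0_pi; lra.
have [lt|gt|e] := ltgtP t a; last by rewrite e eqxx in ta.
- have s1 : 0 < sin ((a - t) / 2) by apply: sin_gt0_pi; lra.
  have ph : 1 / 2 < p x by rewrite pE ltrDl !mulr_gt0.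
  rewrite indicE memNset; last by rewrite /= in_itv/= andbT; apply/negP; rewrite -leNgt ltW.
  have pne : p x != 1 / 2 by rewrite gt_eqF.
  by have := step_poly_cvg (p01 x) pne; rewrite ltNge (ltW ph).
- have s1 : 0 < sin ((t - a) / 2) by apply: sin_gt0_pi; lra.
  have ph : p x < 1 / 2.
    rewrite pE (_ : (a - t) / 2 = - ((t - a) / 2)); last by field.
    by rewrite sinN mulrN mulrN gtrDl oppr_lt0 !mulr_gt0.
  rewrite indicE mem_set; last by rewrite /= in_itv/= andbT.
  have pne : p x != 1 / 2 by rewrite lt_eqF.
  by have := step_poly_cvg (p01 x) pne; rewrite ph.
Qed.

Lemma fejer_cvg1_lim (h : nat -> torus R -> R) f (M : R) : bmf f ->
  (forall n, fejer_cvg1 (h n)) -> (forall n, bmf (h n)) ->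
  (forall n x, `|h n x| <= M) ->
  {ae TM, forall x, h n x @[n --> \oo] --> f x} -> fejer_cvg1 f.
Proof.
move=> bf Wh bh hM hf; apply: fejer_cvg1_close; first exact: bmf_tint.
move=> e e0.
have [] := @dominated_convergence _ _ R TM setT measurableT (fun n x => (h n x)%:E)
   (fun x => (f x)%:E) (cst M%:E) _ _ _ _ _.
- by move=> n; apply/measurable_EFinP; case: (bh n).
- by apply/measurable_EFinP; case: bf.
- apply: filterS hf => x H _; apply: cvg_EFin; last exact: H.
  exact: nearW.
- rewrite (_ : cst M%:E = EFin \o (fun=> M))//.
  by apply: integrable_bmf; [exact: torus_fin | exact: bmf_cst].
- by apply/aeW => x n _ /=; rewrite lee_fin.
move=> _ C _.
have /fine_cvgP[_ C'] := C.
move/cvgr0Pnorm_le : C' => /(_ _ e0) [n _ /(_ n (leqnn n)) /= nE].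
exists (h n); split => //; apply: le_trans (ler_norm _) _; apply: le_trans nE.
apply: eq_le_real; congr `|_|; congr fine.
by apply: eq_integral => x _; rewrite distrC.
Qed.

Lemma fejer_cvg1_prod f1 f2 f3 : trig_limit f1 -> trig_limit f2 -> trig_limit f3 ->
  fejer_cvg1 (fun x => f1 x * f2 x * f3 x).
Proof.
move=> [b1 [q1 [t1 u1 c1]]] [b2 [q2 [t2 u2 c2]]] [b3 [q3 [t3 u3 c3]]].
have tt n : trigsum (fun x => q1 n x * q2 n x * q3 n x) by do 2 apply: trigsumM => //.
apply: (@fejer_cvg1_lim (fun n x => q1 n x * q2 n x * q3 n x) _ 1).
- by do 2 apply: bmfM => //.
- by move=> n; exact: fejer_cvg1_trigsum.
- by move=> n; exact: trigsum_bmf.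
- move=> n x; have /andP[a0 a1] := u1 n x; have /andP[d0 d1] := u2 n x.
  have /andP[e0 e1] := u3 n x.
  rewrite ger0_norm ?mulr_ge0//; apply: mulr_ile1 => //; first exact: mulr_ge0.
  exact: mulr_ile1.
- by apply: filterS3 c1 c2 c3 => x C1 C2 C3; apply: cvgM => //; exact: cvgM.
Qed.

(** The sets with this property form a lambda-system, by linearity and dominated
    convergence. *)
Lemma fejer_cvg1_dynkin d (T' : measurableType d) (h : torus R -> T') (psi : torus R -> R)
    (G : set (set T')) :
  measurable_fun setT h -> bmf psi -> setI_closed G ->
  @measurable _ T' = <<s G >> -> fejer_cvg1 psi ->
  (forall A, G A -> fejer_cvg1 (fun x => \1_A (h x) * psi x)) ->
  forall A, measurable A -> fejer_cvg1 (fun x => \1_A (h x) * psi x).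
Proof.
move=> mh bpsi GI mG Wpsi WG.
have bi (A : set T') : measurable A -> bmf (fun x => \1_A (h x) * psi x).
  move=> mA; apply: bmfM => //; have [mi [M iM]] := bmf_indic R mA.
  by split; [exact: (measurableT_comp mi) | exists M].
pose H : set (set T') := [set A | measurable A /\ fejer_cvg1 (fun x => \1_A (h x) * psi x)].
suff sub : <<s G >> `<=` H by move=> A; rewrite mG => /sub[].
apply: lambda_system_subset; first exact: GI.
- split; first by [].
  + split; first exact: measurableT.
    rewrite (_ : (fun x => _) = psi); first exact: Wpsi.
    by apply/funext => x; rewrite indicT mul1r.
  + move=> A B BA [mA WA] [mB WB]; split; first exact: measurableD.
    have WL := fejer_cvg1_lin 1 (-1) WA WB.
    rewrite (_ : (fun x => _) = (fun x => 1 * (\1_A (h x) * psi x) + -1 * (\1_B (h x) * psi x))).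
      exact: WL.
    apply/funext => x; rewrite !indicE in_setD mul1r mulN1r -mulrBl; congr (_ * _).
    have [xB|xB] := boolP (h x \in B); last by rewrite subr0 andbT.
    by rewrite (mem_set (BA _ (set_mem xB))) subrr.
  + move=> F ndF HF; have mU : measurable (\bigcup_n F n).
      by apply: bigcup_measurable => n _; case: (HF n).
    split; first exact: mU.
    have [_ [M pM]] := bpsi.
    apply: (@fejer_cvg1_lim (fun n x => \1_(F n) (h x) * psi x) _ M).
    * exact: bi.
    * by move=> n; case: (HF n).
    * by move=> n; apply: bi; case: (HF n).
    * move=> n x; rewrite normrM indicE; case: (_ \in _); rewrite ?normr1 ?mul1r// normr0 mul0r.
      exact: le_trans (pM x).
    * apply/aeW => x; apply: cvgM; last exact: cvg_cst.
      have [[n _ Fn]|nF] := pselect ((\bigcup_n F n) (h x)).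
        apply: (@cvg_trans _ ((fun=> (1 : R)) @ \oo)); last first.
          by rewrite indicE mem_set; [exact: cvg_cst | exists n].
        apply: near_eq_cvg; exists n => // m /= nm.
        by rewrite indicE mem_set//; move: (ndF _ _ nm); rewrite subsetEset; apply.
      rewrite (_ : (fun n => _) = (fun=> 0)); first by rewrite indicE memNset//; exact: cvg_cst.
      by apply/funext => n; rewrite indicE memNset// => Fn; apply: nF; exists n.
- by move=> A GA; split; [rewrite mG; exact: sub_sigma_algebra | exact: WG].
- by [].
Qed.

End L1Density2.

(** * Fejer means of integrable functions *)

Section L1Density3.
Variable R : realType.
Local Notation TM := (torus_measure R).
Implicit Types (f g : torus R -> R).

Import HBSimple.

Lemma measurable_rays : @measurable _ (measurableTypeR R) = <<s @RGenOInfty.G R >>.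
Proof. exact: RGenOInfty.measurableE. Qed.

Lemma rays_setI_closed : setI_closed (@RGenOInfty.G R).
Proof.
move=> _ _ [a ->] [b ->]; exists (Num.max a b).
by apply/seteqP; split => x /=; rewrite !in_itv/= !andbT gt_max => /andP.
Qed.

(** The pi-lambda theorem is used in one coordinate at a time, from rays to Borel
    sets. *)
Lemma fejer_cvg1_box (A B C : set (measurableTypeR R)) :
  measurable A -> measurable B -> measurable C ->
  fejer_cvg1 (fun x => \1_A (xcoord 0 x) * (\1_B (xcoord 1 x) * \1_C (xcoord 2 x))).
Proof.
move=> mA mB mC; have tl1 := @trig_limit1 R.
have tr j G : @RGenOInfty.G R G -> trig_limit (fun x => \1_G (xcoord j x)).
  by move=> [a ->]; exact: trig_limit_ray.
have mr := measurable_rays.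
have eq_cvg1 (f g : torus R -> R) : (forall x, f x = g x) -> fejer_cvg1 f -> fejer_cvg1 g.
  by move=> /funext ->; exact: id.
have S1 f2 f3 : trig_limit f2 -> trig_limit f3 ->
    fejer_cvg1 (fun x => \1_A (xcoord 0 x) * (f2 x * f3 x)).
  move=> l2 l3.
  apply: (fejer_cvg1_dynkin (measurable_xcoord 0) _ rays_setI_closed mr) => //.
  - by apply: bmfM; [case: l2 | case: l3].
  - apply: eq_cvg1 (fejer_cvg1_prod l2 l3 tl1) => x; exact: mulr1.
  - move=> G GG; apply: eq_cvg1 (fejer_cvg1_prod (tr 0%N _ GG) l2 l3) => x.
    by rewrite mulrA.
have S2 f3 : trig_limit f3 ->
    fejer_cvg1 (fun x => \1_B (xcoord 1 x) * (\1_A (xcoord 0 x) * f3 x)).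
  move=> l3.
  apply: (fejer_cvg1_dynkin (measurable_xcoord 1) _ rays_setI_closed mr) => //.
  - by apply: bmfM; [exact: bmf_indic_xcoord | case: l3].
  - by apply: eq_cvg1 (S1 _ _ tl1 l3) => x; rewrite mul1r.
  - move=> G GG; apply: eq_cvg1 (S1 _ _ (tr 1%N _ GG) l3) => x.
    by rewrite mulrCA.
have S3 : fejer_cvg1 (fun x => \1_C (xcoord 2 x) * (\1_A (xcoord 0 x) * \1_B (xcoord 1 x))).
  apply: (fejer_cvg1_dynkin (measurable_xcoord 2) _ rays_setI_closed mr) => //.
  - by apply: bmfM; exact: bmf_indic_xcoord.
  - by apply: eq_cvg1 (S2 _ tl1) => x; rewrite mulr1 mulrC.
  - move=> G GG; apply: eq_cvg1 (S2 _ (tr 2%N _ GG)) => x.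
    by ring.
by apply: eq_cvg1 S3 => x; ring.
Qed.

Lemma fejer_cvg1_indic (M : set (torus R)) : measurable M -> fejer_cvg1 (\1_M).
Proof.
have eq_cvg1 (f g : torus R -> R) : (forall x, f x = g x) -> fejer_cvg1 f -> fejer_cvg1 g.
  by move=> /funext ->; exact: id.
have one : fejer_cvg1 (fun=> 1 : R).
  apply: eq_cvg1 (fejer_cvg1_prod (@trig_limit1 R) (@trig_limit1 R) (@trig_limit1 R)) => x.
  by rewrite !mulr1.
have rectI d1 d2 (T1 : measurableType d1) (T2 : measurableType d2) :
    setI_closed [set A `*` B | A in @measurable _ T1 & B in @measurable _ T2].
  move=> _ _ [A mA [B mB <-]] [A' mA' [B' mB' <-]].
  by exists (A `&` A'); [exact: measurableI | exists (B `&` B');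
    [exact: measurableI | rewrite setXI]].
have S4 (C : set (measurableTypeR R)) (N : set (measurableTypeR R * measurableTypeR R)) :
    measurable C -> measurable N ->
    fejer_cvg1 (fun x : torus R => \1_N x.1 * \1_C (xcoord 2 x)).
  move=> mC; apply: (fejer_cvg1_dynkin (h := fun x : torus R => x.1) _ _
    (@rectI _ _ (measurableTypeR R) (measurableTypeR R))).
  - exact: measurable_fst.
  - exact: bmf_indic_xcoord.
  - exact: measurable_prod_measurableType.
  - apply: eq_cvg1 (fejer_cvg1_box measurableT measurableT mC) => x.
    by rewrite !indicT !mul1r.
  - move=> _ [A mA [B mB <-]].
    apply: eq_cvg1 (fejer_cvg1_box mA mB mC) => x.
    by rewrite mulrA !indicE in_setX -mulnb natrM.
move=> mM; have eq2 := eq_cvg1; apply: eq2 (_ : fejer_cvg1 (fun x => \1_M x * 1)); first by move=> x; rewrite mulr1.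
apply: (fejer_cvg1_dynkin (h := fun x : torus R => x) _ _
    (@rectI _ _ (measurableTypeR R * measurableTypeR R)%type (measurableTypeR R))).
- exact: measurable_id.
- exact: bmf_cst.
- exact: measurable_prod_measurableType.
- exact: one.
- move=> _ [N mN [C mC <-]].
  apply: eq_cvg1 (S4 _ _ mC mN) => x.
  by rewrite mulr1 !indicE in_setX -mulnb natrM.
- exact: mM.
Qed.

(** Simple functions are dense in L^1, which reduces to indicators. *)
Theorem fejer_cvg1_integrable f : tint f -> fejer_cvg1 f.
Proof.
move=> fi; apply: fejer_cvg1_close => // e e0.
have [g [gi _ gc]] := approximation_sfun_integrable measurableT fi.
have /fine_cvgP[_ gc'] := gc.
move/cvgr0Pnorm_le : gc' => /(_ _ e0) [n _ /(_ n (leqnn n)) /= nE].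
exists (fun x => g n x); split; last exact: le_trans (ler_norm _) nE.
pose s := finmap.enum_fset (fset_set (range (g n))).
rewrite (_ : (fun x => _) = (fun x => \sum_(y <- s) (y * \1_(g n @^-1` [set y]) x))); last first.
  by apply/funext => x; rewrite fimfunE fsbig_finite.
elim: s => [|y s ih].
  have := fejer_cvg1_lin 0 0 (fejer_cvg1_indic measurableT) (fejer_cvg1_indic measurableT).
  by under eq_fun do rewrite !mul0r addr0; under [in X in _ -> X]eq_fun do rewrite big_nil.
have my : measurable (g n @^-1` [set y] : set (torus R)) by exact: measurable_funPTI.
have := fejer_cvg1_lin y 1 (fejer_cvg1_indic my) ih.
by under eq_fun do rewrite mul1r; under [in X in _ -> X]eq_fun do rewrite big_cons.
Qed.

(** * Integrals bounded through Fejer means *)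

Definition clamp (M x : R) : R := Num.min M (Num.max (- M) x).

Section LowerSemicontinuity.
Variables (Phi dPhi : R -> R).
Hypotheses (mPhi : measurable_fun setT Phi) (mdPhi : measurable_fun setT dPhi).
Hypothesis tangent : forall x y : R, Phi x + dPhi x * (y - x) <= Phi y.
Hypothesis Phi_ge0 : forall x, 0 <= Phi x.
Hypothesis dPhi_bnd : forall M : R, exists K : R, forall x : R, `|x| <= M -> `|dPhi x| <= K.
Hypothesis Phi_bnd : forall M : R, exists K : R, forall x : R, `|x| <= M -> `|Phi x| <= K.
Hypothesis dPhi_sg : forall x y : R, 0 <= x -> 0 <= y -> 0 <= dPhi x * y.
Hypothesis dPhi_sgN : forall x y : R, x <= 0 -> y <= 0 -> 0 <= dPhi x * y.

(** With [g] the truncation of [f] at level [M], convexity gives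
    [Phi g <= Phi s + Phi' (g) (f - s) - Phi' (g) (f - g)] for the Fejer mean [s],
    where the last term has a sign and [Phi' (g)] is bounded, so that the
    convergence of [s] to [f] in L^1 is enough. Then [M] tends to infinity. *)
Lemma fmean_lsc f (A : R) : tint f ->
  (forall m, \int[TM]_x Phi (fmean ((m, m), m) (fourier f) x) <= A) ->
  (\int[TM]_x (Phi (f x))%:E <= A%:E)%E.
Proof.
move=> fi HA; have [_ fc] := fejer_cvg1_integrable fi.
have mf : measurable_fun setT f by move: fi => /integrableP[/measurable_EFinP].
have clampE M x : 0 <= M -> `|clamp M x| <= M.
  move=> M0; rewrite ler_norml /clamp le_min ge_min lexx/= andbT le_max lexx/=.
  lra.
have mcl M : measurable_fun setT (fun x => clamp M (f x)).
  apply: measurable_minr; first exact: measurable_cst.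
  by apply: measurable_maxr; first exact: measurable_cst.
have bcl M : 0 <= M -> bmf (fun x => clamp M (f x)).
  by move=> M0; split => //; exists M => x; exact: clampE.
have bP M : 0 <= M -> bmf (fun x => Phi (clamp M (f x))).
  move=> M0; split; first exact: measurableT_comp.
  by have [K HK] := Phi_bnd M; exists K => x; apply: HK; exact: clampE.
have bd M : 0 <= M -> bmf (fun x => dPhi (clamp M (f x))).
  move=> M0; split; first exact: measurableT_comp.
  by have [K HK] := dPhi_bnd M; exists K => x; apply: HK; exact: clampE.
have IM M : 0 <= M -> \int[TM]_x Phi (clamp M (f x)) <= A.
  move=> M0; have [K HK] := dPhi_bnd M.
  have K0 : 0 <= K by apply: le_trans (HK 0 _) => //; rewrite normr0.
  have key m : \int[TM]_x Phi (clamp M (f x)) - K * fdist m f <= A.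
    apply: le_trans (HA m).
    have bm := bmf_fmean (m, m, m) (fourier f).
    have i1 : tint (fun x => Phi (clamp M (f x))) by apply: bmf_tint; exact: bP.
    have i2 := tint_fdist m fi.
    have bPm : bmf (fun x => Phi (fmean (m, m, m) (fourier f) x)).
      split; first by apply: measurableT_comp => //; case: bm.
      have [_ [L HL]] := bm; have [K' HK'] := Phi_bnd L.
      by exists K' => x; exact: HK'.
    have := Rintegral_lin 1 (- K) i1 i2; rewrite mul1r mulNr -/(fdist m f) => <-.
    apply: le_Rintegral => //; [exact: tint_lin | exact: bmf_tint |].
    move=> x _; rewrite mul1r.
    apply: le_trans (tangent (clamp M (f x)) _); rewrite lerD2l mulNr.
    set s := fmean _ _ x; set g := clamp M (f x).
    have -> : dPhi g * (s - g) = - (dPhi g * (f x - s)) + dPhi g * (f x - g) by ring.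
    have h1 : dPhi g * (f x - s) <= K * `|f x - s|.
      apply: le_trans (ler_norm _) _; rewrite normrM ler_wpM2r//.
      by apply: HK; exact: clampE.
    have h2 : 0 <= dPhi g * (f x - g).
      rewrite /g /clamp; have [f1|f1] := leP (- M) (f x); have [f2|f2] := leP M (f x).
      - by rewrite dPhi_sg// subr_ge0.
      - by rewrite subrr mulr0.
      - by have := le_trans f2 (ltW f1); move=> ?; apply: dPhi_sg; lra.
      - have [h|h] := leP M (- M); first by apply: dPhi_sgN; lra.
        by apply: dPhi_sgN; lra.
    lra.
  apply: (@cvg_le_cst R (fun m => \int[TM]_x Phi (clamp M (f x)) - K * fdist m f)) => //.
  rewrite -[X in _ --> X]subr0 -(mulr0 K).
  apply: cvgB; first exact: cvg_cst.
  exact: (cvgM (cvg_cst K) fc).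
have clampS x : exists N, forall n, (N <= n)%N -> clamp n%:R (f x) = f x.
  exists (Num.truncn `|f x|).+1 => n nN.
  have nf : `|f x| <= n%:R.
    by apply: le_trans (ltW (truncnS_gt _)) _; rewrite ler_nat.
  move: nf; rewrite ler_norml => /andP[f1 f2].
  by rewrite /clamp (max_idPr f1) (min_idPr f2).
have Ec x : (Phi (clamp n%:R (f x)))%:E @[n --> \oo] --> (Phi (f x))%:E.
  have [N HN] := clampS x.
  apply: (@cvg_trans _ ((fun=> (Phi (f x))%:E) @ \oo)); last exact: cvg_cst.
  by apply: near_eq_cvg; exists N => // n /= Nn; rewrite HN.
have mn n : measurable_fun setT (fun x => (Phi (clamp n%:R (f x)))%:E).
  by apply/measurable_EFinP; case: (bP n%:R (ler0n _ _)).
have n0 n x : setT x -> (0 <= (Phi (clamp n%:R (f x)))%:E)%E by move=> _; rewrite lee_fin.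
have H := @fatou _ _ _ TM setT measurableT (fun n x => (Phi (clamp n%:R (f x)))%:E) mn n0.
rewrite (_ : (\int[TM]_x (Phi (f x))%:E)%E =
    (\int[TM]_x limn_einf (fun n => (Phi (clamp n%:R (f x)))%:E))%E); last first.
  apply: eq_integral => x _; rewrite is_cvg_limn_einfE; last by apply/cvg_ex; eexists; exact: Ec.
  by apply/esym/cvg_lim => //; exact: Ec.
apply: le_trans H _; rewrite limn_einf_lim; apply: lime_le; first exact: is_cvg_einfs.
apply: nearW => n; apply: (@le_trans _ _ (\int[TM]_x (Phi (clamp n%:R (f x)))%:E)%E).
  by apply: ereal_inf_lbound; exists n => /=.
by rewrite -EFin_Rintegral ?lee_fin ?IM//; exact: bmf_tint (bP _ _).
Qed.

End LowerSemicontinuity.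

Lemma fmean_lsc6 f (A : R) : tint f ->
  (forall m, \int[TM]_x (fmean ((m, m), m) (fourier f) x) ^+ 6 <= A) ->
  (\int[TM]_x (f x ^+ 6)%:E <= A%:E)%E.
Proof.
apply: (fmean_lsc (Phi := fun x => x ^+ 6) (dPhi := fun x => 6 * x ^+ 5)).
- exact: exprn_measurable.
- by apply: measurable_funM => //; exact: exprn_measurable.
- by move=> x y; exact: tangent6.
- by move=> x; exact: exprn_even_ge0.
- move=> M; exists (6 * M ^+ 5) => x xM.
  by rewrite normrM normrX (ger0_norm (x := 6))// ler_wpM2l// lerXn2r// nnegrE// (le_trans _ xM).
- move=> M; exists (M ^+ 6) => x xM.
  by rewrite normrX lerXn2r// nnegrE// (le_trans _ xM).
- by move=> x y x0 y0; rewrite !mulr_ge0// exprn_ge0.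
- move=> x y x0 y0; rewrite (_ : _ * y = 6 * (x ^+ 4) * ((- x) * (- y))); last by ring.
  by apply: mulr_ge0; [apply: mulr_ge0 => //; exact: exprn_even_ge0 | apply: mulr_ge0; rewrite oppr_ge0].
Qed.

Lemma fmean_lsc2 f (A : R) : tint f ->
  (forall m, \int[TM]_x (fmean ((m, m), m) (fourier f) x) ^+ 2 <= A) ->
  (\int[TM]_x (f x ^+ 2)%:E <= A%:E)%E.
Proof.
apply: (fmean_lsc (Phi := fun x => x ^+ 2) (dPhi := fun x => 2 * x)).
- exact: exprn_measurable.
- by apply: measurable_funM.
- move=> x y; rewrite -subr_ge0 (_ : _ - _ = (y - x) ^+ 2); last by ring.
  exact: sqr_ge0.
- by move=> x; exact: sqr_ge0.
- move=> M; exists (2 * M) => x xM.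
  by rewrite normrM (ger0_norm (x := 2))// ler_wpM2l.
- move=> M; exists (M ^+ 2) => x xM.
  by rewrite normrX lerXn2r// nnegrE// (le_trans _ xM).
- by move=> x y x0 y0; apply: mulr_ge0 => //; apply: mulr_ge0.
- by move=> x y x0 y0; nra.
Qed.

Lemma fmean_contract6 n f : tint f ->
  ((\int[TM]_x (fmean n (fourier f) x) ^+ 6)%:E <= \int[TM]_x (f x ^+ 6)%:E)%E.
Proof.
move=> fi; have [inf|fin] := eqVneq (\int[TM]_x (f x ^+ 6)%:E)%E +oo%E.
  by rewrite inf leey.
have mf : measurable_fun setT f by move: fi => /integrableP[/measurable_EFinP].
have p6 x : 0 <= x ^+ 6 :> R by exact: exprn_even_ge0.
have fi6 : TM.-integrable setT (EFin \o (fun x => f x ^+ 6)).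
  apply/integrableP; split; first by apply/measurable_EFinP; exact: measurable_funX.
  under eq_integral do rewrite /= ger0_norm//.
  by rewrite ltey.
rewrite EFin_Rintegral; last by apply: bmf_tint; apply: bmfX; exact: bmf_fmean.
apply: (fmean_contract (Phi := fun x => x ^+ 6) (dPhi := fun x => 6 * x ^+ 5)) => //.
by move=> x y; exact: tangent6.
Qed.

End L1Density3.

(** * Combinations of Fejer multipliers on L^6 *)

Section FejerCombinations.
Variable R : realType.
Local Notation TM := (torus_measure R).
Implicit Types (s : seq Z3) (u v : distr R) (f g : torus R -> R).

Lemma fmean_trigpoly n s u x :
  fmean n (fourier (trigpoly s u)) x = trigpoly s (multiplier (fejer R n) u) x.
Proof.
have bt t : tint (trigpoly t u) by apply: bmf_tint; exact: bmf_trigpoly.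
elim: s => [|k s ih].
  have b0 : tint (fun _ : torus R => 0 : R) by apply: bmf_tint; exact: bmf_cst.
  have := fmean_lin n 0 0 x b0 b0; rewrite !mul0r addr0.
  rewrite (_ : (fun _ : torus R => 0 : R) = trigpoly [::] u).
    by rewrite /trigpoly big_nil.
  by apply/funext => y; rewrite /trigpoly big_nil.
have bc a : tint (fun y : torus R => cos (dotp k y + a)) by apply: bmf_tint; exact: bmf_cosdot.
have bw : tint (fun y => complex.Re (u k) * cos (dotp k y + 0) +
    complex.Im (u k) * cos (dotp k y + pi / 2)) by exact: tint_lin.
have E y : trigpoly (k :: s) u y = 1 * (complex.Re (u k) * cos (dotp k y + 0) +
    complex.Im (u k) * cos (dotp k y + pi / 2)) + 1 * trigpoly s u y.
  by rewrite /trigpoly big_cons /wave addr0 cosDpihalf; ring.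
rewrite (funext E) fmean_lin// fmean_lin// !fmean_cos ih !mul1r.
rewrite [RHS]/trigpoly big_cons /wave Re_multiplier Im_multiplier addr0 cosDpihalf.
by rewrite -/(trigpoly s _ x); congr (_ + _); ring.
Qed.

(** The multiplier is an average of translations. *)
Lemma contraction6_fejer n : contraction6 (fejer R n).
Proof.
move=> s u.
have b6 v : TM.-integrable setT (EFin \o (fun x => trigpoly s v x ^+ 6)).
  by apply: bmf_tint; apply: bmfX; exact: bmf_trigpoly.
rewrite -lee_fin (EFin_Rintegral (b6 _)) (EFin_Rintegral (b6 _)).
have ti : tint (trigpoly s u) by apply: bmf_tint; exact: bmf_trigpoly.
have := fmean_contract6 n ti.
rewrite EFin_Rintegral; last by apply: bmf_tint; apply: bmfX; exact: bmf_fmean.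
by under eq_integral do rewrite fmean_trigpoly.
Qed.

Definition bounded6 (A : R) (m : Z3 -> R) := forall s u,
  \int[TM]_x (trigpoly s (multiplier m u) x ^+ 6) <=
  A ^+ 6 * \int[TM]_x (trigpoly s u x ^+ 6).

(** The sixth power lies above its tangent line at the sum divided by [A]. *)
Lemma jensen6 (I : Type) (L : seq I) (a p : I -> R) (A : R) : 0 < A ->
  \sum_(i <- L) `|a i| <= A ->
  (\sum_(i <- L) a i * p i) ^+ 6 <= A ^+ 5 * \sum_(i <- L) `|a i| * p i ^+ 6.
Proof.
move=> A0 aA; set P := \sum_(i <- L) a i * p i; pose X := P / A.
have PX : P = A * X by rewrite /X mulrC divfK// gt_eqF.
have X6 : 0 <= X ^+ 6 by exact: exprn_even_ge0.
have h i : `|a i| * X ^+ 6 + 6 * X ^+ 5 * (a i * p i - `|a i| * X) <= `|a i| * p i ^+ 6.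
  have [a0|a0] := ger0P (a i).
    have := ler_wpM2l a0 (tangent6 X (p i)); apply: le_trans.
    by apply: eq_le_real; ring.
  have a1 : 0 <= - a i by rewrite oppr_ge0 ltW.
  have := ler_wpM2l a1 (tangent6 X (- p i)); rewrite -[X in _ <= _ * X]/((- p i) ^+ 6).
  rewrite (_ : (- p i) ^+ 6 = p i ^+ 6); last by ring.
  apply: le_trans.
  by apply: eq_le_real; ring.
have H : \sum_(i <- L) (`|a i| * X ^+ 6 + 6 * X ^+ 5 * (a i * p i - `|a i| * X)) <=
    \sum_(i <- L) `|a i| * p i ^+ 6 by apply: ler_sum => i _; exact: h.
rewrite big_split /= -mulr_suml -mulr_sumr sumrB -/P -mulr_suml PX in H.
set S := \sum_(i <- L) `|a i| in aA H.
have SA := ler_wpM2r X6 aA.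
have H2 : A * X ^+ 6 <= \sum_(i <- L) `|a i| * p i ^+ 6.
  apply: le_trans H.
  have -> : S * X ^+ 6 + 6 * X ^+ 5 * (A * X - S * X) = 6 * (A * X ^+ 6) - 5 * (S * X ^+ 6) by ring.
  lra.
rewrite PX (_ : (A * X) ^+ 6 = A ^+ 5 * (A * X ^+ 6)); last by ring.
by apply: ler_wpM2l => //; rewrite exprn_ge0// ltW.
Qed.

Lemma bounded6_comb (I : Type) (L : seq I) (a : I -> R) (M : I -> Z3 -> R) m (A : R) :
  0 < A -> \sum_(i <- L) `|a i| <= A -> (forall i, contraction6 (M i)) ->
  (forall k, m k = \sum_(i <- L) a i * M i k) -> bounded6 A m.
Proof.
move=> A0 aA cM mE s u; have tf := torus_fin R.
have b6 v : bmf (fun x => trigpoly s v x ^+ 6) by apply: bmfX; exact: bmf_trigpoly.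
have E x : trigpoly s (multiplier m u) x = \sum_(i <- L) a i * trigpoly s (multiplier (M i) u) x.
  rewrite /trigpoly; under [RHS]eq_bigr do rewrite mulr_sumr.
  rewrite exchange_big /=; apply: eq_bigr => k _.
  rewrite /wave Re_multiplier Im_multiplier mE !mulr_suml -sumrB; apply: eq_bigr => i _.
  by rewrite Re_multiplier Im_multiplier; ring.
apply: (@le_trans _ _ (\int[TM]_x (A ^+ 5 * \sum_(i <- L) `|a i| * trigpoly s (multiplier (M i) u) x ^+ 6))).
  apply: (bmf_Rintegral_le tf) => //.
    by apply: bmfZ; apply: bmf_sum => i; apply: bmfZ.
  by move=> x; rewrite E; exact: jensen6.
have A5 : 0 <= A ^+ 5 by rewrite exprn_ge0// ltW.
rewrite RintegralZb//; last by apply: bmf_sum => i; apply: bmfZ.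
rewrite Rintegral_sum; last by move=> i; apply: bmf_tint; apply: bmfZ.
rewrite [A ^+ 6]exprSr -[leRHS]mulrA; apply: ler_wpM2l => //.
set Q := \int[TM]_x trigpoly s u x ^+ 6.
have Q0 : 0 <= Q by apply: Rintegral_ge0 => // x _; exact: exprn_even_ge0.
apply: (@le_trans _ _ (\sum_(i <- L) `|a i| * Q)).
  by apply: ler_sum => i _; rewrite RintegralZb//; apply: ler_wpM2l => //; exact: cM.
by rewrite -mulr_suml; apply: ler_wpM2r.
Qed.

Definition ddiff (m : nat -> R) (n : nat) : R := m n - 2 * m n.+1 + m n.+2.

(** Two summations by parts. If [m] vanishes from [M] on, only [m k] remains. *)
Lemma abel_ddiff (m : nat -> R) (M k : nat) :
  \sum_(0 <= n < M) (n.+1 - k)%:R * ddiff m n =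
  if (k <= M)%N then m k - (M.+1 - k)%:R * m M + (M - k)%:R * m M.+1 else 0.
Proof.
elim: M => [|M ih].
  rewrite big_nil leqn0; case: eqP => [->|//].
  by rewrite subn0 subnn; ring.
rewrite big_nat_recr//= ih; have [kM|kM] := leqP k M.
  rewrite (leqW kM) (subSn (leqW kM)) (subSn kM) /ddiff.
  by rewrite -!natr1; ring.
have [->|kn] := eqVneq k M.+1; first by rewrite leqnn subnn subSnn; ring.
have -> : (k <= M.+1)%N = false by lia.
by rewrite (_ : (M.+1 - k)%N = 0%N); [ring | lia].
Qed.

Lemma fejer_expansion1 (m : nat -> R) (M : nat) (k : int) :
  (forall n, (M <= n)%N -> m n = 0) ->
  m `|k|%N = \sum_(0 <= n < M) n.+1%:R * ddiff m n * zfejer R n k.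
Proof.
move=> m0; rewrite [RHS](_ : _ = \sum_(0 <= n < M) (n.+1 - `|k|)%:R * ddiff m n); last first.
  apply: eq_bigr => n _; rewrite /zfejer.
  have n0 : n.+1%:R != 0 :> R by rewrite pnatr_eq0.
  by field.
rewrite abel_ddiff; case: leqP => kM; last by rewrite m0// ltnW.
by rewrite (m0 M)// (m0 M.+1)//; ring.
Qed.

Definition ddiff3 (m : nat -> nat -> nat -> R) (a b c : nat) : R :=
  ddiff (fun a' => ddiff (fun b' => ddiff (m a' b') c) b) a.

Lemma fejer_expansion (m : nat -> nat -> nat -> R) (M : nat) (k : Z3) :
  (forall a b c, (M <= a)%N || (M <= b)%N || (M <= c)%N -> m a b c = 0) ->
  m `|k.1.1|%N `|k.1.2|%N `|k.2|%N =
  \sum_(0 <= a < M) \sum_(0 <= b < M) \sum_(0 <= c < M)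
    (a.+1%:R * b.+1%:R * c.+1%:R * ddiff3 m a b c) * fejer R ((a, b), c) k.
Proof.
move=> m0.
have m1 a b c : (M <= a)%N -> m a b c = 0 by move=> h; apply: m0; rewrite h.
have m2 a b c : (M <= b)%N -> m a b c = 0 by move=> h; apply: m0; rewrite h orbT.
have m3 a b c : (M <= c)%N -> m a b c = 0 by move=> h; apply: m0; rewrite h orbT.
rewrite (@fejer_expansion1 (fun a => m a `|k.1.2|%N `|k.2|%N) M k.1.1); last by move=> n /m1 ->.
apply: eq_bigr => a _.
rewrite (@fejer_expansion1 (fun b => ddiff (fun a' => m a' b `|k.2|%N) a) M k.1.2); last first.
  by move=> n h; rewrite /ddiff !m2//; ring.
rewrite mulr_sumr mulr_suml; apply: eq_bigr => b _.
rewrite (@fejer_expansion1 (fun c => ddiff (fun b' => ddiff (fun a' => m a' b' c) a) b) M k.2); last first.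
  by move=> n h; rewrite /ddiff !m3//; ring.
rewrite mulr_sumr mulr_suml mulr_sumr mulr_suml; apply: eq_bigr => c _.
by rewrite /ddiff3 /ddiff /fejer; ring.
Qed.

End FejerCombinations.

(** * The truncations P_N on L^6 *)

Section CutoffMultiplier.
Variable R : realType.
Local Notation TM := (torus_measure R).

Lemma ler_pow n (x y : R) : 0 <= x -> x <= y -> x ^+ n <= y ^+ n.
Proof. by move=> x0 xy; apply: lerXn2r => //; rewrite nnegrE// (le_trans x0). Qed.

(** All derivatives are carried along so that [jet2] can be iterated. *)
Definition jet (D : nat -> R -> R) := forall j (x : R), is_derive x (1 : R) (D j) (D j.+1 x).

(** [2 D' + 4 xi^2 D''], with [a = xi^2]: the second derivative of
    [y |-> D (y^2 + c)] at [xi] is its value at [xi^2 + c]. *)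
Definition jet2 (a : R) (D : nat -> R -> R) (j : nat) (y : R) : R :=
  2 * D j.+1 y + 4 * a * D j.+2 y.

Lemma jet_jet2 a D : jet D -> jet (jet2 a D).
Proof.
move=> jD j x.
have d1 := @is_deriveZ _ _ _ _ 2 x 1 _ (jD j.+1 x).
have d2 := @is_deriveZ _ _ _ _ (4 * a) x 1 _ (jD j.+2 x).
exact: (is_derive_eq (is_deriveD d1 d2)).
Qed.

(** The pairs of a weight and of a number of steps in a second difference. *)
Definition stencil : seq (R * R) := [:: (1, 0); (-2, 1); (1, 2)].

Lemma stencil_sum (F : R * R -> R) :
  \sum_(p <- stencil) F p = F (1, 0) + F (-2, 1) + F (1, 2).
Proof. by rewrite !big_cons big_nil /=; ring. Qed.

Lemma mvt_second (f df ddf : R -> R) (x h : R) : 0 < h ->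
  (forall y : R, is_derive y (1 : R) f (df y)) ->
  (forall y : R, is_derive y (1 : R) df (ddf y)) ->
  exists2 xi : R, x <= xi <= x + 2 * h &
    \sum_(p <- stencil) p.1 * f (x + p.2 * h) = h ^+ 2 * ddf xi.
Proof.
move=> h0 fd dfd.
have contin (g dg : R -> R) (gd : forall y : R, is_derive y (1 : R) g (dg y)) a b :
    {within `[a, b], continuous g}.
  by apply: derivable_within_continuous => y _; case: (gd y).
pose g y := f (y + h) - f y.
have gd (y : R) : is_derive y (1 : R) g (df (y + h) - df y).
  have H := @is_derive1_comp _ f (fun z => z + h) y _ _ (fd (y + h))
    (is_deriveD (is_derive_id y (1 : R)) (is_derive_cst h y (1 : R))).
  have H' := is_deriveB H (fd y).
  by apply: (is_derive_eq H'); rewrite addr0 mulr1.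
have xh y : y <= y + h by rewrite lerDl ltW.
have [y1 + E1] := @MVT_segment R g _ x (x + h) (xh _) (fun y _ => gd y) (contin _ _ gd _ _).
have [y2 + E2] := @MVT_segment R df _ y1 (y1 + h) (xh _) (fun y _ => dfd y) (contin _ _ dfd _ _).
rewrite !in_itv /= => /andP[a1 a2] /andP[b1 b2]; exists y2.
  by apply/andP; split; lra.
move: E1; rewrite E2 /g !(addrC _ h) !addrK => E1.
rewrite stencil_sum /= !mul0r addr0 !mul1r.
have -> : h ^+ 2 * ddf y2 = ddf y2 * h * h by ring.
rewrite -E1; have -> : x + 2 * h = h + (h + x) by ring.
by rewrite (addrC x h); ring.
Qed.

Lemma stencil_jet (I : Type) (L : seq I) (a c : I -> R) D (x h : R) : jet D -> 0 < h ->
  exists2 xi : R, x <= xi <= x + 2 * h &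
    \sum_(p <- stencil) \sum_(i <- L) p.1 * a i * D 0%N ((x + p.2 * h) ^+ 2 + c i) =
    h ^+ 2 * \sum_(i <- L) a i * jet2 (xi ^+ 2) D 0 (xi ^+ 2 + c i).
Proof.
move=> jD h0.
have sd (cc y : R) : is_derive y (1 : R) (fun z : R => z ^+ 2 + cc) (2 * y).
  have H := is_deriveD (is_deriveX 2 (is_derive_id y (1 : R))) (is_derive_cst cc y (1 : R)).
  by apply: (is_derive_eq H); rewrite addr0 /= expr1 -[_ *: _]/(_ * _) mulr1; ring.
have d1 j (cc y : R) : is_derive y (1 : R) (fun z : R => D j (z ^+ 2 + cc)) (2 * y * D j.+1 (y ^+ 2 + cc)).
  have H := @is_derive1_comp _ (D j) (fun z => z ^+ 2 + cc) y _ _ (jD j _) (sd cc y).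
  by apply: (is_derive_eq H); rewrite mulrC.
pose f y := \sum_(i <- L) a i * D 0%N (y ^+ 2 + c i).
pose df y := \sum_(i <- L) a i * (2 * y * D 1%N (y ^+ 2 + c i)).
pose ddf y := \sum_(i <- L) a i * jet2 (y ^+ 2) D 0 (y ^+ 2 + c i).
have sumd (F dF : I -> R -> R) (y : R) : (forall i, is_derive y (1 : R) (F i) (dF i y)) ->
    is_derive y (1 : R) (fun z => \sum_(i <- L) a i * F i z) (\sum_(i <- L) a i * dF i y).
  move=> dFi; rewrite {f df ddf}; elim: L => [|i l ih].
    by under eq_fun do rewrite big_nil; rewrite big_nil; exact: is_derive_cst.
  under eq_fun do rewrite big_cons; rewrite big_cons.
  exact: (is_deriveD (is_deriveZ (a i) (dFi i)) ih).
have fd (y : R) : is_derive y (1 : R) f (df y).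
  by apply: (sumd (fun i z => D 0%N (z ^+ 2 + c i)) (fun i z => 2 * z * D 1%N (z ^+ 2 + c i))) => i.
have dfd (y : R) : is_derive y (1 : R) df (ddf y).
  apply: (sumd (fun i z => 2 * z * D 1%N (z ^+ 2 + c i)) (fun i z => jet2 (z ^+ 2) D 0 (z ^+ 2 + c i))) => i.
  have H := is_deriveM (is_deriveZ 2 (is_derive_id y (1 : R))) (d1 1%N (c i) y).
  apply: (is_derive_eq H); rewrite /jet2 -![_ *: _]/(_ * _) -?[(2 \*: id) y]/(2 * y).
  by ring.
have [xi xi1 xi2] := mvt_second x h0 fd dfd.
exists xi => //; rewrite -xi2; apply: eq_bigr => p _; rewrite /f mulr_sumr.
by apply: eq_bigr => i _; rewrite mulrA.
Qed.

(** The symbols are functions of the sum of the squares of the three coordinates,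
    and this form is kept when the second differences are replaced by second
    derivatives, by the mean value theorem, in one coordinate at a time. *)
Lemma stencil_jet3 D (x y z h : R) : jet D -> 0 < h -> exists xi eta zeta : R,
  [/\ x <= xi <= x + 2 * h, y <= eta <= y + 2 * h, z <= zeta <= z + 2 * h &
   \sum_(p <- stencil) \sum_(q <- stencil) \sum_(r <- stencil)
     p.1 * (q.1 * r.1) * D 0%N ((x + p.2 * h) ^+ 2 + ((y + q.2 * h) ^+ 2 + (z + r.2 * h) ^+ 2)) =
   h ^+ 6 * jet2 (zeta ^+ 2) (jet2 (eta ^+ 2) (jet2 (xi ^+ 2) D)) 0
     (xi ^+ 2 + eta ^+ 2 + zeta ^+ 2)].
Proof.
move=> jD h0.
pose L := [seq (q, r) | q <- stencil, r <- stencil].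
have [xi xiI E1] := @stencil_jet _ L (fun i => i.1.1 * i.2.1)
  (fun i => (y + i.1.2 * h) ^+ 2 + (z + i.2.2 * h) ^+ 2) D x h jD h0.
have jD1 := jet_jet2 (xi ^+ 2) jD.
have [eta etaI E2] := @stencil_jet _ stencil (fun r => r.1)
  (fun r => xi ^+ 2 + (z + r.2 * h) ^+ 2) _ y h jD1 h0.
have jD2 := jet_jet2 (eta ^+ 2) jD1.
have [zeta zetaI E3] := @stencil_jet _ [:: tt] (fun=> 1)
  (fun=> xi ^+ 2 + eta ^+ 2) _ z h jD2 h0.
exists xi, eta, zeta; split => //.
transitivity (\sum_(p <- stencil) \sum_(i <- L) p.1 * (i.1.1 * i.2.1) *
    D 0%N ((x + p.2 * h) ^+ 2 + ((y + i.1.2 * h) ^+ 2 + (z + i.2.2 * h) ^+ 2))).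
  by apply: eq_bigr => p _; rewrite /L big_allpairs.
rewrite E1 /L big_allpairs.
transitivity (h ^+ 2 * \sum_(p <- stencil) \sum_(r <- stencil) p.1 * r.1 *
   jet2 (xi ^+ 2) D 0 ((y + p.2 * h) ^+ 2 + (xi ^+ 2 + (z + r.2 * h) ^+ 2))).
  congr (_ * _); apply: eq_bigr => q _; apply: eq_bigr => r _.
  by congr (_ * jet2 _ _ _ _); ring.
rewrite E2 mulrA.
transitivity (h ^+ 2 * h ^+ 2 * \sum_(p <- stencil) \sum_(i <- [:: tt]) p.1 * 1 *
   jet2 (eta ^+ 2) (jet2 (xi ^+ 2) D) 0 ((z + p.2 * h) ^+ 2 + (xi ^+ 2 + eta ^+ 2))).
  congr (_ * _); apply: eq_bigr => q _; rewrite big_seq1 mulr1.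
  by congr (_ * jet2 _ _ _ _); ring.
rewrite E3 big_seq1 mul1r (addrC (zeta ^+ 2)); ring.
Qed.

Lemma jet2_bound a b D (Y K : R) n : 0 <= a <= b ->
  (forall j y, (j <= n.+2)%N -> 0 <= y <= Y -> `|D j y| <= K) ->
  forall j y, (j <= n)%N -> 0 <= y <= Y -> `|jet2 a D j y| <= (2 + 4 * b) * K.
Proof.
move=> /andP[a0 ab] DK j y jn y0; rewrite /jet2 [leRHS]mulrDl.
have h1 : `|D j.+1 y| <= K by apply: DK => //; lia.
have h2 : `|D j.+2 y| <= K by apply: DK => //; lia.
apply: le_trans (ler_normD _ _) _; rewrite !normrM (ger0_norm (x := 2))// (ger0_norm (x := 4))// (ger0_norm a0).
apply: lerD; first by apply: ler_wpM2l.
apply: ler_pM => //; first by apply: mulr_ge0.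
by apply: ler_wpM2l.
Qed.

(** The symbol of [P_N]. *)
Definition tsym (psi : R -> R) (N : nat) (k : Z3) : R :=
  if k == 0 then 1 else psi (normsq R k / N%:R ^+ 2).

Section Cutoff.
Variable psi : R -> R.
Hypothesis hpsi : is_cutoff psi.

Let D j := derive1n j psi.

Lemma jet_cutoff : jet D.
Proof.
case: hpsi => dpsi _ _ j x; rewrite /D derive1nS derive1E.
exact/derivableP/dpsi.
Qed.

Lemma cutoff0 : psi 0 = 1.
Proof. by case: hpsi => _ _; exact: nbhs_singleton. Qed.

Lemma tsymE N k : tsym psi N k = psi (normsq R k / N%:R ^+ 2).
Proof.
rewrite /tsym; case: eqP => // ->; rewrite /normsq /= expr0n /= !addr0 mul0r.
by rewrite cutoff0.
Qed.

Lemma cutoff_vanish : exists2 r0 : nat, (0 < r0)%N & forall x : R, r0%:R ^+ 2 <= x -> psi x = 0.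
Proof.
case: hpsi => _ [r Hr] _; exists (Num.truncn `|r|).+1 => // x xr.
have r1 : r < (Num.truncn `|r|).+1%:R by apply: le_lt_trans (ler_norm _) (truncnS_gt _).
have r2 : 1 <= (Num.truncn `|r|).+1%:R :> R by rewrite ler1n.
apply: Hr; apply: lt_le_trans r1 _; apply: le_trans (ler_norm _).
by apply: le_trans xr; rewrite expr2 ler_peMl// (le_trans _ r2).
Qed.

Lemma jet_bounded (Y : R) n : exists2 K : R, 0 <= K &
  forall j y, (j <= n)%N -> 0 <= y <= Y -> `|D j y| <= K.
Proof.
have [Y0|Y0] := leP 0 Y; last first.
  by exists 0 => // j y _ /andP[y0 /(le_trans y0)]; rewrite leNgt Y0.
have one j : exists2 K : R, 0 <= K & forall y, 0 <= y <= Y -> `|D j y| <= K.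
  have cD : {within `[0, Y], continuous (fun y => `|D j y|)}.
    apply: continuous_subspaceT => y; apply: continuous_comp; last exact: norm_continuous.
    by apply/differentiable_continuous/derivable1_diffP; case: (jet_cutoff j y).
  by have [y0 _ Hy] := EVT_max Y0 cD; exists `|D j y0|.
elim: n => [|n [K K0 HK]].
  by have [K K0 HK] := one 0%N; exists K => // j y; rewrite leqn0 => /eqP ->; exact: HK.
have [K' K'0 HK'] := one n.+1; exists (K + K') => [|j y]; first exact: addr_ge0.
rewrite leq_eqVlt => /orP[/eqP ->|jn] yY.
  by apply: le_trans (HK' _ yY) _; rewrite lerDr.
by apply: le_trans (HK _ _ _ yY) _; rewrite ?lerDl.
Qed.

Lemma tsym_bounded : exists2 K : R, 0 <= K & forall N k, `|tsym psi N k| <= K.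
Proof.
have [r0 r00 Hr] := cutoff_vanish.
have [K K0 HK] := jet_bounded (r0%:R ^+ 2) 0.
exists K => // N k; rewrite tsymE.
have x0 : 0 <= normsq R k / N%:R ^+ 2 by apply: mulr_ge0; [exact: normsq_ge0 | rewrite invr_ge0 exprn_ge0].
have [h|h] := leP (r0%:R ^+ 2) (normsq R k / N%:R ^+ 2); first by rewrite Hr// normr0.
by apply: (HK 0%N) => //; rewrite x0 ltW.
Qed.

Lemma normsq_abs (k : Z3) :
  normsq R k = `|k.1.1|%:R ^+ 2 + (`|k.1.2|%:R ^+ 2 + `|k.2|%:R ^+ 2).
Proof.
have E (j : int) : (j%:~R : R) ^+ 2 = `|j|%:R ^+ 2.
  by rewrite natr_absz intr_norm real_normK// num_real.
by rewrite /normsq !E addrA.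
Qed.

(** The sixth mixed difference of the symbol is of order [N^-6], and it is summed
    against weights of order [N^3] over about [N^3] indices. *)
Theorem bounded6_tsym : exists2 A : R, 0 < A & forall N, (0 < N)%N -> bounded6 A (tsym psi N).
Proof.
have [r0 r00 Hr] := cutoff_vanish.
(* The intermediate points lie within two steps of the nodes below [r0]. *)
pose B : R := (r0 + 2)%:R.
have [K K0 HK] := jet_bounded (3 * B ^+ 2) 6.
pose K3 := (2 + 4 * B ^+ 2) * ((2 + 4 * B ^+ 2) * ((2 + 4 * B ^+ 2) * K)).
have K30 : 0 <= K3.
  by rewrite /K3; do 3![apply: mulr_ge0; first by apply: addr_ge0 => //; apply: mulr_ge0 => //; exact: sqr_ge0].
exists (1 + r0%:R ^+ 6 * K3) => [|N N0].
  by rewrite ltr_wpDr// mulr_ge0// exprn_ge0.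
pose h : R := N%:R^-1; have N0' : 0 < N%:R :> R by rewrite ltr0n.
have h0 : 0 < h by rewrite invr_gt0.
pose m (a b c : nat) : R := D 0 ((a%:R * h) ^+ 2 + ((b%:R * h) ^+ 2 + (c%:R * h) ^+ 2)).
pose M := (r0 * N)%N.
have hM : M%:R * h = r0%:R by rewrite /M /h natrM mulfK// gt_eqF.
have mM a b c : (M <= a)%N || (M <= b)%N || (M <= c)%N -> m a b c = 0.
  have sq j : (M <= j)%N -> r0%:R ^+ 2 <= (j%:R * h) ^+ 2.
    move=> Mj; rewrite -hM; apply: ler_pow; first by apply: mulr_ge0 => //; exact: ltW.
    by apply: ler_wpM2r; [exact: ltW | rewrite ler_nat].
  have := sqr_ge0 (a%:R * h); have := sqr_ge0 (b%:R * h); have := sqr_ge0 (c%:R * h).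
  move=> c0 b0 a0 /orP[/orP[]|] /sq ?; apply: Hr; lra.
have mE k : tsym psi N k = m `|k.1.1|%N `|k.1.2|%N `|k.2|%N.
  by rewrite tsymE normsq_abs /m /D derive1n0 /h; congr psi; rewrite !exprMn exprVn; ring.
have mD a b c : (a < M)%N -> (b < M)%N -> (c < M)%N -> `|ddiff3 m a b c| <= h ^+ 6 * K3.
  move=> aM bM cM.
  have [xi [eta [zeta [xiI etaI zetaI E]]]] :=
    stencil_jet3 (a%:R * h) (b%:R * h) (c%:R * h) jet_cutoff h0.
  have -> : ddiff3 m a b c = h ^+ 6 * jet2 (zeta ^+ 2) (jet2 (eta ^+ 2) (jet2 (xi ^+ 2) D)) 0
     (xi ^+ 2 + eta ^+ 2 + zeta ^+ 2).
    rewrite -E !stencil_sum /= /ddiff3 /ddiff /m.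
    have nS j : j.+1%:R * h = j%:R * h + h by rewrite -natr1 mulrDl mul1r.
    rewrite (nS a.+1) (nS a) (nS b.+1) (nS b) (nS c.+1) (nS c) !mul0r !addr0 !mul1r.
    have hh j : j%:R * h + h + h = j%:R * h + 2 * h by ring.
    by rewrite !hh /D /=; ring.
  rewrite normrM (ger0_norm (exprn_ge0 6 (ltW h0))); apply: ler_wpM2l; first exact/exprn_ge0/ltW.
  have bd j (z : R) : (j < M)%N -> j%:R * h <= z <= j%:R * h + 2 * h -> 0 <= z ^+ 2 <= B ^+ 2.
    move=> jM /andP[z1 z2]; have j0 : 0 <= j%:R * h by rewrite mulr_ge0// ltW.
    have z0 : 0 <= z by apply: le_trans z1.
    rewrite sqr_ge0/=; apply: ler_pow => //; apply: le_trans z2 _.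
    rewrite /B natrD -hM lerD//.
      by apply: ler_wpM2r; [exact: ltW | rewrite ler_nat ltnW].
    by rewrite ler_piMr// /h invf_le1// ler1n.
  have X1 := bd _ _ aM xiI; have X2 := bd _ _ bM etaI; have X3 := bd _ _ cM zetaI.
  apply: (jet2_bound (Y := 3 * B ^+ 2) (n := 0) X3) => //; last by lra.
  by apply: (jet2_bound (n := 2) X2); exact: (jet2_bound (n := 4) X1).
pose L := [seq (p, c) | p <- [seq (a, b) | a <- index_iota 0 M, b <- index_iota 0 M], c <- index_iota 0 M].
pose co (n : nat * nat * nat) := n.1.1.+1%:R * n.1.2.+1%:R * n.2.+1%:R * ddiff3 m n.1.1 n.1.2 n.2.
apply: (@bounded6_comb _ _ L co (fejer R)).
- by rewrite ltr_wpDr// mulr_ge0// exprn_ge0.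
- apply: (@le_trans _ _ (r0%:R ^+ 6 * K3)); last by rewrite lerDr.
  rewrite big_allpairs big_allpairs.
  apply: (@le_trans _ _ (\sum_(0 <= a < M) \sum_(0 <= b < M) \sum_(0 <= c < M)
      (M%:R ^+ 3 * (h ^+ 6 * K3)))).
    rewrite !big_mkord; apply: ler_sum => a _; rewrite !big_mkord; apply: ler_sum => b _.
    rewrite !big_mkord; apply: ler_sum => c _.
    rewrite /co /= normrM; apply: ler_pM => //; last exact: mD.
    rewrite ger0_norm// (_ : M%:R ^+ 3 = M%:R * M%:R * M%:R); last by ring.
    by apply: ler_pM => //; [apply: ler_pM => // |]; rewrite ler_nat.
  have Es (x : R) : \sum_(0 <= a < M) x = M%:R * x by rewrite sumr_const_nat subn0 mulr_natl.
  under eq_bigr do under eq_bigr do rewrite Es.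
  under eq_bigr do rewrite Es.
  rewrite Es.
  have -> : M%:R * (M%:R * (M%:R * (M%:R ^+ 3 * (h ^+ 6 * K3)))) = (M%:R * h) ^+ 6 * K3 by ring.
  by rewrite hM.
- exact: contraction6_fejer.
- move=> k; rewrite mE (fejer_expansion k mM) !big_allpairs.
  by apply: eq_bigr => a _; apply: eq_bigr => b _; apply: eq_bigr.
Qed.

(** The left-hand side is bounded, and vanishes when [<k>] is at most a small
    multiple of [N]. *)
Lemma tsym_near1 : exists2 A : R, 0 < A & forall N k, (0 < N)%N ->
  (1 - tsym psi N k) ^+ 2 <= A / N%:R * bracket2 R k `^ 2^-1.
Proof.
have [K K0 HK] := tsym_bounded.
have [_ _ /nbhs_ballP[rho /= rho0 near1]] := hpsi.
pose A0 := (1 + K) ^+ 2.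
exists (A0 * (1 + rho^-1)) => [|N k N0].
  by rewrite mulr_gt0// ?exprn_gt0// ltr_wpDr// ?invr_ge0 ltW.
have N0' : 0 < N%:R :> R by rewrite ltr0n.
have b0 := bracket2_gt0 R k; have n0 := normsq_ge0 R k.
set x := normsq R k / N%:R ^+ 2.
have x0 : 0 <= x by rewrite divr_ge0// exprn_ge0.
have rhs0 : 0 <= A0 * (1 + rho^-1) / N%:R * bracket2 R k `^ 2^-1.
  apply: mulr_ge0; last exact: powR_ge0.
  by rewrite divr_ge0// mulr_ge0 ?sqr_ge0// addr_ge0// invr_ge0 ltW.
have [xr|xr] := ltP x rho.
  rewrite tsymE -/x (near1 x) ?subrr ?expr0n//.
  by rewrite /ball /= sub0r normrN ger0_norm.
have h1 : (1 - tsym psi N k) ^+ 2 <= A0.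
  rewrite -[leLHS]real_normK ?num_real//; apply: ler_pow => //.
  by apply: le_trans (ler_normB _ _) _; rewrite normr1 lerD2l.
apply: le_trans h1 _; set s := bracket2 R k `^ 2^-1.
have s0 : 0 <= s by exact: powR_ge0.
have s2 : s ^+ 2 = bracket2 R k.
  by rewrite -powR_mulrn// -powRrM mulVf ?powRr1 ?ltW// pnatr_eq0.
pose y := s / N%:R; have y0 : 0 <= y by rewrite divr_ge0// ltW.
rewrite (_ : _ * s = A0 * ((1 + rho^-1) * y)); last by rewrite /y; ring.
rewrite -[leLHS]mulr1; apply: ler_wpM2l; first exact: sqr_ge0.
have yr : rho <= y ^+ 2.
  rewrite /y exprMn exprVn s2; apply: le_trans xr _; apply: ler_wpM2r.
    by rewrite invr_ge0 exprn_ge0.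
  by rewrite /bracket2 lerDr.
have c2 : rho * rho^-1 = 1 by rewrite mulfV// gt_eqF.
have c0 : 0 < rho^-1 by rewrite invr_gt0.
rewrite -(ler_pM2l rho0); nra.
Qed.

End Cutoff.

End CutoffMultiplier.

(** * The cubic nonlinearity in L^2 and in H^(-1) *)

Section NonlinearEstimate.
Variable R : realType.
Local Notation TM := (torus_measure R).
Implicit Types (s : seq Z3) (u v w z : distr R) (f g : torus R -> R) (k : Z3).

Let tf : (TM setT < +oo)%E := torus_fin R.

Lemma ReD (a b : R[i]) : complex.Re (a + b) = complex.Re a + complex.Re b.
Proof. by case: a; case: b. Qed.

Lemma ImD (a b : R[i]) : complex.Im (a + b) = complex.Im a + complex.Im b.
Proof. by case: a; case: b. Qed.

Lemma ReB (a b : R[i]) : complex.Re (a - b) = complex.Re a - complex.Re b.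
Proof. by case: a; case: b. Qed.

Lemma ImB (a b : R[i]) : complex.Im (a - b) = complex.Im a - complex.Im b.
Proof. by case: a; case: b. Qed.

Lemma csqD_le (a b : R[i]) : csq (a + b) <= 2 * csq a + 2 * csq b.
Proof.
rewrite /csq ReD ImD -subr_ge0.
rewrite (_ : _ - _ = (complex.Re a - complex.Re b) ^+ 2 + (complex.Im a - complex.Im b) ^+ 2).
  by rewrite addr_ge0// sqr_ge0.
by ring.
Qed.

Lemma pow6_add (x y : R) : (x + y) ^+ 6 <= 32 * (x ^+ 6 + y ^+ 6).
Proof.
have h : 0 <= (2^-1 : R) <= 1 by apply/andP; split; lra.
have := convex6 x y h; rewrite (_ : 1 - 2^-1 = 2^-1 :> R); last by field.
move=> H; have -> : (x + y) ^+ 6 = 64 * (2^-1 * x + 2^-1 * y) ^+ 6 by field.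
have -> : 32 * (x ^+ 6 + y ^+ 6) = 64 * (2^-1 * x ^+ 6 + 2^-1 * y ^+ 6) by field.
by apply: ler_wpM2l.
Qed.

Lemma trigpoly_csum s u v x :
  trigpoly s (fun k => u k + v k) x = trigpoly s u x + trigpoly s v x.
Proof.
rewrite /trigpoly -big_split; apply: eq_bigr => k _.
by rewrite /wave ReD ImD /=; ring.
Qed.

Lemma tint_mulr (h p : torus R -> R) : tint h -> bmf p -> tint (fun x => h x * p x).
Proof. by move=> hi bp; rewrite /tint; under eq_fun do rewrite mulrC; exact: integrable_bmfM. Qed.

Lemma integrable_pow6 f (A : R) : tint f -> (\int[TM]_x (f x ^+ 6)%:E <= A%:E)%E ->
  tint (fun x => f x ^+ 6).
Proof.
move=> fi fA; have mf : measurable_fun setT f by move: fi => /integrableP[/measurable_EFinP].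
apply/integrableP; split; first by apply/measurable_EFinP; exact: measurable_funX.
under eq_integral do rewrite /= ger0_norm ?exprn_even_ge0//.
exact: le_lt_trans fA (ltry _).
Qed.

(** The part [z] is controlled through [(1 - Delta)^(gamma/2) z], as negative
    powers of [1 - Delta] contract L^6, and [w] by the Sobolev embedding. *)
Lemma Lsix_bound (gamma A K q : R) (m : Z3 -> R) z w f :
  0 < gamma < 2 -> bounded6 A m -> (forall k, `|m k| <= K) -> tint f ->
  (forall k, fourier f k = multiplier m (fun k => z k + w k) k) ->
  (forall n, \int[TM]_x
     (fmean ((n, n), n) (multiplier (fun k => bracket2 R k `^ (gamma / 2)) z) x) ^+ 6 <= q ^+ 6) ->
  (forall s, uniq s -> \sum_(k <- s) bracket2 R k * csq (w k) <= q ^+ 2) ->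
  (\int[TM]_x (f x ^+ 6)%:E <=
     (32 * (A ^+ 6 + 5 ^+ 6 * vol R ^+ 3 * K ^+ 6) * q ^+ 6)%:E)%E.
Proof.
move=> /andP[g0 g2] bm mK fi fE zq wq.
apply: fmean_lsc6 => // n; pose bx := box ((n, n), n).
pose fj := fejer R ((n, n), n); pose J (k : Z3) := bracket2 R k `^ (gamma / 2).
have b6 v : bmf (fun x => trigpoly bx v x ^+ 6) by apply: bmfX; exact: bmf_trigpoly.
pose p1 := trigpoly bx (multiplier m (multiplier fj z)).
pose p2 := trigpoly bx (multiplier (fun k => fj k * m k) w).
have pE x : fmean ((n, n), n) (fourier f) x = p1 x + p2 x.
  rewrite /p1 /p2 -trigpoly_csum /fmean; apply: eq_trigpoly => k _.
  rewrite /multiplier fE /multiplier -/fj !mulrDr mulrCA; congr (_ + _).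
  by rewrite mulrA -rmorphM.
have I1 : \int[TM]_x p1 x ^+ 6 <= A ^+ 6 * q ^+ 6.
  apply: le_trans (bm _ _) _; apply: ler_wpM2l; first exact: exprn_even_ge0.
  apply: le_trans (zq n).
  have s01 : 0 < gamma / 2 < 1 by apply/andP; split; lra.
  apply: le_trans (contraction6_bessel s01 bx (multiplier fj (multiplier J z))).
  apply: eq_le_real; apply: eq_Rintegral => x _; congr (_ ^+ 6).
  apply: eq_trigpoly => k _; rewrite /multiplier !mulrA -!rmorphM; congr (_%:C%C * _).
  rewrite [RHS]mulrAC /J -powRD; last by rewrite (gt_eqF (bracket2_gt0 R k)) implybT.
  by rewrite addNr powRr0 mul1r.
have I2 : \int[TM]_x p2 x ^+ 6 <= 5 ^+ 6 * vol R ^+ 3 * K ^+ 6 * q ^+ 6.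
  have ub : uniq bx by exact: uniq_box.
  apply: le_trans (sobolev_trigpoly _ ub) _; rewrite -[leRHS]mulrA; apply: ler_wpM2l.
    by apply/ltW/mulr_gt0; rewrite exprn_gt0// vol_gt0.
  have -> : K ^+ 6 * q ^+ 6 = (K ^+ 2 * q ^+ 2) ^+ 3 by ring.
  apply: ler_pow.
    apply: sumr_ge0 => k _; apply: mulr_ge0; [exact/ltW/bracket2_gt0 | exact: csq_ge0].
  apply: le_trans (ler_wpM2l (sqr_ge0 K) (wq _ ub)); rewrite mulr_sumr; apply: ler_sum => k _.
  rewrite csq_multiplier mulrCA; apply: ler_wpM2r.
    by apply: mulr_ge0; [exact/ltW/bracket2_gt0 | exact: csq_ge0].
  rewrite exprMn -[leRHS]mul1r; apply: ler_pM; rewrite ?sqr_ge0//.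
    rewrite -(expr1n _ 2); apply: ler_pow; [exact: fejer_ge0 | exact: fejer_le1].
  by rewrite -[m k ^+ 2]real_normK ?num_real//; apply: ler_pow.
apply: (@le_trans _ _ (\int[TM]_x (32 * (p1 x ^+ 6 + p2 x ^+ 6)))).
  apply: (bmf_Rintegral_le tf).
  - by apply: bmfX; exact: bmf_fmean.
  - by apply: bmfZ; apply: bmfD; exact: b6.
  - by move=> x; rewrite pE; exact: pow6_add.
rewrite RintegralZb//; last by apply: bmfD; exact: b6.
rewrite RintegralDb//; [|exact: b6|exact: b6].
rewrite -mulrA; apply: ler_wpM2l => //; rewrite mulrDl.
exact: lerD.
Qed.

Lemma Ltwo_bound (Q : R) e u : tint e ->
  (forall n x, fmean n (fourier e) x = fmean n u x) ->
  (forall s, uniq s -> \sum_(k <- s) csq (u k) <= Q) ->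
  (\int[TM]_x (e x ^+ 2)%:E <= (vol R * Q)%:E)%E.
Proof.
move=> ei eE uQ; apply: fmean_lsc2 => // n.
have ub := uniq_box ((n, n), n).
under eq_Rintegral do rewrite eE.
apply: le_trans (trigpoly_L2 _ ub) _; apply: ler_wpM2l; first exact/ltW/vol_gt0.
apply: le_trans (uQ _ ub); apply: ler_sum => k _; rewrite csq_multiplier.
rewrite -[leRHS]mul1r; apply: ler_wpM2r; first exact: csq_ge0.
by rewrite -(expr1n _ 2); apply: ler_pow; [exact: fejer_ge0 | exact: fejer_le1].
Qed.

(** Bessel's inequality for [f^3], which is square integrable. *)
Lemma bessel_cube f (A : R) s : uniq s -> tint f -> tint (fun x => f x ^+ 3) ->
  (\int[TM]_x (f x ^+ 6)%:E <= A%:E)%E ->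
  vol R * \sum_(k <- s) csq (fourier (fun x => f x ^+ 3) k) <= A.
Proof.
move=> us fi fi3 fA; set S := \sum_(k <- s) _.
have fi6 := integrable_pow6 fi fA.
pose p := trigpoly s (fourier (fun x => f x ^+ 3)).
have bp : bmf p by exact: bmf_trigpoly.
have E : \int[TM]_x (f x ^+ 3 * p x) = vol R * S.
  by rewrite pairing//; congr (_ * _); apply: eq_bigr => k _; rewrite /csq !expr2.
have bp2 : bmf (fun x => p x ^+ 2) by exact: bmfX.
have H : \int[TM]_x (f x ^+ 3 * p x) <= \int[TM]_x (2^-1 * f x ^+ 6 + 2^-1 * p x ^+ 2).
  apply: le_Rintegral => //.
  - exact: tint_mulr.
  - by apply: tint_lin => //; exact: bmf_tint.
  - move=> x _; rewrite -subr_ge0.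
    rewrite (_ : _ - _ = 2^-1 * (f x ^+ 3 - p x) ^+ 2); last by field.
    by rewrite mulr_ge0// sqr_ge0.
rewrite Rintegral_lin// in H; last exact: bmf_tint.
have h2 : \int[TM]_x p x ^+ 2 <= vol R * S by exact: trigpoly_L2.
have h6 : \int[TM]_x f x ^+ 6 <= A by rewrite -lee_fin EFin_Rintegral.
rewrite E in H; lra.
Qed.

Lemma amgm_124 (x y z : R) : 0 <= x -> 0 <= y -> 0 <= z ->
  x * y ^+ 2 * z <= x ^+ 2 / 2 + y ^+ 6 / 3 + z ^+ 6 / 6.
Proof.
move=> x0 y0 z0.
have h1 : x * (y ^+ 2 * z) <= x ^+ 2 / 2 + (y ^+ 2 * z) ^+ 2 / 2.
  have := sqr_ge0 (x - y ^+ 2 * z); rewrite sqrrB; lra.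
(* [p^2 r <= (2 p^3 + r^3) / 3] with [p = y^2] and [r = z^2]. *)
pose p := y ^+ 2; pose r := z ^+ 2.
have p0 : 0 <= p by exact: sqr_ge0.
have r0 : 0 <= r by exact: sqr_ge0.
have h2 : p ^+ 2 * r <= (2 * p ^+ 3 + r ^+ 3) / 3.
  rewrite ler_pdivlMr// -subr_ge0.
  rewrite (_ : _ - _ = (p - r) ^+ 2 * (2 * p + r)); last by ring.
  by rewrite mulr_ge0 ?sqr_ge0// addr_ge0// mulr_ge0.
rewrite -mulrA; apply: le_trans h1 _.
have -> : (y ^+ 2 * z) ^+ 2 = p ^+ 2 * r by rewrite /p /r; ring.
have -> : y ^+ 6 = p ^+ 3 by rewrite /p; ring.
have -> : z ^+ 6 = r ^+ 3 by rewrite /r; ring.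
lra.
Qed.

Lemma cube_diff_le (a b : R) : `|a ^+ 3 - b ^+ 3| <= 3 / 2 * (`|a - b| * (a ^+ 2 + b ^+ 2)).
Proof.
rewrite (_ : a ^+ 3 - b ^+ 3 = (a - b) * (a ^+ 2 + a * b + b ^+ 2)); last by ring.
rewrite normrM mulrCA; apply: ler_wpM2l => //.
have := sqr_ge0 (a - b); have := sqr_ge0 (a + b); have := sqr_ge0 a; have := sqr_ge0 b.
rewrite sqrrB sqrrD => h1 h2 h3 h4; rewrite ler_norml; apply/andP; split; lra.
Qed.

(** Duality: the sum is tested against a trigonometric polynomial bounded in L^6 by
    this sum, through the Sobolev embedding. The three factors [f - g], [f^2 + g^2]
    and the test function are in L^2, L^3 and L^6; the inequality of Holder is
    replaced by that of the means after each factor is scaled by its norm. *)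
Lemma cube_difference (A V q D : R) f g s : uniq s -> 0 < q -> 0 < D ->
  tint f -> tint g -> tint (fun x => f x ^+ 3) -> tint (fun x => g x ^+ 3) ->
  (\int[TM]_x (f x ^+ 6)%:E <= (A * q ^+ 6)%:E)%E ->
  (\int[TM]_x (g x ^+ 6)%:E <= (A * q ^+ 6)%:E)%E ->
  (\int[TM]_x ((f x - g x) ^+ 2)%:E <= (V * D ^+ 2)%:E)%E ->
  vol R ^+ 2 * \sum_(k <- s) (bracket2 R k)^-1 *
    csq (fourier (fun x => f x ^+ 3) k - fourier (fun x => g x ^+ 3) k) <=
  (3 * (V / 2 + A / 3 + 5 ^+ 6 * vol R ^+ 3 / 6)) ^+ 2 * (D ^+ 2 * q ^+ 4).
Proof.
move=> us q0 D0 fi gi fi3 gi3 fA gA eV.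
pose H k := fourier (fun x => f x ^+ 3) k - fourier (fun x => g x ^+ 3) k.
set S2 := \sum_(k <- s) _.
have S20 : 0 <= S2.
  by apply: sumr_ge0 => k _; apply: mulr_ge0; rewrite ?csq_ge0// invr_ge0 ltW// bracket2_gt0.
set C := 3 * _.
have [S2z|S2n] := eqVneq S2 0.
  by rewrite S2z mulr0; apply: mulr_ge0; [exact: sqr_ge0 | apply: mulr_ge0; rewrite exprn_ge0// ltW].
have S2p : 0 < S2 by rewrite lt_neqAle eq_sym S2n.
pose S := Num.sqrt S2; have S0 : 0 < S by rewrite sqrtr_gt0.
have SS : S ^+ 2 = S2 by rewrite sqr_sqrtr.
pose u := multiplier (fun k => (bracket2 R k)^-1) H.
pose phi := trigpoly s u.
have bphi : bmf phi by exact: bmf_trigpoly.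
have bphi6 : bmf (fun x => phi x ^+ 6) by exact: bmfX.
have ei : tint (fun x => f x - g x) by exact: tintB.
have me : measurable_fun setT (fun x => f x - g x) by move: ei => /integrableP[/measurable_EFinP].
have fi6 := integrable_pow6 fi fA; have gi6 := integrable_pow6 gi gA.
have ei2 : tint (fun x => (f x - g x) ^+ 2).
  apply/integrableP; split; first by apply/measurable_EFinP; exact: measurable_funX.
  under eq_integral do rewrite /= ger0_norm ?sqr_ge0//.
  exact: le_lt_trans eV (ltry _).
have h6 : \int[TM]_x phi x ^+ 6 <= 5 ^+ 6 * vol R ^+ 3 * S ^+ 6.
  have -> : S ^+ 6 = S2 ^+ 3 by rewrite -SS -exprM.
  apply: le_trans (sobolev_trigpoly _ us) _.
  apply: eq_le_real; congr (_ * _ ^+ 3).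
  apply: eq_bigr => k _; rewrite csq_multiplier.
  have bn : bracket2 R k != 0 by rewrite gt_eqF// bracket2_gt0.
  by field.
have E : \int[TM]_x ((f x ^+ 3 - g x ^+ 3) * phi x) = vol R * S2.
  transitivity (\int[TM]_x (1 * (f x ^+ 3 * phi x) + (-1) * (g x ^+ 3 * phi x))).
    by apply: eq_Rintegral => x _; ring.
  rewrite Rintegral_lin; [|exact: tint_mulr|exact: tint_mulr].
  rewrite !pairing// mul1r mulN1r -mulrBr -sumrB; congr (_ * _); apply: eq_bigr => k _.
  rewrite Re_multiplier Im_multiplier /csq /H ReB ImB; ring.
have pt x : (f x ^+ 3 - g x ^+ 3) * phi x <= (D * q ^+ 2 * S) *
   (3 / 2 * D ^- 2 * (f x - g x) ^+ 2 + (2^-1 * q ^- 6 * f x ^+ 6 + (2^-1 * q ^- 6 * g x ^+ 6 +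
     2^-1 * S ^- 6 * phi x ^+ 6))).
  have Dn : D != 0 by rewrite gt_eqF.
  have qn : q != 0 by rewrite gt_eqF.
  have Sn : S != 0 by rewrite gt_eqF.
  apply: le_trans (ler_norm _) _; rewrite normrM.
  apply: le_trans (ler_wpM2r (normr_ge0 _) (cube_diff_le (f x) (g x))) _.
  have am y : 0 <= y -> `|f x - g x| * y ^+ 2 * `|phi x| <= (D * q ^+ 2 * S) *
      (D ^- 2 * (f x - g x) ^+ 2 / 2 + q ^- 6 * y ^+ 6 / 3 + S ^- 6 * phi x ^+ 6 / 6).
    move=> y0.
    have := @amgm_124 (`|f x - g x| / D) (y / q) (`|phi x| / S).
    move/(_ (divr_ge0 (normr_ge0 _) (ltW D0)) (divr_ge0 y0 (ltW q0)) (divr_ge0 (normr_ge0 _) (ltW S0))).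
    have P0 : 0 <= D * q ^+ 2 * S by apply/ltW; rewrite !mulr_gt0// exprn_gt0.
    move/(ler_wpM2l P0) => am.
    rewrite (_ : `|f x - g x| * y ^+ 2 * `|phi x| = D * q ^+ 2 * S *
       (`|f x - g x| / D * (y / q) ^+ 2 * (`|phi x| / S))); last first.
      by move: (S) Sn => S' Sn; field; rewrite Dn qn Sn.
    apply: le_trans am _; apply: ler_wpM2l => //.
    have n2 (a : R) : `|a| ^+ 2 = a ^+ 2 by rewrite real_normK ?num_real.
    have n6 (a : R) : `|a| ^+ 6 = a ^+ 6 by rewrite -[6%N]/(2 * 3)%N !exprM n2.
    by rewrite !exprMn !exprVn n2 n6; apply: eq_le_real; ring.
  have n2 (a : R) : `|a| ^+ 2 = a ^+ 2 by rewrite real_normK ?num_real.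
  have n6 (a : R) : `|a| ^+ 6 = a ^+ 6 by rewrite -[6%N]/(2 * 3)%N !exprM n2.
  have := am _ (normr_ge0 (f x)); have := am _ (normr_ge0 (g x)).
  rewrite !n2 !n6 => a1 a2.
  set P := D * q ^+ 2 * S in a1 a2 *.
  have -> : 3 / 2 * (`|f x - g x| * (f x ^+ 2 + g x ^+ 2)) * `|phi x| =
    3 / 2 * (`|f x - g x| * f x ^+ 2 * `|phi x| + `|f x - g x| * g x ^+ 2 * `|phi x|) by ring.
  set a := `|f x - g x| * f x ^+ 2 * _ in a2 *; set b := `|f x - g x| * g x ^+ 2 * _ in a1 *.
  have -> : P * (3 / 2 * D ^- 2 * (f x - g x) ^+ 2 + (2^-1 * q ^- 6 * f x ^+ 6 +
    (2^-1 * q ^- 6 * g x ^+ 6 + 2^-1 * S ^- 6 * phi x ^+ 6))) =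
    P * (3 / 2 * (D ^- 2 * (f x - g x) ^+ 2) + (2^-1 * (q ^- 6 * f x ^+ 6) +
    (2^-1 * (q ^- 6 * g x ^+ 6) + 2^-1 * (S ^- 6 * phi x ^+ 6)))) by rewrite !mulrA.
  move: (D ^- 2 * _) (q ^- 6 * f x ^+ 6) (q ^- 6 * g x ^+ 6) (S ^- 6 * _) a1 a2 => X1 X2 X3 X4 a1 a2.
  clear -a1 a2; lra.
have iS (c1 : R) h : tint h -> tint (fun x => c1 * h x).
  move=> hi; have := tint_lin c1 0 hi hi.
  by under eq_fun do rewrite mul0r addr0.
have iphi : tint (fun x => phi x ^+ 6) by exact: bmf_tint.
have i1 := tint_lin (2^-1 * q ^- 6) (2^-1 * S ^- 6) gi6 iphi.
have i2 := tint_lin (2^-1 * q ^- 6) 1 fi6 i1.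
have i3 := tint_lin (3 / 2 * D ^- 2) 1 ei2 i2.
have i4 := iS (D * q ^+ 2 * S) _ i3.
have Hm : vol R * S2 <= D * q ^+ 2 * S * C.
  rewrite -E.
  apply: (@le_trans _ _ (\int[TM]_x ((D * q ^+ 2 * S) *
    (3 / 2 * D ^- 2 * (f x - g x) ^+ 2 + 1 * (2^-1 * q ^- 6 * f x ^+ 6 + 1 * (2^-1 * q ^- 6 * g x ^+ 6 +
     2^-1 * S ^- 6 * phi x ^+ 6)))))).
    apply: le_Rintegral => //.
    - by apply: tint_mulr => //; exact: tintB.
    - by move=> x _; rewrite !mul1r; exact: pt.
  apply: (@le_trans _ _ ((D * q ^+ 2 * S) * (3 / 2 * D ^- 2 * \int[TM]_x (f x - g x) ^+ 2 +
     1 * (2^-1 * q ^- 6 * \int[TM]_x f x ^+ 6 + 1 * (2^-1 * q ^- 6 * \int[TM]_x g x ^+ 6 +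
     2^-1 * S ^- 6 * \int[TM]_x phi x ^+ 6))))).
    apply: eq_le_real.
    rewrite -(Rintegral_lin _ _ gi6 iphi) -(Rintegral_lin _ _ fi6 i1) -(Rintegral_lin _ _ ei2 i2).
    have := Rintegral_lin (D * q ^+ 2 * S) 0 i3 i3.
    by rewrite mul0r addr0 => <-; apply: eq_Rintegral => x _; rewrite mul0r addr0.
  apply: ler_wpM2l; first by apply/ltW; rewrite !mulr_gt0// exprn_gt0.
  have J1 : \int[TM]_x (f x - g x) ^+ 2 <= V * D ^+ 2 by rewrite -lee_fin EFin_Rintegral.
  have J2 : \int[TM]_x f x ^+ 6 <= A * q ^+ 6 by rewrite -lee_fin EFin_Rintegral.
  have J3 : \int[TM]_x g x ^+ 6 <= A * q ^+ 6 by rewrite -lee_fin EFin_Rintegral.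
  have inv_le (c1 X B y : R) n : 0 <= c1 -> 0 < y -> X <= B * y ^+ n -> c1 * y ^- n * X <= c1 * B.
    move=> c10 y0 XB; rewrite -mulrA; apply: ler_wpM2l => //.
    by rewrite mulrC ler_pdivrMr// exprn_gt0.
  have K1 : 3 / 2 * D ^- 2 * \int[TM]_x (f x - g x) ^+ 2 <= 3 / 2 * V by exact: inv_le.
  have K2 : 2^-1 * q ^- 6 * \int[TM]_x f x ^+ 6 <= 2^-1 * A by exact: inv_le.
  have K3 : 2^-1 * q ^- 6 * \int[TM]_x g x ^+ 6 <= 2^-1 * A by exact: inv_le.
  have K4 : 2^-1 * S ^- 6 * \int[TM]_x phi x ^+ 6 <= 2^-1 * (5 ^+ 6 * vol R ^+ 3) by exact: inv_le.
  by rewrite !mul1r /C; move: K1 K2 K3 K4; clear; lra.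
have Hs : vol R * S <= C * (D * q ^+ 2).
  rewrite -(ler_pM2r S0) -mulrA -expr2 SS; apply: le_trans Hm _.
  by apply: eq_le_real; ring.
rewrite -SS (_ : D ^+ 2 * q ^+ 4 = (D * q ^+ 2) ^+ 2); last by ring.
rewrite -!exprMn; apply: ler_pow => //.
by apply: mulr_ge0; [exact/ltW/vol_gt0 | exact: ltW].
Qed.

End NonlinearEstimate.

(** * The forcing of the difference equation *)

Section CubeDefect.
Variable R : realType.
Local Notation TM := (torus_measure R).
Implicit Types (s : seq Z3) (u v w z U : distr R) (f g : torus R -> R) (k : Z3).

(** The first part of [(1 - P_N) F + P_N (F - FN)] gains a power of [N] as
    [F = U^3] is in L^2, and the second one is linear in the L^2 norm of
    [U - P_N UN], which is that of [U - UN] up to a power of [N]. *)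
Theorem nonlinear_estimate (psi : R -> R) : is_cutoff psi ->
  exists2 C : R, 0 < C & forall (gamma q P Y2 : R) N z U UN F FN,
  0 < gamma < 2 -> (0 < N)%N -> 0 < q -> 0 < P ->
  is_cube U F -> is_cube (truncation psi N UN) FN ->
  (forall n, \int[TM]_x
     (fmean ((n, n), n) (multiplier (fun k => bracket2 R k `^ (gamma / 2)) z) x) ^+ 6 <= q ^+ 6) ->
  (forall s, uniq s -> \sum_(k <- s) bracket2 R k * csq (U k - z k) <= q ^+ 2) ->
  (forall s, uniq s -> \sum_(k <- s) bracket2 R k * csq (UN k - z k) <= q ^+ 2) ->
  (forall s, uniq s -> \sum_(k <- s) bracket2 R k `^ 2^-1 * csq (U k) <= P) ->
  (forall s, uniq s -> \sum_(k <- s) csq (U k - UN k) <= Y2) ->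
  forall s, uniq s ->
  \sum_(k <- s) (bracket2 R k)^-1 * csq (F k - truncation psi N FN k) <=
  C * (q ^+ 6 / N%:R + q ^+ 4 * (P / N%:R + Y2)).
Proof.
move=> hpsi.
have [A A0 HA] := bounded6_tsym hpsi.
have [K K0 HK] := tsym_bounded hpsi.
have [A1 A10 HA1] := tsym_near1 hpsi.
have v0 := vol_gt0 R.
pose C0 : R := 5 ^+ 6 * vol R ^+ 3.
have C00 : 0 < C0 by rewrite mulr_gt0// exprn_gt0.
pose A' := 32 * (1 ^+ 6 + C0 * 1 ^+ 6) + 32 * (A ^+ 6 + C0 * K ^+ 6).
have E1 : 0 <= 32 * (1 ^+ 6 + C0 * 1 ^+ 6).
  by rewrite !expr1n mulr1 mulr_ge0// addr_ge0// ltW.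
have E2 : 0 <= 32 * (A ^+ 6 + C0 * K ^+ 6).
  by rewrite mulr_ge0// addr_ge0// ?exprn_ge0 ?(ltW A0)// mulr_ge0 ?(ltW C00)// exprn_ge0.
pose C3 := 3 * (vol R / 2 + A' / 3 + C0 / 6).
pose X1 := 2 * A1 * A' / vol R; pose X2 := 2 * K ^+ 2 * (C3 ^+ 2 / vol R ^+ 2).
have X10 : 0 <= X1.
  by rewrite /X1 divr_ge0 ?(ltW v0)// mulr_ge0 ?addr_ge0// mulr_ge0 ?(ltW A10).
have X20 : 0 <= X2.
  by rewrite /X2 mulr_ge0 ?divr_ge0 ?sqr_ge0// mulr_ge0 ?sqr_ge0.
pose c2 := 2 * A1 + 2 * K ^+ 2.
have c20 : 0 <= c2 by rewrite /c2 addr_ge0// mulr_ge0 ?sqr_ge0 ?(ltW A10).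
exists (1 + X1 + X2 * (2 * c2)).
  by rewrite -addrA ltr_wpDr// addr_ge0// mulr_ge0// mulr_ge0.
move=> gamma q P Y2 N z U UN F FN g01 N0 q0 P0 [f [fi fU] [fi3 fF]] [g [gi gU] [gi3 gF]] zq Uq UNq UP UY s us.
have N0' : 0 < N%:R :> R by rewrite ltr0n.
pose m := tsym psi N.
have Y20 : 0 <= Y2 by have := UY [::] isT; rewrite big_nil.
have fA : (\int[TM]_x (f x ^+ 6)%:E <= (A' * q ^+ 6)%:E)%E.
  have b1 : bounded6 1 (fun=> 1 : R).
    by move=> t u; rewrite expr1n mul1r; exact: contraction6_1.
  have fU' k : fourier f k = multiplier (fun=> 1) (fun k => z k + (U k - z k)) k.
    by rewrite fU /multiplier rmorph1 mul1r addrC subrK.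
  have b2 (k : Z3) : `|1 : R| <= 1 by rewrite normr1.
  apply: le_trans (Lsix_bound g01 b1 b2 fi fU' zq Uq) _.
  by rewrite lee_fin; apply: ler_wpM2r; [rewrite exprn_ge0// ltW | rewrite lerDl].
have gA : (\int[TM]_x (g x ^+ 6)%:E <= (A' * q ^+ 6)%:E)%E.
  have gU' k : fourier g k = multiplier m (fun k => z k + (UN k - z k)) k.
    by rewrite gU /truncation /multiplier (addrC (z k)) subrK.
  apply: le_trans (Lsix_bound g01 (HA _ N0) (HK N) gi gU' zq UNq) _.
  by rewrite lee_fin; apply: ler_wpM2r; [rewrite exprn_ge0// ltW | rewrite lerDr].
(* The last term makes [D2] positive, as required by the scaling. *)
pose D2 := c2 * (P / N%:R + Y2) + (2 * A1) / N%:R * P.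
have PN : 0 < P / N%:R by rewrite divr_gt0.
have D20 : 0 < D2.
  rewrite /D2 ltr_wpDl//; first by rewrite mulr_ge0// addr_ge0// ltW.
  by rewrite mulr_gt0// divr_gt0// mulr_gt0.
pose D := Num.sqrt D2; have D0 : 0 < D by rewrite sqrtr_gt0.
have DD : D ^+ 2 = D2 by rewrite sqr_sqrtr// ltW.
pose e x := f x - g x.
have ei : tint e by exact: tintB.
pose v k := U k - multiplier m UN k.
have ev n x : fmean n (fourier e) x = fmean n v x.
  have -> : e = (fun x => 1 * f x + (-1) * g x) by apply/funext => y; rewrite mul1r mulN1r.
  rewrite fmean_lin// mul1r mulN1r /fmean /trigpoly -sumrB; apply: eq_bigr => k _.
  by rewrite /wave !Re_multiplier !Im_multiplier fU gU /v ReB ImB; ring.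
have vQ t : uniq t -> \sum_(k <- t) csq (v k) <= D2.
  move=> ut; apply: (@le_trans _ _ (\sum_(k <- t) (2 * (A1 / N%:R) * (bracket2 R k `^ 2^-1 * csq (U k)) +
     2 * K ^+ 2 * csq (U k - UN k)))).
    apply: ler_sum => k _.
    have -> : v k = multiplier (fun k => 1 - m k) U k + multiplier m (fun k => U k - UN k) k.
      by rewrite /v /multiplier rmorphB rmorph1; ring.
    apply: le_trans (csqD_le _ _) _; rewrite !csq_multiplier.
    apply: lerD; rewrite -mulrA; apply: ler_wpM2l => //.
      by rewrite mulrA; apply: ler_wpM2r; [exact: csq_ge0 | exact: HA1].
    by apply: ler_wpM2r; [exact: csq_ge0 | rewrite -[leLHS]real_normK ?num_real//; apply: ler_pow => //; exact: HK].
  rewrite big_split -!mulr_sumr /=.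
  have h1 : 2 * (A1 / N%:R) * (\sum_(k <- t) bracket2 R k `^ 2^-1 * csq (U k)) <= 2 * (A1 / N%:R) * P.
    by apply: ler_wpM2l; [apply: mulr_ge0 => //; rewrite divr_ge0// ltW | exact: UP].
  have h2 : 2 * K ^+ 2 * (\sum_(k <- t) csq (U k - UN k)) <= 2 * K ^+ 2 * Y2.
    by apply: ler_wpM2l; [apply: mulr_ge0 => //; exact: sqr_ge0 | exact: UY].
  have h3 : 0 <= c2 * (P / N%:R) by rewrite mulr_ge0// ltW.
  have h4 : 0 <= 2 * A1 * Y2 by rewrite mulr_ge0// mulr_ge0// ltW.
  apply: le_trans (lerD h1 h2) _.
  have -> : D2 = c2 * (P / N%:R) + 2 * A1 * Y2 + (2 * (A1 / N%:R) * P + 2 * K ^+ 2 * Y2).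
    by rewrite /D2 /c2; ring.
  by rewrite lerDr addr_ge0.
have eV : (\int[TM]_x ((f x - g x) ^+ 2)%:E <= (vol R * D ^+ 2)%:E)%E.
  by rewrite DD; exact: (Ltwo_bound ei ev vQ).
have cd := cube_difference us q0 D0 fi gi fi3 gi3 fA gA eV.
have bs := bessel_cube us fi fi3 fA.
rewrite (eq_bigr (fun k => (bracket2 R k)^-1 * csq (F k - FN k))) in cd; last first.
  by move=> k _; rewrite fF gF.
rewrite (eq_bigr (fun k => csq (F k))) in bs; last by move=> k _; rewrite fF.
set SF := \sum_(k <- s) csq (F k) in bs; set SD := \sum_(k <- s) _ in cd.
apply: (@le_trans _ _ (2 * (A1 / N%:R) * SF + 2 * K ^+ 2 * SD)).
  rewrite /SF /SD !mulr_sumr -big_split /=; apply: ler_sum => k _.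
  have b0 := bracket2_gt0 R k.
  have -> : F k - truncation psi N FN k =
      multiplier (fun k => 1 - m k) F k + multiplier m (fun k => F k - FN k) k.
    by rewrite /truncation /multiplier rmorphB rmorph1; ring.
  apply: le_trans (ler_wpM2l _ (csqD_le _ _)) _; first by rewrite invr_ge0 ltW.
  rewrite !csq_multiplier mulrDr; apply: lerD.
    rewrite mulrCA -mulrA; apply: ler_wpM2l => //; rewrite mulrA; apply: ler_wpM2r; first exact: csq_ge0.
    rewrite mulrC ler_pdivrMr//; apply: le_trans (HA1 N k N0) _.
    apply: ler_wpM2l; first by rewrite divr_ge0// ltW.
    rewrite -[leRHS](powRr1 (ltW b0)); apply: ler_powR; [exact: bracket2_ge1 | lra].
  rewrite mulrCA -mulrA; apply: ler_wpM2l => //; rewrite mulrCA; apply: ler_wpM2r.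
    by rewrite mulr_ge0 ?csq_ge0// invr_ge0 ltW.
  by rewrite -[leLHS]real_normK ?num_real//; apply: ler_pow => //; exact: HK.
have q6 : 0 <= q ^+ 6 by rewrite exprn_ge0// ltW.
have q4 : 0 <= q ^+ 4 by rewrite exprn_ge0// ltW.
have F1 : 2 * (A1 / N%:R) * SF <= X1 * (q ^+ 6 / N%:R).
  have : SF <= A' * q ^+ 6 / vol R by rewrite ler_pdivlMr// mulrC.
  move=> /(ler_wpM2l (_ : 0 <= 2 * (A1 / N%:R))) h; apply: le_trans (h _) _.
    by rewrite mulr_ge0// divr_ge0// ltW.
  by apply: eq_le_real; rewrite /X1; ring.
have F2 : 2 * K ^+ 2 * SD <= X2 * (2 * c2 * (q ^+ 4 * (P / N%:R + Y2))).
  have h : SD <= C3 ^+ 2 * (D ^+ 2 * q ^+ 4) / vol R ^+ 2.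
    have v2 : 0 < vol R ^+ 2 by exact: exprn_gt0.
    by rewrite (ler_pdivlMr _ _ v2) [leLHS]mulrC; exact: cd.
  have D2le : D ^+ 2 <= 2 * c2 * (P / N%:R + Y2).
    rewrite DD /D2.
    have h3 : 2 * A1 / N%:R * P <= c2 * (P / N%:R + Y2).
      rewrite -mulrA [_^-1 * P]mulrC; apply: ler_pM.
      - by rewrite mulr_ge0// ltW.
      - exact: ltW.
      - by rewrite /c2 lerDl mulr_ge0// sqr_ge0.
      - by rewrite lerDl.
    move: h3; clear; lra.
  apply: le_trans (ler_wpM2l (_ : 0 <= 2 * K ^+ 2) h) _; first by rewrite mulr_ge0// sqr_ge0.
  rewrite (_ : 2 * K ^+ 2 * _ = X2 * (D ^+ 2 * q ^+ 4)); last by rewrite /X2; ring.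
  apply: ler_wpM2l => //; rewrite [q ^+ 4 * _]mulrC [leRHS]mulrA; exact: ler_wpM2r.
have q6N : 0 <= q ^+ 6 / N%:R by rewrite divr_ge0.
have q4N : 0 <= q ^+ 4 * (P / N%:R + Y2) by rewrite mulr_ge0// addr_ge0// ltW.
apply: le_trans (lerD F1 F2) _; move: q6N q4N.
set a := q ^+ 6 / _; set b := q ^+ 4 * _ => a0 b0.
have := mulr_ge0 X10 b0; have := mulr_ge0 X20 (mulr_ge0 (mulr_ge0 (ler0n R 2) c20) a0).
clear -a0 b0; lra.
Qed.
End CubeDefect.

(** * Integration of differential inequalities *)

Section RealInduction.
Variable R : realType.

Lemma derive_right_le (f : R -> R) (df s e : R) : is_derive s (1 : R) f df -> 0 < e ->
  exists2 delta : R, 0 < delta & forall h : R, 0 < h -> h < delta ->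
    f (s + h) - f s <= (df + e) * h.
Proof.
move=> fd e0.
have /cvgr_dist_lt/(_ _ e0)/nbhs_ballP[delta /= d0 Hd] := @ex_derive _ _ _ _ _ _ _ fd.
exists delta => // h h0 hd.
have hb : ball 0 delta h by rewrite /ball /= sub0r normrN gtr0_norm.
have dE := @derive_val _ _ _ _ _ _ _ fd; rewrite /derive in dE.
have := Hd h hb (lt0r_neq0 h0); rewrite dE.
rewrite /= -[_ *: 1]/(h * 1) mulr1 -[_ *: _]/(h^-1 * _) => H.
have {}H : h^-1 * (f (h + s) - f s) < df + e.
  move: H; rewrite ltr_norml => /andP[H _]; lra.
rewrite (addrC s h); move: H; rewrite mulrC ltr_pdivrMr// => /ltW.
exact: id.
Qed.

(** At each time, one of the [beta n] is enough up to an arbitrarily small error,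
    even where their supremum is infinite, and by continuity it remains enough for
    a while. Hence the first time at which the conclusion stops cannot precede
    [t1]. *)
Lemma integrate_sup_inequality (f df : R -> R) (beta : nat -> R -> R) (I : R -> R) (c0 c1 t1 : R) :
  0 <= t1 -> 0 < c1 ->
  (forall t : R, is_derive t (1 : R) f (df t)) ->
  (forall n, continuous (beta n)) -> (forall n t, 0 <= beta n t) ->
  (forall n a b c, 0 <= a -> a <= b -> b <= t1 ->
     (forall t, a <= t <= b -> c <= beta n t) -> c * (b - a) <= I b - I a) ->
  (forall t b, 0 <= t <= t1 -> (forall n, beta n t <= b) -> df t <= c0 + c1 * b) ->
  f t1 - f 0 <= c0 * t1 + c1 * (I t1 - I 0).
Proof.
move=> t10 c10 fd betac beta0 Ibeta dfb.
have Imono a b : 0 <= a -> a <= b -> b <= t1 -> I a <= I b.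
  move=> a0 ab b1; have := Ibeta 0%N a b 0 a0 ab b1 (fun t _ => beta0 0%N t).
  by rewrite mul0r subr_ge0.
have fc : continuous f.
  by move=> t; apply/differentiable_continuous/derivable1_diffP; case: (fd t).
suff main e : 0 < e -> f t1 - f 0 <= (c0 + e) * t1 + c1 * (I t1 - I 0).
  apply/ler_addgt0Pr => e e0.
  have t11 : 0 < t1 + 1 by rewrite ltr_wpDl.
  have := main (e / (t1 + 1)) (divr_gt0 e0 t11).
  have : e / (t1 + 1) * t1 <= e.
    by rewrite -mulrA ger_pMr// mulrC ler_pdivrMr// mul1r lerDl.
  rewrite mulrDl; lra.
move=> e0; pose g t := f t - f 0 - (c0 + e) * t - c1 * (I t - I 0).
suff : g t1 <= 0 by rewrite /g; lra.
pose A := [set t : R | 0 <= t <= t1 /\ g t <= 0].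
have A0 : A 0 by split; [rewrite lexx | rewrite /g !subrr !mulr0 !subr0].
have supA : has_sup A by split; [exists 0 | exists t1 => t [/andP[]]].
pose s := sup A.
have s0 : 0 <= s by apply: (ub_le_sup supA.2).
have s1 : s <= t1 by apply: ge_sup; [exists 0 | move=> t [/andP[]]].
have gs : g s <= 0.
  apply/ler_addgt0Pr => eta eta0; rewrite add0r.
  have e2 : 0 < eta / 2 by rewrite divr_gt0.
  have /cvgr_dist_lt/(_ _ e2)/nbhs_ballP[d /= d0 Hd] := fc s.
  have M0 : 0 < `|c0 + e| + 1 by rewrite ltr_wpDl.
  pose d' := Num.min d (eta / 2 / (`|c0 + e| + 1)).
  have d'0 : 0 < d' by rewrite lt_min d0 divr_gt0.
  have [t [/andP[t0 tt1] gt] st] := sup_adherent d'0 supA.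
  have ts : t <= s by apply: (ub_le_sup supA.2); split; rewrite ?t0.
  have st1 : s - t < d by rewrite ltrBlDl -ltrBlDr; apply: le_lt_trans st; rewrite lerD2l lerN2 ge_min lexx.
  have st2 : s - t < eta / 2 / (`|c0 + e| + 1).
    by rewrite ltrBlDl -ltrBlDr; apply: le_lt_trans st; rewrite lerD2l lerN2 ge_min lexx orbT.
  have fst : f s - f t < eta / 2.
    apply: le_lt_trans (ler_norm _) _; apply: Hd.
    by rewrite /ball /= ger0_norm// subr_ge0.
  have cst : - ((c0 + e) * (s - t)) <= eta / 2.
    apply: le_trans (ler_norm _) _; rewrite normrN normrM (ger0_norm (x := s - t)) ?subr_ge0//.
    apply: (@le_trans _ _ ((`|c0 + e| + 1) * (s - t))).
      by apply: ler_wpM2r; [rewrite subr_ge0 | rewrite lerDl].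
    by rewrite mulrC -ler_pdivlMr// ltW.
  have cI : 0 <= c1 * (I s - I t) by rewrite mulr_ge0 ?(ltW c10)// subr_ge0 Imono.
  have -> : g s = g t + (f s - f t) - (c0 + e) * (s - t) - c1 * (I s - I t) by rewrite /g; ring.
  lra.
have [->//|sn] := eqVneq t1 s.
have {}sn : s < t1 by rewrite lt_neqAle eq_sym sn.
pose b := (df s - c0 - e / 2) / c1.
have bE : c1 * b = df s - c0 - e / 2 by rewrite /b mulrC divfK// gt_eqF.
have [n nb] : exists n, b < beta n s.
  apply: contrapT => /forallNP H.
  have : df s <= c0 + c1 * b.
    by apply: dfb; [rewrite s0 | move=> n; rewrite leNgt; apply/negP/H].
  rewrite bE; lra.
have e2 : 0 < e / 2 by rewrite divr_gt0.
have [d1 d10 Hd1] := derive_right_le (fd s) e2.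
have bn0 : 0 < beta n s - b by rewrite subr_gt0.
have /cvgr_dist_lt/(_ _ bn0)/nbhs_ballP[d2 /= d20 Hd2] := betac n s.
pose h := Num.min (d1 / 2) (Num.min (d2 / 2) (t1 - s)).
have h0 : 0 < h by rewrite !lt_min !divr_gt0//= subr_gt0.
have h1 : h < d1.
  by apply: (@le_lt_trans _ _ (d1 / 2)); [rewrite ge_min lexx | lra].
have h2 : h < d2.
  by apply: (@le_lt_trans _ _ (d2 / 2)); [rewrite !ge_min lexx orbT | lra].
have h3 : s + h <= t1.
  by rewrite addrC -lerBrDr !ge_min lexx !orbT.
have F1 := Hd1 h h0 h1.
have F2 : b * (s + h - s) <= I (s + h) - I s.
  apply: (Ibeta n) => //; first by rewrite lerDl ltW.
  move=> t /andP[t2 t3].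
  have : `|beta n s - beta n t| < beta n s - b.
    apply: Hd2; rewrite /ball /= distrC ger0_norm ?subr_ge0//; lra.
  rewrite ltr_norml => /andP[_ H]; lra.
have : A (s + h).
  split; first by rewrite h3 andbT addr_ge0// ltW.
  have -> : g (s + h) = g s + (f (s + h) - f s) - (c0 + e) * h - c1 * (I (s + h) - I s) by rewrite /g; ring.
  have F3 := ler_wpM2l (ltW c10) F2.
  rewrite (_ : s + h - s = h) in F3; last by ring.
  rewrite mulrA bE in F3; lra.
move=> /(ub_le_sup supA.2); rewrite -/s; lra.
Qed.

End RealInduction.

(** * Sobolev norms as suprema of finite sums *)

Section PhaseNorms.
Variable R : realType.
Implicit Types (s : seq Z3) (k : Z3) (d : phase R) (c : distr R).

Lemma poweR_invn_le (x : \bar R) (b : R) n : (0 <= x)%E ->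
  (poweR x n.+1%:R^-1 <= b%:E)%E -> (x <= (b ^+ n.+1)%:E)%E.
Proof.
case: x => [r||] //; last by rewrite poweRyr ?invr_eq0 ?pnatr_eq0// leye_eq.
rewrite poweR_EFin !lee_fin => r0 rb.
have -> : r = (r `^ n.+1%:R^-1) ^+ n.+1.
  by rewrite -powR_mulrn ?powR_ge0// -powRrM mulVf ?pnatr_eq0// powRr1.
by apply: ler_pow => //; exact: powR_ge0.
Qed.

Lemma poweR_invn_ge (x : \bar R) (b : R) n : (0 <= x)%E -> 0 <= b ->
  (x <= (b ^+ n.+1)%:E)%E -> (poweR x n.+1%:R^-1 <= b%:E)%E.
Proof.
case: x => [r||] //; rewrite poweR_EFin !lee_fin => r0 b0 rb.
have -> : b = (b ^+ n.+1) `^ n.+1%:R^-1.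
  by rewrite -powR_mulrn// -powRrM mulfV ?pnatr_eq0// powRr1.
by apply: ge0_ler_powR => //; rewrite nnegrE// exprn_ge0.
Qed.

Lemma poweR_invnK (x : \bar R) n : (0 <= x)%E -> (poweR x n.+1%:R^-1 ^+ n.+1 = x)%E.
Proof.
case: x => [r||] // r0.
  rewrite poweR_EFin -EFin_expe -powR_mulrn ?powR_ge0// -powRrM mulVf ?pnatr_eq0//.
  by rewrite powRr1.
rewrite poweRyr ?invr_eq0 ?pnatr_eq0//.
by elim: n => [|n ih]; rewrite ?expe1// expeS ih mulyy.
Qed.

Lemma esum_ge_sum (a : Z3 -> R) s : uniq s -> (forall k, 0 <= a k) ->
  ((\sum_(k <- s) a k)%:E <= \esum_(k in [set: Z3]) (a k)%:E)%E.
Proof.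
move=> us a0; apply: esum_ge; exists [set` s]; first by split => //; exact: finite_seq.
by rewrite -fsbig_seq// sumEFin.
Qed.

Lemma esum_le_sum (a : Z3 -> R) (M : R) :
  (forall s, uniq s -> \sum_(k <- s) a k <= M) ->
  (\esum_(k in [set: Z3]) (a k)%:E <= M%:E)%E.
Proof.
move=> H; apply: ge_ereal_sup => _ [X [fX _] <-].
by rewrite fsbig_finite//= sumEFin lee_fin; apply: H; exact: finmap.fset_uniq.
Qed.

Lemma phase_norm_ge_sum (sg b : R) d : (phase_norm sg d <= b%:E)%E ->
  forall s, uniq s ->
  \sum_(k <- s) (bracket2 R k `^ sg * csq (d.1 k) + bracket2 R k `^ (sg - 1) * csq (d.2 k)) <= b ^+ 2.
Proof.
have e0 t c : (0 <= \esum_(k in [set: Z3]) (bracket2 R k `^ t * csq (c k))%:E)%E.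
  by apply: esum_ge0 => k _; rewrite lee_fin mulr_ge0 ?powR_ge0 ?csq_ge0.
rewrite /phase_norm /sobolev_norm !(poweR_invnK 1 (e0 _ _)) => H s us.
rewrite -lee_fin; apply: le_trans (poweR_invn_le (n := 1) _ H); last exact: adde_ge0.
rewrite -esumD; [|by move=> k _; rewrite lee_fin mulr_ge0 ?powR_ge0 ?csq_ge0..].
apply: esum_ge_sum => // k.
by rewrite addr_ge0// mulr_ge0 ?powR_ge0 ?csq_ge0.
Qed.

Lemma phase_norm_le_sum (sg b : R) d : 0 <= b ->
  (forall s, uniq s ->
  \sum_(k <- s) (bracket2 R k `^ sg * csq (d.1 k) + bracket2 R k `^ (sg - 1) * csq (d.2 k)) <= b ^+ 2) ->
  (phase_norm sg d <= b%:E)%E.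
Proof.
have e0 t c : (0 <= \esum_(k in [set: Z3]) (bracket2 R k `^ t * csq (c k))%:E)%E.
  by apply: esum_ge0 => k _; rewrite lee_fin mulr_ge0 ?powR_ge0 ?csq_ge0.
move=> b0 H; rewrite /phase_norm /sobolev_norm !(poweR_invnK 1 (e0 _ _)).
apply: (@poweR_invn_ge _ _ 1) => //; first exact: adde_ge0.
rewrite -esumD; [|by move=> k _; rewrite lee_fin mulr_ge0 ?powR_ge0 ?csq_ge0..].
exact: esum_le_sum.
Qed.

(** The factor [1 / <k>] makes up for the lower regularity of the velocity. *)
Lemma free_flow_bound (r t : R) d : (phase_norm 2^-1 d <= r%:E)%E ->
  forall s, uniq s ->
  \sum_(k <- s) bracket2 R k `^ 2^-1 * csq ((free_flow t d).1 k) <= 2 * r ^+ 2.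
Proof.
move=> dr s us; apply: le_trans (ler_wpM2l _ (phase_norm_ge_sum dr us)) => //.
rewrite mulr_sumr; apply: ler_sum => k _.
have b0 := bracket2_gt0 R k.
set c := multiplier (fun k => cos (t * Num.sqrt (bracket2 R k))) d.1 k.
set c' := multiplier (fun k => sin (t * Num.sqrt (bracket2 R k)) / Num.sqrt (bracket2 R k)) d.2 k.
have -> : (free_flow t d).1 k = c + c' by [].
apply: le_trans (ler_wpM2l (powR_ge0 _ _) (csqD_le c c')) _.
rewrite mulrDr [leRHS]mulrDr /c /c' !csq_multiplier.
have h1 : cos (t * Num.sqrt (bracket2 R k)) ^+ 2 <= 1.
  by rewrite -(cos2Dsin2 (t * Num.sqrt (bracket2 R k))) lerDl sqr_ge0.
have h2 : sin (t * Num.sqrt (bracket2 R k)) ^+ 2 <= 1.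
  by rewrite -(cos2Dsin2 (t * Num.sqrt (bracket2 R k))) lerDr sqr_ge0.
apply: lerD.
  rewrite mulrCA; apply: ler_wpM2l => //; apply: ler_wpM2l; first exact: powR_ge0.
  by rewrite -[leRHS]mul1r; apply: ler_wpM2r => //; exact: csq_ge0.
rewrite mulrCA; apply: ler_wpM2l => //.
rewrite powRD ?(gt_eqF b0) ?implybT// -mulrA; apply: ler_wpM2l; first exact: powR_ge0.
rewrite exprMn exprVn sqr_sqrtr ?(ltW b0)// powRN powRr1 ?(ltW b0)//.
apply: ler_wpM2r; first exact: csq_ge0.
by rewrite -[leRHS]mul1r; apply: ler_wpM2r => //; rewrite invr_ge0 ltW.
Qed.

(** With [x = <k>^2], both weights are compared through
    [sqrt x <= Lam + x / Lam]. *)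
Lemma interpolate_half (Lam E H : R) d s : 0 < Lam ->
  \sum_(k <- s) (csq (d.1 k) + (bracket2 R k)^-1 * csq (d.2 k)) <= E ->
  \sum_(k <- s) (bracket2 R k * csq (d.1 k) + csq (d.2 k)) <= H ->
  \sum_(k <- s) (bracket2 R k `^ 2^-1 * csq (d.1 k) + bracket2 R k `^ (2^-1 - 1) * csq (d.2 k)) <=
  Lam * E + H / Lam.
Proof.
move=> L0 hE hH.
apply: le_trans (lerD (ler_wpM2l (ltW L0) hE) (ler_wpM2r (_ : 0 <= Lam^-1) hH)); last first.
  by rewrite invr_ge0 ltW.
rewrite mulr_sumr mulr_suml -big_split /=; apply: ler_sum => k _.
have b0 := bracket2_gt0 R k.
rewrite powRD ?(gt_eqF b0) ?implybT// powRN powRr1 ?(ltW b0)//.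
set x := bracket2 R k in b0 *; pose y := x `^ 2^-1.
have y0 : 0 <= y by exact: powR_ge0.
have y2 : y ^+ 2 = x by rewrite -powR_mulrn// -powRrM mulVf ?pnatr_eq0// powRr1// ltW.
rewrite -/y -mulrA -mulrDr.
have -> : Lam * (csq (d.1 k) + x^-1 * csq (d.2 k)) + (x * csq (d.1 k) + csq (d.2 k)) / Lam =
   (Lam + x / Lam) * (csq (d.1 k) + x^-1 * csq (d.2 k)).
  by field; rewrite !gt_eqF.
apply: ler_wpM2r.
  by rewrite addr_ge0 ?csq_ge0// mulr_ge0 ?csq_ge0// invr_ge0 ltW.
rewrite -(ler_pM2l L0) mulrDr (mulrC x) mulVKf ?gt_eqF// -y2.
have := sqr_ge0 (Lam - y); have := mulr_ge0 (ltW L0) y0; rewrite sqrrB !expr2; lra.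
Qed.

End PhaseNorms.

(** * The free evolution in L^6 *)

Section SupIntegral.
Variable R : realType.
Local Notation mu := (@lebesgue_measure R).
Local Notation TM := (torus_measure R).

Import HBNNSimple.

(** Integrals of nonnegative functions are suprema over simple functions, hence
    monotone without any measurability. *)
Lemma ge0_le_integral_nonmeasurable (D : set R) (f g : R -> \bar R) :
  (forall x, D x -> (0 <= f x)%E) -> (forall x, D x -> (f x <= g x)%E) ->
  (\int[mu]_(x in D) f x <= \int[mu]_(x in D) g x)%E.
Proof.
move=> f0 fg; rewrite !ge0_integralE//; last by move=> x Dx; apply: le_trans (f0 x Dx) (fg x Dx).
apply: ereal_sup_le => _ [h /= hf <-]; exists h => //= x.
apply: le_trans (hf x) _; rewrite /patch; case: ifPn => // xD.
by apply: fg; rewrite inE in xD.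
Qed.

(** The function [I] is the integral of the supremum of the [beta n], which is
    measurable even if [F] is not. *)
Lemma sup_integral (beta : nat -> R -> R) (F : R -> \bar R) (M T : R) : 0 <= T ->
  (forall n, continuous (beta n)) -> (forall n t, 0 <= beta n t) ->
  (forall n t, 0 <= t <= T -> ((beta n t)%:E <= F t)%E) ->
  (\int[mu]_(t in `[0%R, T]) F t <= M%:E)%E ->
  exists I : R -> R,
   (forall t, 0 <= t <= T -> I t - I 0 <= M) /\
   forall n a b c, 0 <= a -> a <= b -> b <= T ->
     (forall t, a <= t <= b -> c <= beta n t) -> c * (b - a) <= I b - I a.
Proof.
move=> T0 bc b0 bF FM.
pose G t := esups (fun n => (beta n t)%:E) 0.
have Gge n t : ((beta n t)%:E <= G t)%E by apply: ereal_sup_ubound; exists n.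
have G0 t : (0 <= G t)%E by apply: le_trans (Gge 0%N t); rewrite lee_fin.
have mG D : measurable_fun D G.
  apply: measurable_fun_esups => n; apply/measurable_EFinP.
  by apply: measurable_funTS; exact: continuous_measurable_fun.
have GF t : 0 <= t <= T -> (G t <= F t)%E.
  by move=> tT; apply: ge_ereal_sup => _ [n _ <-]; exact: bF.
pose J t := (\int[mu]_(x in `[0%R, t]) G x)%E.
have Jmono a b : a <= b -> (J a <= J b)%E.
  move=> ab; apply: ge0_subset_integral => //; first exact: mG.
  by apply: subset_itvl; rewrite bnd_simp.
have J0 t : (0 <= J t)%E by apply: integral_ge0.
have JT : (J T <= M%:E)%E.
  apply: le_trans FM; apply: ge0_le_integral_nonmeasurable => // t /=.
have Jfin t : t <= T -> J t \is a fin_num.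
  move=> tT; rewrite ge0_fin_numE//; apply: le_lt_trans (Jmono _ _ tT) _.
  exact: le_lt_trans JT (ltry _).
exists (fun t => fine (J t)); split.
  move=> t /andP[t0 tT]; rewrite lerBlDr.
  apply: (@le_trans _ _ M); last by rewrite lerDl fine_ge0.
  rewrite -lee_fin fineK ?Jfin//; exact: le_trans (Jmono _ _ tT) JT.
move=> n a b c a0 ab bT cb.
rewrite lerBrDr -lee_fin EFinD !fineK ?Jfin// ?(le_trans ab)//.
rewrite [leRHS](_ : _ = J a + \int[mu]_(x in `]a, b]) G x)%E; last first.
  rewrite /J -ge0_integral_setU//=.
    by rewrite -itv_bndbnd_setU// bnd_simp.
    exact: mG.
  apply/disj_setPS => t [/=]; rewrite !in_itv/= => /andP[_ ta] /andP[ta' _].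
  by move: (lt_le_trans ta' ta); rewrite ltxx.
rewrite addeC; apply: leeD => //.
have [c0|c0] := ltP c 0.
  apply: (@le_trans _ _ 0%E); last by apply: integral_ge0.
  by rewrite lee_fin nmulr_rle0// subr_ge0.
have -> : ((c * (b - a))%:E = \int[mu]_(x in `]a, b]) (cst c%:E) x)%E.
  have muE : mu (`]a, b] : set R) = (b - a)%:E.
    rewrite lebesgue_measure_itv/= lte_fin; case: ltP => // ba.
    by have -> : a = b; [apply/eqP; rewrite eq_le ab | rewrite subrr].
  rewrite integral_cst; last exact: measurable_itv.
  rewrite EFinM; congr (_ * _)%E; exact/esym/muE.
apply: ge0_le_integral => //; first exact: mG.
move=> t /=; rewrite in_itv/= => /andP[/ltW ta tb].
by apply: le_trans (Gge n t); rewrite lee_fin cb// ta.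
Qed.

(** Contrary to the L^6 norm of [smoothed_free], these are continuous in time. *)
Definition free_mean (gamma : R) (d : phase R) (n : nat) (t : R) : R :=
  \int[TM]_x (fmean ((n, n), n) (smoothed_free gamma t d) x) ^+ 6.

Lemma smoothed_freeE gamma t (d : phase R) : smoothed_free gamma t d =
  multiplier (fun k => bracket2 R k `^ (gamma / 2)) (free_flow t d).1.
Proof.
apply/funext => k.
transitivity (multiplier (fun k => cos (t * Num.sqrt (bracket2 R k)))
    (multiplier (fun k => bracket2 R k `^ (gamma / 2)) d.1) k +
  multiplier (fun k => sin (t * Num.sqrt (bracket2 R k)) / Num.sqrt (bracket2 R k))
    (multiplier (fun k => bracket2 R k `^ (gamma / 2)) d.2) k) => //.
rewrite [RHS](_ : _ = multiplier (fun k => bracket2 R k `^ (gamma / 2))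
  (fun k => multiplier (fun k => cos (t * Num.sqrt (bracket2 R k))) d.1 k +
  multiplier (fun k => sin (t * Num.sqrt (bracket2 R k)) / Num.sqrt (bracket2 R k)) d.2 k) k)//.
by rewrite /multiplier mulrDr !(mulrCA ((_ `^ _)%:C)%C).
Qed.

Lemma free_mean_ge0 gamma d n t : 0 <= free_mean gamma d n t.
Proof. by apply: Rintegral_ge0 => // x _; exact: exprn_even_ge0. Qed.

Lemma continuous_free_mean gamma d n : continuous (free_mean gamma d n).
Proof.
move=> t; rewrite /free_mean /fmean.
have lin (p : R[i] -> R) (pC : forall (a b : R[i]), p (a + b) = p a + p b)
    (pM : forall (m : Z3 -> R) c k, p (multiplier m c k) = m k * p (c k)) k :
  p (multiplier (fejer R ((n, n), n)) (smoothed_free gamma t' d) k) @[t' --> t] -->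
  p (multiplier (fejer R ((n, n), n)) (smoothed_free gamma t d) k).
  pose om := Num.sqrt (bracket2 R k).
  pose J : Z3 -> R := fun k => bracket2 R k `^ (gamma / 2).
  have E t' : p (multiplier (fejer R ((n, n), n)) (smoothed_free gamma t' d) k) =
    fejer R ((n, n), n) k * (cos (t' * om) * p (multiplier J d.1 k) +
      sin (t' * om) / om * p (multiplier J d.2 k)).
    rewrite pM -(pM (fun k => cos (t' * Num.sqrt (bracket2 R k)))).
    by rewrite -(pM (fun k => sin (t' * Num.sqrt (bracket2 R k)) / Num.sqrt (bracket2 R k))) -pC.
  rewrite E (_ : (fun t' => _) = (fun t' => fejer R ((n, n), n) k *
    (cos (t' * om) * p (multiplier J d.1 k) + sin (t' * om) / om * p (multiplier J d.2 k)))); last first.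
    by apply/funext => t'; rewrite E.
  have ctom : (t' * om) @[t' --> t] --> (t * om) by apply: cvgM; [exact: cvg_id | exact: cvg_cst].
  apply: cvgM; first exact: cvg_cst.
  apply: cvgD.
    apply: cvgM; last exact: cvg_cst.
    by apply: continuous_cvg => //; exact: continuous_cos.
  apply: cvgM; last exact: cvg_cst.
  apply: cvgM; last exact: cvg_cst.
  by apply: continuous_cvg => //; exact: continuous_sin.
by apply: cvg_trigpoly6 => k; apply: lin => //; [exact: ReD | exact: Re_multiplier | exact: ImD | exact: Im_multiplier].
Qed.

(** Fejer means contract L^6, for any function with the given coefficients. *)
Lemma free_mean_le gamma d n t :
  ((free_mean gamma d n t)%:E <= Lnorm_distr 6%:E (smoothed_free gamma t d) ^+ 6)%E.
Proof.
set c := smoothed_free _ _ _; set b := free_mean _ _ _ _.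
have b0 : 0 <= b by exact: free_mean_ge0.
have H : ((b `^ 6^-1)%:E <= Lnorm_distr 6%:E c)%E.
  apply: le_ereal_inf_tmp => _ [f [fi fc] <-].
  rewrite Lnorm.unlock -poweR_EFin; apply: gt0_ler_poweR; rewrite ?invr_ge0//.
  - by rewrite in_itv/= leey lee_fin b0.
  - by rewrite in_itv/= leey andbT integral_ge0// => x _; rewrite poweR_ge0.
  have -> : (\int[TM]_x poweR `|(EFin \o f) x|%E 6 = \int[TM]_x (f x ^+ 6)%:E)%E.
    apply: eq_integral => x _; rewrite /= powR_mulrn//.
    by rewrite -normrX ger0_norm// exprn_even_ge0.
  apply: le_trans (fmean_contract6 ((n, n), n) fi).
  by rewrite (funext fc).
move: (Lnorm_distr _ _) H => [l||] // H.
  rewrite -EFin_expe; apply: (@poweR_invn_le _ _ _ 5); first by rewrite lee_fin.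
  by rewrite poweR_EFin.
rewrite (_ : (+oo ^+ 6 = +oo :> \bar R)%E) ?leey//.
Qed.

End SupIntegral.

(** * A Gronwall inequality *)

Section Gronwall.
Variable R : realType.

Lemma sqr_le_split (kappa q : R) : 0 < kappa -> q ^+ 2 <= kappa + q ^+ 6 / kappa ^+ 2.
Proof.
move=> k0; have -> : q ^+ 6 = (q ^+ 2) ^+ 3 by rewrite -exprM.
set y := q ^+ 2.
have y0 : 0 <= y by exact: sqr_ge0.
have [yk|ky] := leP y kappa.
  by apply: le_trans yk _; rewrite lerDl; apply: divr_ge0; [exact: exprn_ge0 | exact: sqr_ge0].
apply: (@le_trans _ _ (y ^+ 3 / kappa ^+ 2)); last by rewrite lerDr ltW.
rewrite ler_pdivlMr ?exprn_gt0// [y ^+ 3]exprS; apply: ler_wpM2l => //.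
by apply: ler_pow; exact: ltW.
Qed.

Lemma pow_le_1D6 (q : R) : q ^+ 2 <= 1 + q ^+ 6 /\ q ^+ 4 <= 1 + q ^+ 6.
Proof.
have q0 : 0 <= q ^+ 2 by exact: sqr_ge0.
have -> : q ^+ 6 = (q ^+ 2) ^+ 3 by rewrite -exprM.
have -> : q ^+ 4 = (q ^+ 2) ^+ 2 by rewrite -exprM.
set y := q ^+ 2 in q0 *.
have := sqr_ge0 (y - 1); rewrite sqrrB expr1n mulr1 => h.
have h2 := mulr_ge0 q0 h; split.
  have -> : y ^+ 3 = y * (y ^+ 2 - y *+ 2 + 1) + 2 * y ^+ 2 - y by ring.
  by nra.
have -> : y ^+ 3 = y * (y ^+ 2 - y *+ 2 + 1) + 2 * y ^+ 2 - y by ring.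
nra.
Qed.

(** Each energy is driven by the supremum of all of them, with a factor [q^2] that
    is only integrable in time. This factor is split into a constant [kappa],
    absorbed by the weight [exp (- L t)], and a part with small integral, so that
    a bound [m exp (L t)] of all energies improves to
    [(m / 2 + O(1 / N)) exp (L t)], and this is iterated. *)
Theorem sup_gronwall (C B P T M : R) : 0 < C -> 0 < B -> 0 < P -> 0 < T -> 0 <= M ->
  exists2 K1 : R, 0 <= K1 & forall (J : Type) (E dE : J -> R -> R)
    (beta : nat -> R -> R) (I : R -> R) (N m : R), 0 < N -> 0 <= m ->
  (forall j t, is_derive t (1 : R) (E j) (dE j t)) -> (forall j, E j 0 = 0) ->
  (forall j t, 0 <= t <= T -> E j t <= m) ->
  (forall n, continuous (beta n)) -> (forall n t, 0 <= beta n t) ->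
  (forall t, 0 <= t <= T -> I t - I 0 <= M) ->
  (forall n a b c, 0 <= a -> a <= b -> b <= T ->
     (forall t, a <= t <= b -> c <= beta n t) -> c * (b - a) <= I b - I a) ->
  (forall t S q, 0 <= t <= T -> (forall j, E j t <= S) -> 0 < q ->
     (forall n, beta n t <= q ^+ 6) -> B ^+ 6 <= q ^+ 6 ->
     forall j, dE j t <= (1 + C) * (q ^+ 2 * S) + C * ((q ^+ 4 + q ^+ 2 * P) / N)) ->
  forall j t, 0 <= t <= T -> E j t <= K1 / N.
Proof.
move=> C0 B0 P0 T0 M0.
have C10 : 0 < 1 + C by rewrite addr_gt0.
have B60 : 0 < B ^+ 6 by exact: exprn_gt0.
pose M1 := B ^+ 6 * T + M.
have M10 : 0 <= M1 by rewrite addr_ge0// mulr_ge0// ltW.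
(* With these values of [kappa] and [L], both parts of the Gronwall factor
   contribute at most [m / 4]. *)
pose kappa := 1 + 4 * (1 + C) * M1.
have k1 : 1 <= kappa by rewrite lerDl mulr_ge0// mulr_ge0// ltW.
have k0 : 0 < kappa by exact: lt_le_trans k1.
pose L := 4 * (1 + C) * kappa.
have L0 : 0 < L by rewrite !mulr_gt0.
pose K2 := C * (1 + P) * (M1 + T).
have K20 : 0 <= K2.
  apply: mulr_ge0; last by apply: addr_ge0 => //; exact: ltW.
  by apply/ltW/mulr_gt0 => //; exact: addr_gt0.
exists (2 * K2 * expR (L * T)); first by rewrite mulr_ge0 ?expR_ge0// mulr_ge0.
move=> J E dE beta I N m N0 m0 Ed E0 Em bc b0 IM Ib dEb.
have Ni : 0 <= N^-1 by rewrite invr_ge0 ltW.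
pose Q (a : R) := forall j t, 0 <= t <= T -> E j t <= a * expR (L * t).
have step a : 0 <= a -> Q a -> Q (a / 2 + K2 / N).
  move=> a0 Qa j t1 /andP[t10 t1T].
  pose A := (1 + C) * kappa * a.
  pose f t := E j t - A / L * expR (L * t).
  pose df t := dE j t - A * expR (L * t).
  have fd (t : R) : is_derive t (1 : R) f (df t).
    have H := @is_derive1_comp _ expR (fun z => L * z) t _ _ (is_derive_expR (L * t))
      (is_deriveZ L (is_derive_id t (1 : R))).
    have H' := is_deriveB (Ed j t) (is_deriveZ (A / L) H).
    apply: (is_derive_eq H'); rewrite /df; congr (_ - _).
    rewrite -![_ *: _]/(_ * _) mulr1.
    by field; rewrite gt_eqF.
  pose g0 := C * (1 + P) / N.
  have g00 : 0 < g0 by rewrite divr_gt0// mulr_gt0// addr_gt0.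
  pose c1 := (1 + C) * a * expR (L * t1) / kappa ^+ 2 + g0.
  have c1a : 0 <= (1 + C) * a * expR (L * t1) / kappa ^+ 2.
    by rewrite divr_ge0 ?sqr_ge0// mulr_ge0 ?expR_ge0// mulr_ge0// ltW.
  have c10 : 0 < c1 by rewrite ltr_wpDl.
  pose c0 := c1 * B ^+ 6 + g0.
  have c00 : 0 <= c0 by rewrite addr_ge0 ?(ltW g00)// mulr_ge0// ltW.
  have key : f t1 - f 0 <= c0 * t1 + c1 * (I t1 - I 0).
    apply: (integrate_sup_inequality t10 c10 fd bc b0).
      by move=> n x y c x0 xy yt; apply: Ib => //; exact: le_trans yt t1T.
    move=> t b /andP[t0 tt1] bb.
    have tT : 0 <= t <= T by rewrite t0 (le_trans tt1).
    have bge0 : 0 <= b by exact: le_trans (b0 0%N t) (bb 0%N).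
    have q60 : 0 < B ^+ 6 + b by rewrite ltr_wpDr.
    pose q := (B ^+ 6 + b) `^ 6^-1.
    have q0 : 0 < q by rewrite powR_gt0.
    have q6 : q ^+ 6 = B ^+ 6 + b.
      by rewrite -powR_mulrn ?powR_ge0// -powRrM mulVf ?pnatr_eq0// powRr1// ltW.
    have bq n : beta n t <= q ^+ 6.
      by rewrite q6; apply: le_trans (bb n) _; rewrite lerDr ltW.
    have Bq : B ^+ 6 <= q ^+ 6 by rewrite q6 lerDl.
    have H := dEb t _ q tT (fun j => Qa j t tT) q0 bq Bq j.
    have [h2 h4] := pow_le_1D6 q.
    have hk := sqr_le_split q k0.
    have S0 : 0 <= (1 + C) * (a * expR (L * t)).
      by rewrite mulr_ge0 ?(ltW C10)// mulr_ge0 ?expR_ge0.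
    have e1 : expR (L * t) <= expR (L * t1) by rewrite ler_expR ler_pM2l.
    have D1 : (1 + C) * (q ^+ 2 * (a * expR (L * t))) <=
        A * expR (L * t) + (1 + C) * a * expR (L * t1) / kappa ^+ 2 * q ^+ 6.
      have := ler_wpM2l S0 hk; rewrite mulrDr => D.
      rewrite [leLHS](_ : _ = (1 + C) * (a * expR (L * t)) * q ^+ 2); last by ring.
      apply: le_trans D _; apply: lerD.
        by rewrite /A; apply: eq_le_real; ring.
      rewrite [leLHS](_ : _ = (1 + C) * a * (q ^+ 6 / kappa ^+ 2) * expR (L * t)); last by ring.
      rewrite [leRHS](_ : _ = (1 + C) * a * (q ^+ 6 / kappa ^+ 2) * expR (L * t1)); last by ring.
      apply: ler_wpM2l => //.
      by rewrite mulr_ge0// ?divr_ge0 ?sqr_ge0 ?q6 ?(ltW q60)// mulr_ge0// ltW.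
    have D2 : C * ((q ^+ 4 + q ^+ 2 * P) / N) <= g0 * (1 + q ^+ 6).
      rewrite /g0 [leRHS](_ : _ = C * ((1 + P) * (1 + q ^+ 6) / N)); last by ring.
      apply: ler_wpM2l; first exact: ltW.
      apply: ler_wpM2r => //.
      have := ler_wpM2r (ltW P0) h2; rewrite mulrDl; lra.
    rewrite /df /c0; move: q6 => /(congr1 (fun y => c1 * y)); rewrite mulrDr => q6.
    rewrite addrAC -q6 {1}/c1 mulrDl.
    rewrite mulrDr mulr1 in D2; lra.
  rewrite /f E0 mulr0 expR0 mulr1 sub0r opprK in key.
  have t1T' : 0 <= t1 <= T by rewrite t10.
  have k2 := ler_wpM2l (ltW c10) (IM _ t1T').
  have k3 := ler_wpM2l c00 t1T.
  have AL : A / L = a / 4 by rewrite /A /L; field; rewrite !gt_eqF.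
  have c1M : c1 * M1 <= a / 4 * expR (L * t1) + g0 * M1.
    rewrite /c1 mulrDl lerD2r -mulrA [leLHS](_ : _ = (a * expR (L * t1)) * ((1 + C) * M1 / kappa ^+ 2)); last by ring.
    rewrite [leRHS](_ : _ = (a * expR (L * t1)) * 4^-1); last by ring.
    apply: ler_wpM2l; first by rewrite mulr_ge0// expR_ge0.
    rewrite ler_pdivrMr ?exprn_gt0//.
    have : kappa <= kappa ^+ 2 by rewrite expr2 ler_peMr// ltW.
    have : 4 * (1 + C) * M1 <= kappa by rewrite /kappa lerDr.
    lra.
  have e1 : 1 <= expR (L * t1) by rewrite -expR0 ler_expR mulr_ge0// ltW.
  have K2N : 0 <= K2 / N by rewrite mulr_ge0.
  have K2e := ler_peMr K2N e1.
  have K2E : K2 / N = g0 * M1 + g0 * T by rewrite /K2 /g0; ring.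
  have c0T : c0 * T + c1 * M = c1 * M1 + g0 * T by rewrite /c0 /M1; ring.
  have A0 : 0 <= A / L by rewrite AL divr_ge0.
  rewrite AL in key A0; rewrite mulrDl; lra.
have iter n : Q (2 * (K2 / N) + m / 2 ^+ n).
  elim: n => [|n ih].
    move=> j t tT; apply: le_trans (Em j t tT) _; rewrite expr0 divr1.
    have e1 : 1 <= expR (L * t).
      by case/andP: tT => t0 _; rewrite -expR0 ler_expR mulr_ge0// ltW.
    have K2N : 0 <= 2 * (K2 / N) + m by rewrite addr_ge0// mulr_ge0// mulr_ge0.
    apply: le_trans (ler_peMr K2N e1); rewrite lerDr mulr_ge0// mulr_ge0//.
  rewrite (_ : 2 * (K2 / N) + _ = (2 * (K2 / N) + m / 2 ^+ n) / 2 + K2 / N).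
    apply: step => //; rewrite addr_ge0//; first by rewrite mulr_ge0// mulr_ge0.
    by rewrite divr_ge0// exprn_ge0.
  by rewrite exprS invfM; field; rewrite gt_eqF ?exprn_gt0// gt_eqF.
move=> j t tT.
have lim : (2 * (K2 / N) + m / 2 ^+ n) * expR (L * t) @[n --> \oo] --> (2 * (K2 / N) + m * 0) * expR (L * t).
  apply: cvgM; last exact: cvg_cst.
  apply: cvgD; first exact: cvg_cst.
  apply: cvgM; first exact: cvg_cst.
  under eq_fun do rewrite -exprVn.
  by apply: cvg_expr; rewrite gtr0_norm; lra.
have : E j t <= (2 * (K2 / N) + m * 0) * expR (L * t).
  by apply: (cvgr_to_ge lim); apply: nearW => n; exact: iter.
move/le_trans; apply; rewrite mulr0 addr0.
case/andP: tT => t0 tT.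
rewrite (_ : 2 * K2 * expR (L * T) / N = 2 * (K2 / N) * expR (L * T)); last by ring.
apply: ler_wpM2l; first by rewrite mulr_ge0// mulr_ge0.
by rewrite ler_expR ler_pM2l.
Qed.

End Gronwall.

(** * The energy of the difference *)

Section Energy.
Variable R : realType.
Implicit Types (s : seq Z3) (k : Z3) (v : phase R).

(** The squared norm in L^2 x H^(-1), restricted to finitely many modes so that it
    can be differentiated. *)
Definition energy s v : R := \sum_(k <- s) (csq (v.1 k) + (bracket2 R k)^-1 * csq (v.2 k)).

(** The time derivative of the energy. The linear part of the equation conserves
    the energy, and only the forcing [G] remains. *)
Definition energy' s v (G : distr R) : R :=
  \sum_(k <- s) - (2 * (bracket2 R k)^-1 *
    (complex.Re (v.2 k) * complex.Re (G k) + complex.Im (v.2 k) * complex.Im (G k))).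

Lemma is_derive_csq (z : R -> R[i]) (dz : R[i]) (t : R) : is_cderive z t dz ->
  is_derive t (1 : R) (fun t => csq (z t))
    (2 * (complex.Re (z t) * complex.Re dz + complex.Im (z t) * complex.Im dz)).
Proof.
move=> [dR dI]; have H := is_deriveD (is_deriveX 2 dR) (is_deriveX 2 dI).
by apply: (is_derive_eq H); rewrite /= !expr1 -![_ *: _]/(_ * _); ring.
Qed.

Lemma is_derive_energy s (V : R -> phase R) (G : distr R) (t : R) :
  (forall k, is_cderive (fun t => (V t).1 k) t ((V t).2 k)) ->
  (forall k, is_cderive (fun t => (V t).2 k) t (- ((bracket2 R k)%:C%C * (V t).1 k) - G k)) ->
  is_derive t (1 : R) (fun t => energy s (V t)) (energy' s (V t) G).
Proof.
move=> d1 d2; rewrite /energy /energy'; elim: s => [|k s ih].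
  by under eq_fun do rewrite big_nil; rewrite big_nil; exact: is_derive_cst.
under eq_fun do rewrite big_cons; rewrite big_cons.
apply: is_deriveD.
have b0 := bracket2_gt0 R k; have bn : bracket2 R k != 0 by rewrite gt_eqF.
have H := is_deriveD (is_derive_csq (d1 k)) (is_deriveZ (bracket2 R k)^-1 (is_derive_csq (d2 k))).
apply: (is_derive_eq H); rewrite ReB ImB -![_ *: _]/(_ * _).
have rN (a : R[i]) : complex.Re (- a) = - complex.Re a by case: a.
have iN (a : R[i]) : complex.Im (- a) = - complex.Im a by case: a.
rewrite rN iN -[_%:C%C * _]/(multiplier (bracket2 R) (V t).1 k) Re_multiplier Im_multiplier.
by field.
Qed.

(** The quadratic inequality between means with parameter [tau], which is later
    taken of the size of the Gronwall factor at each time. *)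
Lemma energy'_le s v (G : distr R) (tau : R) : 0 < tau ->
  energy' s v G <= tau * energy s v + (\sum_(k <- s) (bracket2 R k)^-1 * csq (G k)) / tau.
Proof.
move=> t0; rewrite /energy' /energy mulr_sumr mulr_suml -big_split /=; apply: ler_sum => k _.
have bi : 0 <= (bracket2 R k)^-1 by rewrite invr_ge0 ltW// bracket2_gt0.
set b := (bracket2 R k)^-1 in bi *.
have h (x y : R) : - (2 * (x * y)) <= tau * x ^+ 2 + y ^+ 2 / tau.
  rewrite -subr_ge0 (_ : _ - _ = (tau * x + y) ^+ 2 / tau); last by field; rewrite gt_eqF.
  by rewrite divr_ge0 ?sqr_ge0// ltW.
have c0 : 0 <= tau * csq (v.1 k) by rewrite mulr_ge0 ?csq_ge0// ltW.
have hR := ler_wpM2l bi (h (complex.Re (v.2 k)) (complex.Re (G k))).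
have hI := ler_wpM2l bi (h (complex.Im (v.2 k)) (complex.Im (G k))).
move: c0 hR hI; rewrite /csq; set t' := tau^-1 => c0 hR hI.
have := lerD c0 (lerD hR hI); rewrite add0r => H.
apply: le_trans (le_trans _ H) _; apply: eq_le_real; ring.
Qed.

Lemma csqB_le (a b : R[i]) : csq (a - b) <= 2 * csq a + 2 * csq b.
Proof.
rewrite (_ : csq b = csq (- b)); first exact: csqD_le.
by case: b => x y; rewrite /csq /= !sqrrN.
Qed.

End Energy.

Theorem proposition1p4 (R : realType) (psi : R -> R) (hpsi : is_cutoff psi) :
  exists gamma0 : R, 0 < gamma0 < 2^-1 /\
  forall gamma : R, gamma0 < gamma < 2^-1 ->
  forall mu : probability (g_sigma_algebraType (@cylinders R)) R,
  randomized_law mu ->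
  forall (Phi : R -> phase R -> phase R)
         (PhiN : nat -> R -> phase R -> phase R),
  is_nlkg_flow id (Sigma gamma) Phi ->
  (forall N : nat, (0 < N)%N ->
     is_nlkg_flow (truncation psi N) (Sigma gamma) (PhiN N)) ->
  forall eps : R, 0 < eps ->
  forall C c theta : R, 0 < C -> 0 < c -> 0 < theta ->
  apriori_bounds psi gamma eps mu Phi PhiN C c theta ->
  forall CT : R -> R, (forall T, 0 < T -> 0 < CT T) ->
  exists (K : R -> R -> R -> R) (eps1 : nat -> R),
    (eps1 n @[n --> \oo] --> 0) /\
    forall lam r T : R, 0 < lam -> 0 < r -> 0 < T ->
    forall d : phase R,
    (Sigma_lambda gamma eps C CT Phi PhiN T lam `&` phase_ball 2^-1 r) d ->
    forall N : nat, (0 < N)%N ->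
    (ereal_sup [set phase_norm 2^-1 (Phi t d - PhiN N t d)%R |
                t in `[0%R, T]] <= (K lam T r * eps1 N)%:E)%E.
Proof.
have [Cn Cn0 estimate] := nonlinear_estimate hpsi.
exists 4^-1; split; first by apply/andP; split; lra.
move=> gamma /andP[g0 g1] mu _ Phi PhiN flow flowN eps eps0 C c theta C0 _ _ _ CT CT0.
pose eps1 (N : nat) : R := Num.sqrt (Num.sqrt N%:R^-1).
have eps1_cvg : eps1 n @[n --> \oo] --> 0.
  have h : (n%:R^-1 : R) @[n --> \oo] --> (0 : R).
    by rewrite -(cvg_shiftS (fun n => n%:R^-1 : R)); exact: cvg_harmonic.
  have := continuous_cvg _ (@sqrt_continuous R _) (continuous_cvg _ (@sqrt_continuous R _) h).
  have FF : Filter (\oo : set_system nat) by exact: eventually_filter.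
  by move=> /(_ FF FF); rewrite !sqrtr0.
(* The constant is first found for each value of the three parameters. *)
suff main : forall p : R * R * R, exists K : R, 0 < p.1.1 -> 0 < p.2 -> 0 < p.1.2 ->
    0 <= K /\ forall d : phase R,
    (Sigma_lambda gamma eps C CT Phi PhiN p.1.2 p.1.1 `&` phase_ball 2^-1 p.2) d ->
    forall N : nat, (0 < N)%N -> forall t, 0 <= t <= p.1.2 ->
    (phase_norm 2^-1 (Phi t d - PhiN N t d)%R <= (K * eps1 N)%:E)%E.
  have [K HK] := choice main.
  exists (fun lam T r => K (lam, T, r)), eps1; split => // lam r T lam0 r0 T0 d dS N N0.
  have [_ H] := HK (lam, T, r) lam0 r0 T0.
  by apply: ge_ereal_sup => _ [t tT <-]; apply: H => //; move: tT; rewrite /= in_itv.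
move=> [[lam T] r] /=.
pose B := C * (lam + T) `^ (1 + eps).
pose P := 4 * r ^+ 2 + 2 * B ^+ 2.
pose M := (CT T * lam) ^+ 6.
have [[lam0 [r0 T0]]|npos] := pselect (0 < lam /\ 0 < r /\ 0 < T); last first.
  by exists 0 => l0 r0 T0; exfalso; apply: npos.
have B0 : 0 < B by rewrite mulr_gt0// powR_gt0// addr_gt0.
have P0 : 0 < P by rewrite addr_gt0// mulr_gt0// exprn_gt0.
have M0 : 0 <= M by rewrite exprn_ge0// mulr_ge0 ?(ltW (CT0 _ T0))// ltW.
have [K1 K10 gron] := sup_gronwall Cn0 B0 P0 T0 M0.
exists (Num.sqrt (K1 + 4 * B ^+ 2)) => _ _ _; split; first exact: sqrtr_ge0.
move=> d [[dSigma dB dL6] [_ dr]] N N0.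
have N0' : 0 < N%:R :> R by rewrite ltr0n.
have [Phi0 _ [F solF]] := flow d dSigma.
have [PhiN0 _ [FN solFN]] := flowN N N0 d dSigma.
pose z t := (free_flow t d).1.
pose V t : phase R := (Phi t d - PhiN N t d)%R.
have Vd1 t k : is_cderive (fun t => (V t).1 k) t ((V t).2 k).
  have [_ /(_ k)[[a1 a2] _]] := solF t; have [_ /(_ k)[[b1 b2] _]] := solFN t.
  split.
  - have -> : (fun t => complex.Re ((V t).1 k)) =
      (fun t => complex.Re ((Phi t d).1 k) - complex.Re ((PhiN N t d).1 k)).
      by apply/funext => t'; exact: ReB.
    by apply: (is_derive_eq (is_deriveB a1 b1)); rewrite -ReB.
  - have -> : (fun t => complex.Im ((V t).1 k)) =
      (fun t => complex.Im ((Phi t d).1 k) - complex.Im ((PhiN N t d).1 k)).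
      by apply/funext => t'; exact: ImB.
    by apply: (is_derive_eq (is_deriveB a2 b2)); rewrite -ImB.
pose G t : distr R := fun k => F t k - truncation psi N (FN t) k.
have Vd2 t k : is_cderive (fun t => (V t).2 k) t (- ((bracket2 R k)%:C%C * (V t).1 k) - G t k).
  have [_ /(_ k)[_ [a1 a2]]] := solF t; have [_ /(_ k)[_ [b1 b2]]] := solFN t.
  have E : - ((bracket2 R k)%:C%C * (V t).1 k) - G t k =
     (- ((bracket2 R k)%:C%C * (Phi t d).1 k) - F t k) -
     (- ((bracket2 R k)%:C%C * (PhiN N t d).1 k) - truncation psi N (FN t) k).
    by rewrite (_ : (V t).1 k = (Phi t d).1 k - (PhiN N t d).1 k)// /G; ring.
  split.
  - have -> : (fun t => complex.Re ((V t).2 k)) =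
      (fun t => complex.Re ((Phi t d).2 k) - complex.Re ((PhiN N t d).2 k)).
      by apply/funext => t'; exact: ReB.
    by apply: (is_derive_eq (is_deriveB a1 b1)); rewrite -ReB E.
  - have -> : (fun t => complex.Im ((V t).2 k)) =
      (fun t => complex.Im ((Phi t d).2 k) - complex.Im ((PhiN N t d).2 k)).
      by apply/funext => t'; exact: ImB.
    by apply: (is_derive_eq (is_deriveB a2 b2)); rewrite -ImB E.
have Bt t : 0 <= t <= T -> C * (lam + `|t|) `^ (1 + eps) <= B.
  move=> /andP[t0 tT]; apply: ler_wpM2l; first exact: ltW.
  apply: ge0_ler_powR; rewrite ?nnegrE ?addr_ge0 ?(ltW lam0) ?(ltW T0)//.
    exact: ltW.
  by rewrite lerD2l ger0_norm.
have H1 (W : phase R) t : 0 <= t <= T ->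
    (phase_norm 1 W <= (C * (lam + `|t|) `^ (1 + eps))%:E)%E ->
    forall s, uniq s -> \sum_(k <- s) (bracket2 R k * csq (W.1 k) + csq (W.2 k)) <= B ^+ 2.
  move=> tT WB s us.
  have WB' : (phase_norm 1 W <= B%:E)%E by apply: le_trans WB _; rewrite lee_fin Bt.
  apply: le_trans (phase_norm_ge_sum WB' us); apply: eq_le_real.
  apply: eq_bigr => k _; have b0 := bracket2_gt0 R k.
  by rewrite subrr powRr0 mul1r powRr1// ltW.
have w1 t s : 0 <= t <= T -> uniq s ->
    \sum_(k <- s) (bracket2 R k * csq ((Phi t d - free_flow t d).1 k) +
       csq ((Phi t d - free_flow t d).2 k)) <= B ^+ 2.
  by move=> tT; apply: (H1 _ t tT); have [] := dB t.
have w2 t s : 0 <= t <= T -> uniq s ->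
    \sum_(k <- s) (bracket2 R k * csq ((PhiN N t d - free_flow t d).1 k) +
       csq ((PhiN N t d - free_flow t d).2 k)) <= B ^+ 2.
  by move=> tT; apply: (H1 _ t tT); have [_ _ /(_ N N0)[]] := dB t.
have half s (W : phase R) : \sum_(k <- s) bracket2 R k * csq (W.1 k) <=
    \sum_(k <- s) (bracket2 R k * csq (W.1 k) + csq (W.2 k)).
  by apply: ler_sum => k _; rewrite lerDl csq_ge0.
have VH t s : 0 <= t <= T -> uniq s ->
    \sum_(k <- s) (bracket2 R k * csq ((V t).1 k) + csq ((V t).2 k)) <= 4 * B ^+ 2.
  move=> tT us; pose w := Phi t d - free_flow t d; pose wN := PhiN N t d - free_flow t d.
  have hk k : bracket2 R k * csq ((V t).1 k) + csq ((V t).2 k) <=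
      2 * ((bracket2 R k * csq (w.1 k) + csq (w.2 k)) + (bracket2 R k * csq (wN.1 k) + csq (wN.2 k))).
    have b0 := ltW (bracket2_gt0 R k).
    have e1 : (V t).1 k = w.1 k - wN.1 k.
      transitivity ((Phi t d).1 k - (PhiN N t d).1 k) => //.
      transitivity (((Phi t d).1 k - (free_flow t d).1 k) - ((PhiN N t d).1 k - (free_flow t d).1 k)) => //.
      by ring.
    have e2 : (V t).2 k = w.2 k - wN.2 k.
      transitivity ((Phi t d).2 k - (PhiN N t d).2 k) => //.
      transitivity (((Phi t d).2 k - (free_flow t d).2 k) - ((PhiN N t d).2 k - (free_flow t d).2 k)) => //.
      by ring.
    rewrite e1 e2; have h1 := ler_wpM2l b0 (csqB_le (w.1 k) (wN.1 k)).
    apply: le_trans (lerD h1 (csqB_le (w.2 k) (wN.2 k))) _.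
    by apply: eq_le_real; ring.
  apply: (@le_trans _ _ (2 * (B ^+ 2 + B ^+ 2))); last by apply: eq_le_real; ring.
  apply: le_trans (ler_wpM2l _ (lerD (w1 t s tT us) (w2 t s tT us))) => //.
  rewrite -big_split mulr_sumr; apply: ler_sum => k _; exact: hk.
have VE t s : energy s (V t) <= \sum_(k <- s) (bracket2 R k * csq ((V t).1 k) + csq ((V t).2 k)).
  apply: ler_sum => k _; have b0 := bracket2_gt0 R k; have b1 := bracket2_ge1 R k.
  apply: lerD; first by rewrite ler_peMl ?csq_ge0.
  by rewrite ler_piMl ?csq_ge0// invf_le1.
have [I [IM Ib]] : exists I : R -> R,
   (forall t, 0 <= t <= T -> I t - I 0 <= M) /\
   forall n a b c, 0 <= a -> a <= b -> b <= T ->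
     (forall t, a <= t <= b -> c <= free_mean gamma d n t) -> c * (b - a) <= I b - I a.
  have F0 n t : ((free_mean gamma d n t)%:E <= Lnorm_distr 6%:E (smoothed_free gamma t d) ^+ 6)%E.
    exact: free_mean_le.
  have FM : (\int[@lebesgue_measure R]_(t in `[0%R, T])
      (Lnorm_distr 6%:E (smoothed_free gamma t d) ^+ 6)%E <= M%:E)%E.
    apply: (poweR_invn_le (n := 5)) dL6; apply: integral_ge0 => t _.
    by apply: le_trans (F0 0%N t); rewrite lee_fin free_mean_ge0.
  have := sup_integral (ltW T0) (@continuous_free_mean R gamma d) (@free_mean_ge0 R gamma d)
    (fun n t _ => F0 n t) FM.
  exact: id.
have EK (j : {s : seq Z3 | uniq s}) t : 0 <= t <= T -> energy (sval j) (V t) <= K1 / N%:R.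
  move: j t.
  apply: (gron {s : seq Z3 | uniq s} (fun j t => energy (sval j) (V t))
    (fun j t => energy' (sval j) (V t) (G t)) (free_mean gamma d) I N%:R (4 * B ^+ 2)) => //.
  - by rewrite mulr_ge0// sqr_ge0.
  - by move=> j t; apply: is_derive_energy => k; [exact: Vd1 | exact: Vd2].
  - move=> j; rewrite /V Phi0 PhiN0 subrr /energy big1// => k _.
    by rewrite /csq /= expr0n/= addr0 mulr0 addr0.
  - by move=> j t tT; apply: le_trans (VE _ _) (VH _ _ tT (svalP j)).
  - exact: continuous_free_mean.
  - exact: free_mean_ge0.
  move=> t S q tT ES q0 bq Bq j.
  have BB : B ^+ 2 <= q ^+ 2.
    rewrite -(ler_pXn2r (n := 3)) ?nnegrE ?sqr_ge0//.
    by rewrite -!exprM.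
  have [cF _] := solF t; have [cFN _] := solFN t.
  have q2 : 0 < q ^+ 2 by exact: exprn_gt0.
  have est := estimate gamma q P S N (z t) (Phi t d).1 (PhiN N t d).1 (F t) (FN t) _ N0 q0 P0 cF cFN _ _ _ _ _ _ (svalP j).
  apply: le_trans (energy'_le _ _ _ q2) _.
  have Ej := ler_wpM2l (ltW q2) (ES j).
  have Gj : (\sum_(k <- sval j) (bracket2 R k)^-1 * csq (G t k)) / q ^+ 2 <=
      Cn * (q ^+ 4 / N%:R + q ^+ 2 * (P / N%:R + S)).
    rewrite ler_pdivrMr//; apply: le_trans (est _ _ _ _ _ _) _.
    - by apply/andP; split; clear -g0 g1; lra.
    - by move=> n; rewrite -smoothed_freeE; exact: bq.
    - move=> s us; apply: le_trans BB; exact: le_trans (half s (Phi t d - free_flow t d)) (w1 t s tT us).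
    - move=> s us; apply: le_trans BB; exact: le_trans (half s (PhiN N t d - free_flow t d)) (w2 t s tT us).
    - move=> s us; rewrite /P.
      have h1 := free_flow_bound t dr us.
      have h2 := le_trans (half s (Phi t d - free_flow t d)) (w1 t s tT us).
      apply: (@le_trans _ _ (2 * (2 * r ^+ 2) + 2 * B ^+ 2)); last by rewrite lerD2r mulrA -natrM.
      apply: le_trans (lerD (ler_wpM2l _ h1) (ler_wpM2l _ h2)) => //.
      rewrite !mulr_sumr -big_split /=; apply: ler_sum => k _.
      have b0 := bracket2_gt0 R k; have b1 := bracket2_ge1 R k.
      have -> : (Phi t d).1 k = (free_flow t d).1 k + (Phi t d - free_flow t d).1 k.
        by rewrite [RHS]addrC; exact/esym/subrK.
      apply: le_trans (ler_wpM2l (powR_ge0 _ _) (csqD_le _ _)) _; rewrite mulrDr.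
      apply: lerD; rewrite mulrCA; apply: ler_wpM2l => //.
      apply: ler_wpM2r; first exact: csq_ge0.
      by rewrite -[leRHS](powRr1 (ltW b0)); apply: ler_powR => //; lra.
    - move=> s us; apply: le_trans (ES (exist _ s us)); apply: ler_sum => k _ /=.
      by rewrite lerDl mulr_ge0 ?csq_ge0// invr_ge0 ltW// bracket2_gt0.
    by apply: eq_le_real; ring.
  apply: le_trans (lerD Ej Gj) _; apply: eq_le_real; ring.
move=> t tT.
pose rho := Num.sqrt (N%:R^-1 : R).
have rho0 : 0 < rho by rewrite sqrtr_gt0 invr_gt0.
have rho2 : rho ^+ 2 = N%:R^-1 by rewrite sqr_sqrtr// invr_ge0 ltW.
have KB : 0 <= K1 + 4 * B ^+ 2 by rewrite addr_ge0// mulr_ge0// sqr_ge0.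
apply: phase_norm_le_sum; first by rewrite mulr_ge0// sqrtr_ge0.
move=> s us; rewrite exprMn sqr_sqrtr// /eps1 sqr_sqrtr ?sqrtr_ge0// -/rho.
have ri : 0 < rho^-1 by rewrite invr_gt0.
apply: le_trans (interpolate_half ri (EK (exist _ s us) t tT) (VH t s tT us)) _.
rewrite invrK mulrDl -rho2; apply: eq_le_real.
by field; rewrite gt_eqF.
Qed.
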